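(* Let $a,b\in\mathbb{C}$, $c,c-a\in\mathbb{C}\setminus\mathbb{Z}_{\leqslant 0}$ and $\delta\in(0,\frac{\pi}{2}]$. Let $x\in\mathbb{C}$ with $x\neq 1$, $|\arg(1-x)|<\pi$. Then, as $y\to\infty$ in the sector $|\arg(-y)|\leqslant\frac{\pi}{2}-\delta$, $$\Phi_1[a,b;c;x,y]\sim\frac{\Gamma(c)}{\Gamma(c-a)}\sum_{n=0}^{\infty}{}_2F_1\left[\begin{matrix}-n,b\\ c-a-n\end{matrix};x\right]\frac{(a)_n(a-c+1)_n}{n!}(-y)^{-a-n}.$$
   Context: $(\alpha)_n=\Gamma(\alpha+n)/\Gamma(\alpha)$ is the Pochhammer symbol, ${}_2F_1$ the (principal branch of the) Gauss hypergeometric function, powers take principal values, and $\sim$ denotes a Poincar\'e asymptotic expansion for fixed $x$ and parameters. The Humbert function $\Phi_1$ is defined for $|x|<1$, $y\in\mathbb{C}$ by $$\Phi_1[a,b;c;x,y]=\sum_{m,n=0}^{\infty}\frac{(a)_{m+n}(b)_m}{(c)_{m+n}}\frac{x^m}{m!}\frac{y^n}{n!},$$ and is continued analytically to all $x\in\mathbb{C}\setminus[1,\infty)$, $y\in\mathbb{C}$ by $$\Phi_1[a,b;c;x,y]=\sum_{n=0}^{\infty}\frac{(a)_n}{(c)_n}\,{}_2F_1\left[\begin{matrix}a+n,b\\ c+n\end{matrix};x\right]\frac{y^n}{n!}.$$ When $c-a$ is a positive integer, the product $(a-c+1)_n\,{}_2F_1[-n,b;c-a-n;x]$ is understood by continuity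 in the parameters, i.e. as the polynomial $\sum_{k=0}^{n}(-1)^k\frac{(-n)_k(b)_k}{k!}(a-c+1)_{n-k}x^k$. *)

(* Defs.v *)
From Stdlib Require Import Reals Factorial ClassicalEpsilon.
From Coquelicot Require Import Coquelicot.

Open Scope C_scope.

(** * Principal argument, exponential, logarithm and power *)

(** Principal argument, with values in (-PI, PI]; the value at 0 is junk. *)
Definition Carg (z : C) : R :=
  if Rle_dec 0 (Im z) then acos (Re z / Cmod z) else (- acos (Re z / Cmod z))%R.

Definition Cexp (z : C) : C :=
  RtoC (exp (Re z)) * (cos (Im z), sin (Im z)).

Definition Clog (z : C) : C := (ln (Cmod z), Carg z).

(** Principal value of [z ^ w], meaningful for [z <> 0]; Coquelicot's [Cpow]
    is the power with natural exponent. *)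
Definition Cpower (z w : C) : C := Cexp (w * Clog z).

(** * Limits and sums of complex sequences (meaningful when they converge) *)

Definition CLim_seq (u : nat -> C) : C :=
  (real (Lim_seq (fun n => Re (u n))), real (Lim_seq (fun n => Im (u n)))).

Definition CSeries (u : nat -> C) : C :=
  (Series (fun n => Re (u n)), Series (fun n => Im (u n))).

(** * Pochhammer symbol and Gamma function *)

Definition Cnat (n : nat) : C := RtoC (INR n).

Definition nonpos_int (z : C) : Prop := exists n : nat, z = - Cnat n.

Definition pos_int (z : C) : Prop := exists n : nat, z = Cnat (S n).

(** [z (z+1) ... (z+n-1)], which is Gamma(z+n)/Gamma(z) extended by continuity
    to the nonpositive integers [z]. *)
Fixpoint poch (z : C) (n : nat) : C :=
  match n with
  | O => 1
  | S m => poch z m * (z + Cnat m)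
  end.

Definition Cfact (n : nat) : C := Cnat (fact n).

(** Euler's limit formula n! n^z / (z (z+1) ... (z+n)), valid for every [z]
    that is not a nonpositive integer. *)
Definition CGamma (z : C) : C :=
  CLim_seq (fun n => Cfact n * Cpower (Cnat n) z / poch z (S n)).

(** * Gauss hypergeometric function, principal branch *)

Definition cut_plane (x : C) : Prop := x <> 1 /\ (Rabs (Carg (1 - x)) < PI)%R.

Definition analytic_on (D : C -> Prop) (f : C -> C) : Prop :=
  forall z0 : C, D z0 ->
  exists (r : R) (u : nat -> C), (0 < r)%R /\
    forall z : C, (Cmod (z - z0) < r)%R ->
      is_pseries (K := C_AbsRing) (V := C_NormedModule) u (z - z0) (f z).

Definition gauss_coef (a b c : C) (n : nat) : C :=
  poch a n * poch b n / (poch c n * Cfact n).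

Definition is_hyp2f1 (a b c : C) (f : C -> C) : Prop :=
  analytic_on cut_plane f /\
  forall x : C, (Cmod x < 1)%R ->
    is_pseries (K := C_AbsRing) (V := C_NormedModule) (gauss_coef a b c) x (f x).

(** The analytic continuation of the Gauss series from the unit disk to the
    plane cut along [1, +oo). When [c] is not a nonpositive integer it exists,
    and its values on [cut_plane] are unique; elsewhere the value is junk. *)
Definition hyp2f1 (a b c : C) : C -> C :=
  epsilon (inhabits (fun _ : C => RtoC 0)) (is_hyp2f1 a b c).

(** * Humbert function Phi_1 on the cut plane *)

(** The expansion in powers of [y] that continues the double series from
    [|x| < 1] to all [x] in the cut plane. *)
Definition Phi1 (a b c x y : C) : C :=
  CSeries (fun n =>
    poch a n / poch c n * hyp2f1 (a + Cnat n) b (c + Cnat n) x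
      * (y ^ n / Cfact n)).

(** The product (a-c+1)_n 2F1[-n, b; c-a-n; x]. When [c - a] is a positive
    integer, 2F1 may be undefined while (a-c+1)_n vanishes; the product is then
    the polynomial obtained by continuity in the parameters. *)
Definition poch_hyp2f1 (a b c x : C) (n : nat) : C :=
  if excluded_middle_informative (pos_int (c - a)) then
    sum_n (fun k =>
      (- (1)) ^ k * (poch (- Cnat n) k * poch b k / Cfact k)
        * poch (a - c + 1) (n - k) * x ^ k) n
  else
    poch (a - c + 1) n * hyp2f1 (- Cnat n) b (c - a - Cnat n) x.

(** * Poincare asymptotic expansions *)

(** [f ~ sum_n u n * phi n] with respect to the asymptotic sequence [phi], as
    the variable tends to infinity in [D]: the remainder after the term of
    index [N] is o(phi N), for every [N]. *)
Definition poincare_expansion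
    (D : C -> Prop) (f : C -> C) (u : nat -> C) (phi : nat -> C -> C) : Prop :=
  forall (N : nat) (eps : R), (0 < eps)%R ->
  exists M : R, forall y : C, D y -> (M <= Cmod y)%R ->
    Rle (Cmod (f y - sum_n (fun n => u n * phi n y) N)) (eps * Cmod (phi N y)).

(* Main.v *)
Require Import Defs.
From Stdlib Require Import Reals Arith ClassicalEpsilon Lia Psatz.
From Coquelicot Require Import Coquelicot.

(** Write [z = - y] and [d = c - a].

    When [Re a > 1] and [Re d > 1], summing Euler's integrals of the Gauss
    functions gives
    [[
      B(a, d) Phi1(x, -z) = int_0^1 t^(a-1) (1-t)^(d-1) (1 - x t)^(-b) e^(-z t) dt
    ]]
    ([Phi1_base]), and Watson's lemma applies ([watson_base]): the smooth factor
    [(1-t)^(d-1) (1 - x t)^(-b)] has the Taylor coefficients [hsum], and each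
    Laplace integral of [t^(a+n-1)] over the unit interval is
    [Gamma(a+n) z^(-a-n)] up to an exponentially small error in the sector
    ([laplace_int_asym]). The expansion therefore has the coefficients [ucoef],
    and reversing Pochhammer symbols identifies [n! hsum n] with the
    polynomials of the statement ([poch_hyp2f1_hsum]).

    Gamma is given by Euler's limit, so the constant in the Laplace integral is
    found by letting [z] run through the integers: there [e^(-n t)] can be
    replaced with [(1-t)^n], and the Beta integral [B(a, d + n)] is a quotient of
    Pochhammer symbols ([beta_int_lim], [laplace_int_lim_const]). By partial
    integration the derivative of [z^a] times the Laplace integral is
    exponentially small ([CDer_laplace_log]), which carries the limit from the
    integers to the positive axis and, along arcs, to the sector.

    For general parameters the integral diverges. Two contiguous relations,
    which hold for the ratios [(a)_N / (c)_N], express the function at [(a, c)]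
    through those at [(a, c+1)] or [(a+1, c+1)] and at [(a+1, c+2)]
    ([contiguous_d], [contiguous_a]). The same two relations hold for the
    coefficients ([ucoef_d], [ucoef_a]), so the expansion descends from large
    parameters to all admissible ones ([parameter_induction], [Phi1_expands]).

    The Gauss function is characterized as an analytic continuation, which must
    exist. For large parameters Euler's integral provides it ([euler_continues]),
    and the contiguous relations again give the rest ([hyp2f1_exists]); that the
    relations then hold on the whole cut plane is the identity theorem
    ([continues_unique]). *)

Open Scope C_scope.

(** * Complex-valued functions of a real variable *)

(** The structures of Coquelicot leave equations at a type that is only
    convertible to [R] or [C], which [ring] does not recognize. *)
Ltac rring := match goal with |- ?a = ?b => change (@eq R a b); ring end.

Ltac pos := solve [repeat first [lra | assumption | apply Cmod_ge_0 | apply Rmult_lt_0_compat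
  | apply Rmult_le_pos | apply pow_le | apply exp_pos | apply Rinv_0_lt_compat
  | apply INR_fact_lt_0 | apply pos_INR | apply Rabs_pos | apply Rlt_le]].

Ltac cring := cbv beta; match goal with |- ?a = ?b => change (@eq C a b) end; ring.

Lemma im_plus (z w : C) : Im (z + w) = (Im z + Im w)%R.
Proof. reflexivity. Qed.

Lemma re_minus (z w : C) : Re (z - w) = (Re z - Re w)%R.
Proof. reflexivity. Qed.
Lemma im_minus (z w : C) : Im (z - w) = (Im z - Im w)%R.
Proof. reflexivity. Qed.

Lemma C_eq (z w : C) : Re z = Re w -> Im z = Im w -> z = w.
Proof. destruct z, w; simpl; congruence. Qed.

Lemma Cmod_le_Re_Im (z : C) : Cmod z <= Rabs (Re z) + Rabs (Im z).
Proof.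
  replace z with (RtoC (Re z) + Ci * RtoC (Im z)) at 1.
  - eapply Rle_trans; [apply Cmod_triangle|].
    rewrite Cmod_mult, !Cmod_R, Cmod_Ci. lra.
  - apply C_eq; unfold Ci; simpl; ring.
Qed.

Lemma im_le_Cmod (z : C) : Rabs (Im z) <= Cmod z.
Proof. eapply Rle_trans; [|apply Rmax_Cmod]. apply Rmax_r. Qed.

Lemma Cmod_minus_sym (z w : C) : Cmod (z - w) = Cmod (w - z).
Proof. rewrite <- Cmod_opp. f_equal. ring. Qed.

Lemma Cmod_triangle_minus (z w : C) : Cmod (z - w) <= Cmod z + Cmod w.
Proof. rewrite <- (Cmod_opp w). apply Cmod_triangle. Qed.

Lemma Cmod_triangle_rev (z w : C) : Cmod z - Cmod w <= Cmod (z - w).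
Proof.
  replace z with ((z - w) + w) at 1 by ring.
  generalize (Cmod_triangle (z - w) w). lra.
Qed.

Lemma Cmod_neq0 (z : C) : 0 < Cmod z -> z <> 0.
Proof. intros H. now apply Cmod_gt_0. Qed.

(** Derivatives, continuity and integrals are taken componentwise, so that the
    real theory applies to each part; the price is a factor 2 in the estimates
    of differences and integrals below. *)
Definition CDer (f : R -> C) (t : R) (l : C) : Prop :=
  is_derive (fun s => Re (f s)) t (Re l) /\ is_derive (fun s => Im (f s)) t (Im l).

Definition Ccont (f : R -> C) (t : R) : Prop :=
  continuous (fun s => Re (f s)) t /\ continuous (fun s => Im (f s)) t.

Lemma CDer_const (c : C) (t : R) : CDer (fun _ => c) t 0.
Proof. split; simpl; apply @is_derive_const. Qed.

Lemma CDer_eq (f : R -> C) t l l' : l = l' -> CDer f t l -> CDer f t l'.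
Proof. now intros ->. Qed.

Lemma CDer_ext (f g : R -> C) t l : (forall s, f s = g s) -> CDer f t l -> CDer g t l.
Proof.
  intros E [H1 H2]; split; (eapply is_derive_ext; [|eassumption]);
    intros s; simpl; now rewrite E.
Qed.

Lemma CDer_plus (f g : R -> C) t l m :
  CDer f t l -> CDer g t m -> CDer (fun s => f s + g s) t (l + m).
Proof.
  intros [F1 F2] [G1 G2]; split.
  - exact (is_derive_plus _ _ _ _ _ F1 G1).
  - exact (is_derive_plus _ _ _ _ _ F2 G2).
Qed.

Lemma CDer_mult (f g : R -> C) t l m :
  CDer f t l -> CDer g t m -> CDer (fun s => f s * g s) t (l * g t + f t * m).
Proof.
  intros [F1 F2] [G1 G2]; split.
  - eapply is_derive_ext; [intros s; symmetry; apply re_mult|].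
    evar_last.
    + apply (is_derive_minus (fun s => Re (f s) * Re (g s))%R (fun s => Im (f s) * Im (g s))%R).
      * apply (is_derive_mult (fun s => Re (f s)) (fun s => Re (g s)) t _ _ F1 G1).
        intros; apply Rmult_comm.
      * apply (is_derive_mult (fun s => Im (f s)) (fun s => Im (g s)) t _ _ F2 G2).
        intros; apply Rmult_comm.
    + rewrite re_plus, !re_mult. unfold minus, plus, opp, mult; simpl. rring.
  - eapply is_derive_ext; [intros s; symmetry; apply im_mult|].
    evar_last.
    + apply (is_derive_plus (fun s => Re (f s) * Im (g s))%R (fun s => Im (f s) * Re (g s))%R).
      * apply (is_derive_mult (fun s => Re (f s)) (fun s => Im (g s)) t _ _ F1 G2).
        intros; apply Rmult_comm.
      * apply (is_derive_mult (fun s => Im (f s)) (fun s => Re (g s)) t _ _ F2 G1).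
        intros; apply Rmult_comm.
    + rewrite im_plus.
      rewrite !im_mult. unfold plus, mult; simpl. rring.
Qed.

Lemma CDer_scal (c : C) (f : R -> C) t l : CDer f t l -> CDer (fun s => c * f s) t (c * l).
Proof.
  intros F. eapply CDer_eq; [|apply CDer_mult; [apply CDer_const|exact F]]. cbv beta; ring.
Qed.

Lemma CDer_comp (f : R -> C) (g : R -> R) t l m :
  CDer f (g t) l -> is_derive g t m -> CDer (fun s => f (g s)) t (RtoC m * l).
Proof.
  intros [F1 F2] G; split.
  - evar_last; [apply (is_derive_comp (fun s => Re (f s)) g t _ _ F1 G)|].
    rewrite re_scal_l. reflexivity.
  - evar_last; [apply (is_derive_comp (fun s => Im (f s)) g t _ _ F2 G)|].
    rewrite im_mult. simpl. unfold scal; simpl; unfold mult; simpl. rring.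
Qed.

Lemma CDer_real (f : R -> R) t l : is_derive f t l -> CDer (fun s => RtoC (f s)) t (RtoC l).
Proof. intros F; split; simpl; [exact F|apply @is_derive_const]. Qed.

Lemma CDer_Ccont (f : R -> C) t l : CDer f t l -> Ccont f t.
Proof.
  intros [F1 F2]; split; apply @ex_derive_continuous; eexists; eassumption.
Qed.

Lemma Ccont_const (c : C) t : Ccont (fun _ => c) t.
Proof. split; apply continuous_const. Qed.

Lemma Ccont_plus (f g : R -> C) t : Ccont f t -> Ccont g t -> Ccont (fun s => f s + g s) t.
Proof.
  intros [F1 F2] [G1 G2]; split.
  - exact (continuous_plus _ _ _ F1 G1).
  - exact (continuous_plus _ _ _ F2 G2).
Qed.

Lemma Ccont_opp (f : R -> C) t : Ccont f t -> Ccont (fun s => - f s) t.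
Proof.
  intros [F1 F2]; split.
  - exact (continuous_opp _ _ F1).
  - exact (continuous_opp _ _ F2).
Qed.

Lemma Ccont_minus (f g : R -> C) t : Ccont f t -> Ccont g t -> Ccont (fun s => f s - g s) t.
Proof. intros F G. apply Ccont_plus; [exact F|now apply Ccont_opp]. Qed.

Lemma Ccont_mult (f g : R -> C) t : Ccont f t -> Ccont g t -> Ccont (fun s => f s * g s) t.
Proof.
  intros [F1 F2] [G1 G2]; split.
  - apply (continuous_ext (fun s => minus (Re (f s) * Re (g s))%R (Im (f s) * Im (g s))%R)).
    + intros s; rewrite re_mult; reflexivity.
    + apply @continuous_minus; apply @continuous_mult; assumption.
  - apply (continuous_ext (fun s => plus (Re (f s) * Im (g s))%R (Im (f s) * Re (g s))%R)).
    + intros s; rewrite im_mult; reflexivity.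
    + apply @continuous_plus; apply @continuous_mult; assumption.
Qed.

Lemma Ccont_ext (f g : R -> C) t : (forall s, f s = g s) -> Ccont f t -> Ccont g t.
Proof.
  intros E [H1 H2]; split.
  - exact (continuous_ext _ _ _ (fun s => f_equal Re (E s)) H1).
  - exact (continuous_ext _ _ _ (fun s => f_equal Im (E s)) H2).
Qed.

Lemma Ccont_real (f : R -> R) t : continuous f t -> Ccont (fun s => RtoC (f s)) t.
Proof. intros F; split; simpl; [exact F|apply continuous_const]. Qed.

Lemma Ccont_comp (f : R -> C) (g : R -> R) t :
  continuous g t -> Ccont f (g t) -> Ccont (fun s => f (g s)) t.
Proof.
  intros G [F1 F2]; split.
  - exact (continuous_comp g (fun s => Re (f s)) t G F1).
  - exact (continuous_comp g (fun s => Im (f s)) t G F2).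
Qed.

Lemma Ccont_pow (f : R -> C) n t : Ccont f t -> Ccont (fun s => f s ^ n) t.
Proof.
  intros F. induction n as [|n IH]; simpl.
  - apply Ccont_const.
  - now apply Ccont_mult.
Qed.

Lemma sum_n_C_S (u : nat -> C) n : sum_n u (S n) = sum_n u n + u (S n).
Proof. rewrite sum_Sn. reflexivity. Qed.

Lemma Ccont_sum (f : nat -> R -> C) n t :
  (forall k, Ccont (f k) t) -> Ccont (fun s => sum_n (fun k => f k s) n) t.
Proof.
  intros F. induction n as [|n IH].
  - apply (Ccont_ext (f 0%nat)); [intros s; now rewrite sum_O|apply F].
  - apply (Ccont_ext (fun s => sum_n (fun k => f k s) n + f (S n) s)).
    + intros s; now rewrite sum_n_C_S.
    + now apply Ccont_plus.
Qed.

Lemma continuous_Cmod (f : R -> C) t : Ccont f t -> continuous (fun s => Cmod (f s)) t.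
Proof.
  intros [F1 F2].
  apply (continuous_ext (fun s => sqrt (Re (f s) * Re (f s) + Im (f s) * Im (f s)))).
  - intros s. unfold Cmod, Re, Im. f_equal. ring.
  - apply (continuous_comp (fun s => Re (f s) * Re (f s) + Im (f s) * Im (f s))%R sqrt).
    + apply @continuous_plus; apply @continuous_mult; assumption.
    + apply continuity_pt_filterlim. apply continuity_pt_sqrt. nra.
Qed.

(** ** Integrals over the unit interval *)

Definition CInt (f : R -> C) : C :=
  (RInt (fun t => Re (f t)) 0 1, RInt (fun t => Im (f t)) 0 1).

(** Continuity is two-sided at the end points too: the integrands are extended
    to the whole line, powers of [t] by zero. *)
Definition C01 (f : R -> C) : Prop := forall t, 0 <= t <= 1 -> Ccont f t.

Lemma ex_RInt_01 (f : R -> R) :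
  (forall t, 0 <= t <= 1 -> continuous f t) -> ex_RInt f 0 1.
Proof.
  intros H. apply @ex_RInt_continuous. intros z Hz. apply H.
  rewrite Rmin_left, Rmax_right in Hz by lra. exact Hz.
Qed.

Lemma C01_Re f : C01 f -> ex_RInt (fun t => Re (f t)) 0 1.
Proof. intros H. apply ex_RInt_01. intros t Ht. apply (H t Ht). Qed.

Lemma C01_Im f : C01 f -> ex_RInt (fun t => Im (f t)) 0 1.
Proof. intros H. apply ex_RInt_01. intros t Ht. apply (H t Ht). Qed.

Lemma CInt_ext (f g : R -> C) :
  (forall t, 0 < t < 1 -> f t = g t) -> CInt f = CInt g.
Proof.
  intros E. unfold CInt. f_equal; apply RInt_ext; intros t Ht;
  rewrite Rmin_left, Rmax_right in Ht by lra; now rewrite E.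
Qed.

Lemma CInt_plus (f g : R -> C) :
  C01 f -> C01 g -> CInt (fun t => f t + g t) = CInt f + CInt g.
Proof.
  intros F G. apply C_eq; simpl.
  - apply @RInt_plus; now apply C01_Re.
  - apply @RInt_plus; now apply C01_Im.
Qed.

Lemma CInt_scal (c : C) (f : R -> C) : C01 f -> CInt (fun t => c * f t) = c * CInt f.
Proof.
  intros F.
  pose proof (RInt_correct _ _ _ (C01_Re f F)) as I1.
  pose proof (RInt_correct _ _ _ (C01_Im f F)) as I2.
  apply C_eq.
  - rewrite re_mult. apply is_RInt_unique.
    apply (is_RInt_ext (fun t => minus (scal (Re c) (Re (f t))) (scal (Im c) (Im (f t))))).
    + intros t _. symmetry. apply re_mult.
    + apply (is_RInt_minus (V := R_NormedModule)); now apply @is_RInt_scal.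
  - rewrite im_mult. apply is_RInt_unique.
    apply (is_RInt_ext (fun t => plus (scal (Re c) (Im (f t))) (scal (Im c) (Re (f t))))).
    + intros t _. symmetry. apply im_mult.
    + apply (is_RInt_plus (V := R_NormedModule)); now apply @is_RInt_scal.
Qed.

Lemma C01_plus f g : C01 f -> C01 g -> C01 (fun t => f t + g t).
Proof. intros F G t Ht; apply Ccont_plus; auto. Qed.
Lemma C01_minus f g : C01 f -> C01 g -> C01 (fun t => f t - g t).
Proof. intros F G t Ht; apply Ccont_minus; auto. Qed.
Lemma C01_mult f g : C01 f -> C01 g -> C01 (fun t => f t * g t).
Proof. intros F G t Ht; apply Ccont_mult; auto. Qed.
Lemma C01_const c : C01 (fun _ => c).
Proof. intros t Ht; apply Ccont_const. Qed.
Lemma C01_scal c f : C01 f -> C01 (fun t => c * f t).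
Proof. intros F; apply C01_mult; [apply C01_const|exact F]. Qed.
Lemma C01_sum (f : nat -> R -> C) n : (forall k, C01 (f k)) -> C01 (fun t => sum_n (fun k => f k t) n).
Proof. intros F t Ht; apply Ccont_sum; intros k; now apply F. Qed.
Lemma C01_t : C01 (fun t => RtoC t).
Proof. intros t _. apply Ccont_real. apply continuous_id. Qed.
Lemma C01_pow f n : C01 f -> C01 (fun t => f t ^ n).
Proof. intros F t Ht; apply Ccont_pow; auto. Qed.

Lemma CInt_minus (f g : R -> C) :
  C01 f -> C01 g -> CInt (fun t => f t - g t) = CInt f - CInt g.
Proof.
  intros F G.
  rewrite <- (CInt_ext (fun t => f t + (-(1)) * g t)) by (intros; ring).
  rewrite CInt_plus, CInt_scal by (auto using C01_scal). ring.
Qed.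

Lemma CInt_sum (f : nat -> R -> C) n : (forall k, C01 (f k)) ->
  CInt (fun t => sum_n (fun k => f k t) n) = sum_n (fun k => CInt (f k)) n.
Proof.
  intros F. induction n as [|n IH].
  - rewrite sum_O. apply CInt_ext. intros; now rewrite sum_O.
  - rewrite sum_n_C_S, <- IH, <- CInt_plus by auto using C01_sum.
    apply CInt_ext. intros; now rewrite sum_n_C_S.
Qed.

Lemma CInt_bound (f : R -> C) (g : R -> R) : C01 f -> ex_RInt g 0 1 ->
  (forall t, 0 < t < 1 -> Cmod (f t) <= g t) -> Cmod (CInt f) <= 2 * RInt g 0 1.
Proof.
  intros F G H. eapply Rle_trans; [apply Cmod_le_Re_Im|].
  assert (forall h : R -> R, (forall t, 0 <= t <= 1 -> continuous h t) ->
    (forall t, 0 < t < 1 -> Rabs (h t) <= g t) -> Rabs (RInt h 0 1) <= RInt g 0 1) as K.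
  { intros h Hc Hb. eapply Rle_trans; [apply abs_RInt_le; [lra|now apply ex_RInt_01]|].
    apply RInt_le; [lra| |exact G|exact Hb].
    apply ex_RInt_01. intros t Ht.
    apply (continuous_comp h Rabs); [now apply Hc|apply continuous_Rabs]. }
  assert (Rabs (Re (CInt f)) <= RInt g 0 1).
  { apply K; [intros t Ht; apply (F t Ht)|].
    intros t Ht. eapply Rle_trans; [apply re_le_Cmod|auto]. }
  assert (Rabs (Im (CInt f)) <= RInt g 0 1).
  { apply K; [intros t Ht; apply (F t Ht)|].
    intros t Ht. eapply Rle_trans; [apply im_le_Cmod|auto]. }
  lra.
Qed.

Lemma CInt_bound_const (f : R -> C) (M : R) : C01 f ->
  (forall t, 0 < t < 1 -> Cmod (f t) <= M) -> Cmod (CInt f) <= 2 * M.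
Proof.
  intros F H.
  replace M with (RInt (fun _ => M) 0 1).
  - apply CInt_bound; [exact F|apply @ex_RInt_const|exact H].
  - rewrite RInt_const. unfold scal; simpl; unfold mult; simpl. rring.
Qed.

Lemma CInt_FTC (F f : R -> C) :
  (forall t, 0 <= t <= 1 -> CDer F t (f t)) -> C01 f -> CInt f = F 1%R - F 0%R.
Proof.
  intros D c. apply C_eq; simpl.
  - apply is_RInt_unique. apply (is_RInt_derive (fun t => Re (F t)));
    rewrite Rmin_left, Rmax_right by lra; intros t Ht; [apply (D t Ht)|apply (c t Ht)].
  - apply is_RInt_unique. apply (is_RInt_derive (fun t => Im (F t)));
    rewrite Rmin_left, Rmax_right by lra; intros t Ht; [apply (D t Ht)|apply (c t Ht)].
Qed.

(** ** Mean value inequality and Taylor's formula *)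

Lemma real_mean_value (h h' k k' : R -> R) p q : p <= q ->
  (forall s, p <= s <= q -> is_derive h s (h' s)) ->
  (forall s, p <= s <= q -> is_derive k s (k' s)) ->
  (forall s, p <= s <= q -> h' s <= k' s) -> h q - h p <= k q - k p.
Proof.
  intros Hpq Dh Dk H.
  destruct (MVT_gen (fun s => h s - k s)%R p q (fun s => h' s - k' s)%R) as [c [Hc E]].
  - intros s Hs. rewrite Rmin_left, Rmax_right in Hs by lra.
    apply @is_derive_minus; [apply Dh|apply Dk]; lra.
  - intros s Hs. rewrite Rmin_left, Rmax_right in Hs by lra.
    apply continuity_pt_filterlim. apply (ex_derive_continuous (fun s => h s - k s)%R).
    eexists. apply @is_derive_minus; [apply Dh|apply Dk]; lra.
  - rewrite Rmin_left, Rmax_right in Hc by lra. specialize (H c Hc). nra.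
Qed.

(** The real mean value theorem bounds the two components by the same
    increment of [k], whence the factor 2. *)
Lemma mean_value (h h' : R -> C) (k k' : R -> R) p q : p <= q ->
  (forall s, p <= s <= q -> CDer h s (h' s)) ->
  (forall s, p <= s <= q -> is_derive k s (k' s)) ->
  (forall s, p <= s <= q -> Cmod (h' s) <= k' s) ->
  Cmod (h q - h p) <= 2 * (k q - k p).
Proof.
  intros Hpq Dh Dk H. eapply Rle_trans; [apply Cmod_le_Re_Im|].
  assert (forall f f' : R -> R, (forall s, p <= s <= q -> is_derive f s (f' s)) ->
    (forall s, p <= s <= q -> Rabs (f' s) <= k' s) ->
    Rabs (f q - f p) <= k q - k p) as K.
  { intros f f' Df Hf. apply Rabs_le. split.
    - assert (- f q - - f p <= k q - k p); [|lra].
      apply (real_mean_value (fun s => - f s)%R (fun s => - f' s)%R k k'); auto.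
      + intros s Hs. apply @is_derive_opp; auto.
      + intros s Hs. generalize (Hf s Hs) (Rle_abs (- f' s)). rewrite Rabs_Ropp. lra.
    - apply (real_mean_value f f' k k'); auto.
      intros s Hs. generalize (Hf s Hs) (Rle_abs (f' s)). lra. }
  assert (Rabs (Re (h q) - Re (h p)) <= k q - k p).
  { apply (K (fun s => Re (h s)) (fun s => Re (h' s))).
    - intros s Hs; apply (Dh s Hs).
    - intros s Hs. eapply Rle_trans; [apply re_le_Cmod|auto]. }
  assert (Rabs (Im (h q) - Im (h p)) <= k q - k p).
  { apply (K (fun s => Im (h s)) (fun s => Im (h' s))).
    - intros s Hs; apply (Dh s Hs).
    - intros s Hs. eapply Rle_trans; [apply im_le_Cmod|auto]. }
  rewrite re_minus, im_minus. lra.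
Qed.

Lemma mean_value_const (h h' : R -> C) (M : R) :
  (forall s, 0 <= s <= 1 -> CDer h s (h' s)) ->
  (forall s, 0 <= s <= 1 -> Cmod (h' s) <= M) ->
  Cmod (h 1%R - h 0%R) <= 2 * M.
Proof.
  intros D H.
  replace M with (M * 1 - M * 0)%R by ring.
  apply (mean_value h h' (fun s => M * s)%R (fun _ => M)); auto; [lra|].
  intros s _. auto_derive; [trivial|ring].
Qed.

Lemma Cfact_neq0 n : Cfact n <> 0.
Proof.
  unfold Cfact, Cnat. intros E. apply (INR_fact_neq_0 n). now apply RtoC_inj.
Qed.

Lemma Cnat_S n : Cnat (S n) = Cnat n + 1.
Proof. unfold Cnat. now rewrite S_INR, RtoC_plus. Qed.

Lemma Cnat_S_neq0 n : Cnat (S n) <> 0.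
Proof. unfold Cnat. intros E. apply RtoC_inj in E. now apply (not_0_INR (S n)). Qed.

Lemma Cfact_S n : Cfact (S n) = Cnat (S n) * Cfact n.
Proof. unfold Cfact, Cnat. now rewrite fact_simpl, mult_INR, RtoC_mult. Qed.

(** The sum [sum_{m<=M} f_m(s) (1-s)^m / m!] interpolates between the Taylor
    polynomial at [s = 0] and [f_0(1)] at [s = 1], and its derivative telescopes
    to the single term [f_{M+1}(s) (1-s)^M / M!]. *)
Lemma taylor_path (f : nat -> R -> C) s :
  (forall m, CDer (f m) s (f (S m) s)) -> forall M,
  CDer (fun s => sum_n (fun m => f m s * (RtoC (1 - s) ^ m / Cfact m)) M) s
       (f (S M) s * (RtoC (1 - s) ^ M / Cfact M)).
Proof.
  intros D.
  assert (P : forall m, CDer (fun s => RtoC (1 - s) ^ S m / Cfact (S m)) s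
      (- (RtoC (1 - s) ^ m / Cfact m))).
  { intros m. apply (CDer_ext (fun s => / Cfact (S m) * RtoC ((1 - s) ^ S m))).
    { intros r. rewrite RtoC_pow. unfold Cdiv. ring. }
    eapply CDer_eq; [|apply CDer_scal, (CDer_real _ _ (- (INR (S m) * (1 - s) ^ m))%R)].
    - rewrite Cfact_S, RtoC_opp, RtoC_mult, <- RtoC_pow. fold (Cnat (S m)).
      field. split; [apply Cfact_neq0|apply Cnat_S_neq0].
    - auto_derive; [trivial|]. change (match m with 0%nat => 1%R | S _ => (INR m + 1)%R end) with (INR (S m)). unfold Rminus. ring. }
  induction M as [|M IH].
  - apply (CDer_ext (f 0%nat)); [|eapply CDer_eq; [|apply D]].
    + intros r. rewrite sum_O. change (Cfact 0) with (RtoC 1). simpl. field.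
    + change (Cfact 0) with (RtoC 1). simpl. field.
  - apply (CDer_ext (fun s => sum_n (fun m => f m s * (RtoC (1 - s) ^ m / Cfact m)) M
         + f (S M) s * (RtoC (1 - s) ^ S M / Cfact (S M)))).
    + intros r. now rewrite sum_n_C_S.
    + eapply CDer_eq; [|apply CDer_plus; [apply IH|apply CDer_mult; [apply D|apply P]]].
      cbv beta; ring.
Qed.

Lemma taylor_bound (f : nat -> R -> C) (M : nat) (K : R) :
  (forall m s, 0 <= s <= 1 -> CDer (f m) s (f (S m) s)) ->
  (forall s, 0 <= s <= 1 -> Cmod (f (S M) s) * (1 - s) ^ M / INR (fact M) <= K) ->
  Rle (Cmod (f 0%nat 1%R - sum_n (fun m => f m 0%R / Cfact m) M)) (2 * K).
Proof.
  intros D H.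
  set (h := fun s => sum_n (fun m => f m s * (RtoC (1 - s) ^ m / Cfact m)) M).
  replace (f 0%nat 1%R) with (h 1%R).
  replace (sum_n (fun m => f m 0%R / Cfact m) M) with (h 0%R).
  - apply (mean_value_const h (fun s => f (S M) s * (RtoC (1 - s) ^ M / Cfact M))).
    + intros s Hs. apply taylor_path. intros m; now apply D.
    + intros s Hs. eapply Rle_trans; [|apply (H s Hs)]. right.
      unfold Cdiv, Rdiv. rewrite !Cmod_mult, Cmod_pow, Cmod_inv by apply Cfact_neq0.
      unfold Cfact, Cnat. rewrite !Cmod_R, (Rabs_pos_eq (1 - s)), (Rabs_pos_eq (INR _)); [ring| |lra].
      apply pos_INR.
  - unfold h. apply sum_n_ext. intros m. rewrite Rminus_0_r, Cpow_1_l.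
    change (f m 0%R * (1 / Cfact m) = f m 0%R / Cfact m). unfold Cdiv. ring.
  - unfold h. clear. induction M as [|M IH].
    + rewrite sum_O. change (Cfact 0) with (RtoC 1). simpl. field.
    + rewrite sum_n_C_S, IH. replace (1 - 1)%R with 0%R by ring.
      simpl. unfold Cdiv. ring.
Qed.

(** * Exponential, logarithm and powers *)

Lemma Re_Cexp z : Re (Cexp z) = (exp (Re z) * cos (Im z))%R.
Proof. unfold Cexp. rewrite re_scal_l. reflexivity. Qed.
Lemma Im_Cexp z : Im (Cexp z) = (exp (Re z) * sin (Im z))%R.
Proof. unfold Cexp. rewrite im_scal_l. reflexivity. Qed.

Lemma Cexp_plus z w : Cexp (z + w) = Cexp z * Cexp w.
Proof.
  apply C_eq.
  - rewrite re_mult, !Re_Cexp, !Im_Cexp, re_plus, im_plus, exp_plus, cos_plus. ring.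
  - rewrite im_mult, !Re_Cexp, !Im_Cexp, re_plus, im_plus, exp_plus, sin_plus. ring.
Qed.

Lemma Cexp_0 : Cexp 0 = 1.
Proof. apply C_eq; rewrite ?Re_Cexp, ?Im_Cexp; simpl; rewrite ?exp_0, ?cos_0, ?sin_0; ring. Qed.

Lemma Cmod_Cexp z : Cmod (Cexp z) = exp (Re z).
Proof.
  unfold Cexp. rewrite Cmod_mult, Cmod_R, Rabs_pos_eq by (left; apply exp_pos).
  replace (Cmod (cos (Im z), sin (Im z))) with 1%R; [ring|].
  unfold Cmod, fst, snd. rewrite <- !Rsqr_pow2, Rplus_comm, sin2_cos2. now rewrite sqrt_1.
Qed.

Lemma Cexp_neq0 z : Cexp z <> 0.
Proof. apply Cmod_neq0. rewrite Cmod_Cexp. apply exp_pos. Qed.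

Lemma CDer_Cexp (f : R -> C) t l :
  CDer f t l -> CDer (fun s => Cexp (f s)) t (l * Cexp (f t)).
Proof.
  intros [F1 F2].
  set (p := fun s => Re (f s)). set (q := fun s => Im (f s)).
  assert (E1 : Derive p t = Re l) by exact (is_derive_unique _ _ _ F1).
  assert (E2 : Derive q t = Im l) by exact (is_derive_unique _ _ _ F2).
  assert (EP : ex_derive p t) by (eexists; exact F1).
  assert (EQ : ex_derive q t) by (eexists; exact F2).
  split.
  - apply (is_derive_ext (fun s => exp (p s) * cos (q s))%R).
    { intros s. symmetry. apply Re_Cexp. }
    auto_derive; [repeat split; assumption|].
    change (fun x => p x) with p. change (fun x => q x) with q.
    rewrite re_mult, Re_Cexp, Im_Cexp, E1, E2. unfold p, q. rring.
  - apply (is_derive_ext (fun s => exp (p s) * sin (q s))%R).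
    { intros s. symmetry. apply Im_Cexp. }
    auto_derive; [repeat split; assumption|].
    change (fun x => p x) with p. change (fun x => q x) with q.
    rewrite im_mult, Re_Cexp, Im_Cexp, E1, E2. unfold p, q. rring.
Qed.

Lemma Ccont_Cexp (f : R -> C) t : Ccont f t -> Ccont (fun s => Cexp (f s)) t.
Proof.
  intros [F1 F2].
  assert (K1 : continuous (fun s => exp (Re (f s))) t)
    by (apply (continuous_comp (fun s => Re (f s)) exp); [exact F1|apply continuous_exp]).
  split.
  - apply (continuous_ext (fun s => exp (Re (f s)) * cos (Im (f s)))%R).
    + intros s. symmetry. apply Re_Cexp.
    + apply @continuous_mult; [exact K1|].
      apply (continuous_comp (fun s => Im (f s)) cos); [exact F2|apply continuous_cos].
  - apply (continuous_ext (fun s => exp (Re (f s)) * sin (Im (f s)))%R).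
    + intros s. symmetry. apply Im_Cexp.
    + apply @continuous_mult; [exact K1|].
      apply (continuous_comp (fun s => Im (f s)) sin); [exact F2|apply continuous_sin].
Qed.

Lemma exp_le_compat x y : x <= y -> exp x <= exp y.
Proof. intros [H| ->]; [left; now apply exp_increasing|right; reflexivity]. Qed.

Lemma pow_01 s n : 0 <= s <= 1 -> 0 <= s ^ n <= 1.
Proof. intros H. split; [apply pow_le; lra|]. rewrite <- (pow1 n). apply pow_incr; lra. Qed.

Lemma Cexp_taylor (w : C) (M : nat) :
  Rle (Cmod (Cexp w - sum_n (fun m => (w ^ m / Cfact m)%C) M))
    (2 * (Cmod w ^ S M / INR (fact M) * exp (Cmod w))).
Proof.
  pose proof (taylor_bound (fun m s => w ^ m * Cexp (RtoC s * w)) M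
    (Cmod w ^ S M / INR (fact M) * exp (Cmod w))) as T.
  simpl in T.
  replace (Cexp w) with (1 * Cexp (1 * w)) by (rewrite !Cmult_1_l; reflexivity).
  erewrite sum_n_ext.
  - apply T.
    + intros m s _.
      eapply CDer_eq; [|apply CDer_scal, CDer_Cexp].
      2:{ apply (CDer_ext (fun s => w * RtoC s)); [intros; apply Cmult_comm|].
          apply CDer_scal, (CDer_real (fun s => s)). apply @is_derive_id. }
      simpl. change (RtoC one) with (RtoC 1). ring.
    + intros s Hs. rewrite !Cmod_mult, Cmod_pow, Cmod_Cexp, re_scal_l.
      assert (s * Re w <= Cmod w).
      { generalize (re_le_Cmod w) (Rle_abs (Re w)) (Cmod_ge_0 w). intros. nra. }
      assert (exp (s * Re w) <= exp (Cmod w)) by (now apply exp_le_compat).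
      assert (P := INR_fact_lt_0 M).
      unfold Rdiv.
      assert (0 <= Cmod w * Cmod w ^ M) by pos.
      assert (Q := pow_01 (1 - s) M ltac:(lra)).
      assert (X := exp_pos (s * Re w)).
      assert (exp (s * Re w) * (1 - s) ^ M <= exp (Cmod w)) by nra.
      assert (0 < / INR (fact M)) by now apply Rinv_0_lt_compat.
      replace (Cmod w * Cmod w ^ M * exp (s * Re w) * (1 - s) ^ M * / INR (fact M))%R
        with (Cmod w * Cmod w ^ M * / INR (fact M) * (exp (s * Re w) * (1 - s) ^ M))%R by ring.
      apply Rmult_le_compat_l; [pos|assumption].
  - intros m. simpl. rewrite Cmult_0_l, Cexp_0. now rewrite Cmult_1_r.
Qed.

Lemma Cexp_minus_1_w (w : C) :
  Cmod (Cexp w - 1 - w) <= 2 * (Cmod w ^ 2 * exp (Cmod w)).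
Proof.
  generalize (Cexp_taylor w 1). rewrite sum_n_C_S, sum_O.
  replace (Cexp w - 1 - w) with (Cexp w - (w ^ 0 / Cfact 0 + w ^ 1 / Cfact 1)).
  - change (INR (fact 1)) with 1%R. unfold Rdiv. rewrite Rinv_1, Rmult_1_r. easy.
  - change (Cfact 0) with (RtoC 1). change (Cfact 1) with (RtoC 1). simpl. field.
Qed.

(** [t ^ s] for real [t] and complex [s], with the value [0] at [t <= 0]: this
    makes it differentiable on the whole line when [Re s > 1]. *)
Definition rpow (s : C) (t : R) : C :=
  if Rlt_dec 0 t then Cexp (s * RtoC (ln t)) else 0.

Lemma rpow_pos s t : 0 < t -> rpow s t = Cexp (s * RtoC (ln t)).
Proof. intros H. unfold rpow. destruct (Rlt_dec 0 t); [reflexivity|contradiction]. Qed.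

Lemma rpow_neg s t : t <= 0 -> rpow s t = 0.
Proof. intros H. unfold rpow. destruct (Rlt_dec 0 t); [lra|reflexivity]. Qed.

Lemma rpow_1 s : rpow s 1 = 1.
Proof. rewrite rpow_pos by lra. rewrite ln_1, Cmult_0_r. apply Cexp_0. Qed.

Lemma Cmod_rpow s t : 0 < t -> Cmod (rpow s t) = Rpower t (Re s).
Proof. intros H. rewrite rpow_pos, Cmod_Cexp, re_scal_r by easy. reflexivity. Qed.

Lemma rpow_plus s s' t : rpow (s + s') t = rpow s t * rpow s' t.
Proof.
  unfold rpow. destruct (Rlt_dec 0 t); [|ring].
  rewrite <- Cexp_plus. f_equal. ring.
Qed.

Lemma rpow_one t : 0 < t -> rpow 1 t = RtoC t.
Proof.
  intros H. rewrite rpow_pos, Cmult_1_l by easy.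
  apply C_eq; rewrite ?Re_Cexp, ?Im_Cexp; simpl; rewrite ?exp_ln, ?cos_0, ?sin_0 by easy; ring.
Qed.

Lemma rpow_S s t : rpow (s + 1) t = RtoC t * rpow s t.
Proof.
  destruct (Rlt_dec 0 t) as [H|H].
  - rewrite rpow_plus, rpow_one by easy. ring.
  - rewrite !rpow_neg by lra. ring.
Qed.

Lemma rpow_nat s n t : rpow (s + Cnat n) t = RtoC t ^ n * rpow s t.
Proof.
  induction n as [|n IH].
  - simpl. replace (s + Cnat 0) with s by (unfold Cnat; simpl; ring). ring.
  - rewrite Cnat_S. replace (s + (Cnat n + 1)) with (s + Cnat n + 1) by ring.
    rewrite rpow_S, IH. simpl. ring.
Qed.

Lemma Rpower_small k eps : 0 < k -> 0 < eps ->
  exists d, 0 < d /\ forall h, 0 < h < d -> Rpower h k < eps.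
Proof.
  intros Hk He. exists (Rpower eps (/ k)). split; [apply exp_pos|].
  intros h Hh. replace eps with (Rpower (Rpower eps (/ k)) k).
  - apply Rlt_Rpower_l; lra.
  - rewrite Rpower_mult, Rinv_l, Rpower_1 by lra. reflexivity.
Qed.

Lemma Rpower_le_1 t k : 0 < t <= 1 -> 0 <= k -> Rpower t k <= 1.
Proof.
  intros Ht Hk. unfold Rpower. rewrite <- exp_0. apply exp_le_compat.
  assert (ln t <= 0) by (rewrite <- ln_1; apply ln_le; lra). nra.
Qed.

Lemma Cmod_rpow_le_1 s t : t <= 1 -> 0 <= Re s -> Cmod (rpow s t) <= 1.
Proof.
  intros Ht Hs. destruct (Rlt_dec 0 t) as [H|H].
  - rewrite Cmod_rpow by easy. apply Rpower_le_1; lra.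
  - rewrite rpow_neg, Cmod_0 by lra. lra.
Qed.

Lemma CDer_ext_loc (f g : R -> C) t l :
  locally t (fun s => f s = g s) -> CDer f t l -> CDer g t l.
Proof.
  intros E [H1 H2]; split.
  - apply (is_derive_ext_loc (fun s => Re (f s))); [|exact H1].
    eapply filter_imp; [|exact E]. intros s Es; simpl. now rewrite Es.
  - apply (is_derive_ext_loc (fun s => Im (f s))); [|exact H2].
    eapply filter_imp; [|exact E]. intros s Es; simpl. now rewrite Es.
Qed.

Lemma Ccont_ext_loc (f g : R -> C) t :
  locally t (fun s => f s = g s) -> Ccont f t -> Ccont g t.
Proof.
  intros E [H1 H2]; split.
  - apply (continuous_ext_loc _ (fun s => Re (f s))); [|exact H1].
    eapply filter_imp; [|exact E]. intros s Es; simpl. now rewrite Es.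
  - apply (continuous_ext_loc _ (fun s => Im (f s))); [|exact H2].
    eapply filter_imp; [|exact E]. intros s Es; simpl. now rewrite Es.
Qed.

Lemma locally_pos t : 0 < t -> locally t (fun s => (0 < s)).
Proof. intros H. apply (open_gt 0). exact H. Qed.

Lemma locally_neg t : t < 0 -> locally t (fun s => (s < 0)).
Proof. intros H. apply (open_lt 0). exact H. Qed.

Lemma CDer_rpow s t : 1 < Re s -> CDer (rpow s) t (s * rpow (s - 1) t).
Proof.
  intros Hs. destruct (total_order_T t 0) as [[H|H]|H].
  - rewrite rpow_neg, Cmult_0_r by lra.
    apply (CDer_ext_loc (fun _ => RtoC 0)); [|apply CDer_const].
    eapply filter_imp; [|now apply locally_neg]. intros r Hr; simpl in Hr. rewrite rpow_neg; lra || easy.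
  - subst t. rewrite rpow_neg, Cmult_0_r by lra.
    assert (K : forall g : C -> R, g 0 = 0%R -> (forall z, Rabs (g z) <= Cmod z) ->
        is_derive (fun r => g (rpow s r)) 0%R 0%R).
    { intros g g0 Hg. apply is_derive_Reals. intros eps He.
      destruct (Rpower_small (Re s - 1) eps ltac:(lra) He) as [d [Hd Hp]].
      exists (mkposreal d Hd). intros h Hh0 Hh. simpl in Hh.
      rewrite Rplus_0_l, (rpow_neg s 0) by lra. rewrite g0, !Rminus_0_r.
      destruct (Rlt_dec 0 h) as [P|P].
      - eapply Rle_lt_trans; [|apply (Hp h); rewrite Rabs_pos_eq in Hh by lra; lra].
        unfold Rdiv. rewrite Rabs_mult, Rabs_inv, (Rabs_pos_eq h) by lra.
        apply (Rmult_le_reg_r h); [easy|].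
        rewrite Rmult_assoc, Rinv_l, Rmult_1_r by lra.
        eapply Rle_trans; [apply Hg|]. rewrite Cmod_rpow by easy.
        rewrite <- (Rpower_1 h P) at 3. rewrite <- Rpower_plus. right. f_equal. ring.
      - rewrite rpow_neg, g0 by lra. unfold Rdiv. rewrite Rmult_0_l, Rabs_R0. exact He. }
    split; simpl.
    + apply (K Re); [reflexivity|apply re_le_Cmod].
    + apply (K Im); [reflexivity|apply im_le_Cmod].
  - apply (CDer_ext_loc (fun r => Cexp (s * RtoC (ln r)))).
    + eapply filter_imp; [|now apply locally_pos]. intros r Hr; simpl in Hr. now rewrite rpow_pos.
    + eapply CDer_eq; [|apply CDer_Cexp, CDer_scal, CDer_real, is_derive_ln; exact H].
      replace (rpow (s - 1) t) with (RtoC (/ t) * rpow s t).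
      * rewrite rpow_pos by easy. cbv beta. ring.
      * replace s with (s - 1 + 1) at 1 by ring. rewrite rpow_S, Cmult_assoc, <- RtoC_mult, Rinv_l by lra. ring.
Qed.

Lemma Ccont_rpow s t : 0 < Re s -> Ccont (rpow s) t.
Proof.
  intros Hs. destruct (total_order_T t 0) as [[H|H]|H].
  - apply (Ccont_ext_loc (fun _ => RtoC 0)); [|apply Ccont_const].
    eapply filter_imp; [|now apply locally_neg]. intros r Hr; simpl in Hr. rewrite rpow_neg; lra || easy.
  - subst t.
    assert (K : forall g : C -> R, g 0 = 0%R -> (forall z, Rabs (g z) <= Cmod z) ->
        continuous (fun r => g (rpow s r)) 0%R).
    { intros g g0 Hg. apply continuity_pt_filterlim. intros eps He.
      destruct (Rpower_small (Re s) eps ltac:(lra) He) as [d [Hd Hp]].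
      exists d. split; [exact Hd|]. intros h [_ Hh]. simpl in Hh |- *. unfold Rdist in *.
      rewrite (rpow_neg s 0), g0, Rminus_0_r by lra. rewrite Rminus_0_r in Hh.
      destruct (Rlt_dec 0 h) as [P|P].
      - eapply Rle_lt_trans; [apply Hg|]. rewrite Cmod_rpow by easy.
        apply Hp. rewrite Rabs_pos_eq in Hh by lra. lra.
      - rewrite rpow_neg, g0, Rabs_R0 by lra. exact He. }
    split.
    + apply (K Re); [reflexivity|apply re_le_Cmod].
    + apply (K Im); [reflexivity|apply im_le_Cmod].
  - apply (Ccont_ext_loc (fun r => Cexp (s * RtoC (ln r)))).
    + eapply filter_imp; [|now apply locally_pos]. intros r Hr; simpl in Hr. now rewrite rpow_pos.
    + eapply CDer_Ccont. apply CDer_Cexp, CDer_scal, CDer_real, is_derive_ln; exact H.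
Qed.

(** ** A logarithm on the plane cut along the negative axis *)

(** Since [|u| >= - Re u], with equality exactly on the negative axis and at 0,
    this is the plane without them. *)
Definition slit (u : C) : Prop := (0 < Cmod u + Re u).

(** The half-angle form of the argument is one smooth formula on the whole slit
    plane, unlike the principal argument, which is defined by cases. *)
Definition Clg (u : C) : C := (ln (Cmod u), (2 * atan (Im u / (Cmod u + Re u)))%R).

Lemma slit_neq0 u : slit u -> u <> 0.
Proof. unfold slit. intros H ->. rewrite Cmod_0 in H. simpl in H. lra. Qed.

Lemma Cmod_sqr_sum u : (Cmod u * Cmod u = Re u * Re u + Im u * Im u)%R.
Proof. generalize (Cmod2_alt u). simpl. lra. Qed.

Lemma CDer_Clg (f : R -> C) t l :
  slit (f t) -> CDer f t l -> CDer (fun s => Clg (f s)) t (l / f t).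
Proof.
  intros S [F1 F2].
  assert (N := Cmod_sqr_sum (f t)).
  assert (P : 0 < Cmod (f t)) by (apply Cmod_gt_0; now apply slit_neq0).
  set (p := fun s => Re (f s)). set (q := fun s => Im (f s)).
  assert (E1 : Derive p t = Re l) by exact (is_derive_unique _ _ _ F1).
  assert (E2 : Derive q t = Im l) by exact (is_derive_unique _ _ _ F2).
  assert (EC : forall s, Cmod (f s) = sqrt (p s * p s + q s * q s)).
  { intros s. unfold Cmod, p, q, Re, Im. f_equal. ring. }
  assert (P2 : 0 < p t * p t + q t * q t).
  { change (0 < Re (f t) * Re (f t) + Im (f t) * Im (f t)). nra. }
  assert (EL : l / f t = ((Re l * p t + Im l * q t) / (p t * p t + q t * q t),
                          (Im l * p t - Re l * q t) / (p t * p t + q t * q t))%R).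
  { assert (f t <> 0) by now apply slit_neq0.
    apply (fun A => eq_trans (y := _) A eq_refl).
    unfold Cdiv, Cinv, Cmult, p, q, Re, Im in *. simpl. f_equal; field; nra. }
  rewrite EL. unfold slit in S. rewrite EC in S, P. fold (p t) in *.
  change (Re (f t)) with (p t) in *.
  assert (Q := sqrt_sqrt _ (Rlt_le _ _ P2)).
  assert (EP : ex_derive p t) by (eexists; exact F1).
  assert (EQ : ex_derive q t) by (eexists; exact F2).
  split; simpl.
  - apply (is_derive_ext (fun s => ln (sqrt (p s * p s + q s * q s)))).
    { intros s. now rewrite <- EC. }
    auto_derive.
    + repeat split; auto.
    + change (fun x => p x) with p. change (fun x => q x) with q. rewrite E1, E2.
      set (r := sqrt (p t * p t + q t * q t)) in *. rewrite <- Q. field. lra.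
  - apply (is_derive_ext (fun s => (2 * atan (q s / (sqrt (p s * p s + q s * q s) + p s)))%R)).
    { intros s. now rewrite <- EC. }
    auto_derive.
    + repeat split; auto. lra.
    + change (fun x => p x) with p. change (fun x => q x) with q. rewrite E1, E2.
      set (r := sqrt (p t * p t + q t * q t)) in *.
      replace (p t * p t + q t * q t)%R with (r * r)%R.
      assert (Eq2 : (q t * q t = r * r - p t * p t)%R) by lra.
      assert (D : 0 < (r + p t) * (r + p t) + q t * q t) by nra.
      field_simplify_eq; [|repeat split; lra].
      replace (q t ^ 3)%R with (q t * (r * r - p t * p t))%R by (rewrite <- Eq2; ring).
      replace (q t ^ 2)%R with (r * r - p t * p t)%R by (rewrite <- Eq2; ring).
      ring.
Qed.

Lemma Clg_real r : 0 < r -> Clg (RtoC r) = RtoC (ln r).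
Proof.
  intros H. unfold Clg. rewrite Cmod_R, Rabs_pos_eq by lra. simpl.
  unfold Rdiv. rewrite Rmult_0_l, atan_0, Rmult_0_r. reflexivity.
Qed.

Lemma Im_Clg_bound u : Rabs (Im (Clg u)) <= PI.
Proof.
  simpl. generalize (atan_bound (Im u / (Cmod u + Re u))). intros H. apply Rabs_le. lra.
Qed.

(** * The binomial series *)

Lemma CDer_inv (f : R -> C) t l :
  f t <> 0 -> CDer f t l -> CDer (fun s => / f s) t (- l * (/ f t * / f t)).
Proof.
  intros N [F1 F2].
  set (p := fun s => Re (f s)). set (q := fun s => Im (f s)).
  assert (E1 : Derive p t = Re l) by exact (is_derive_unique _ _ _ F1).
  assert (E2 : Derive q t = Im l) by exact (is_derive_unique _ _ _ F2).
  assert (EP : ex_derive p t) by (eexists; exact F1).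
  assert (EQ : ex_derive q t) by (eexists; exact F2).
  assert (P2 : 0 < p t * p t + q t * q t).
  { unfold p, q. rewrite <- Cmod_sqr_sum. apply Cmod_gt_0 in N. now apply Rmult_lt_0_compat. }
  assert (EL : - l * (/ f t * / f t) =
     ((- (Re l * (p t * p t - q t * q t) + 2 * Im l * p t * q t) / (p t * p t + q t * q t) ^ 2)%R,
      (- (Im l * (p t * p t - q t * q t) - 2 * Re l * p t * q t) / (p t * p t + q t * q t) ^ 2)%R)).
  { unfold Cinv, Cmult, Copp. unfold p, q, Re, Im in *. simpl. f_equal; field; nra. }
  rewrite EL. split.
  - apply (is_derive_ext (fun s => p s / (p s * p s + q s * q s))%R).
    { intros s. unfold Cinv, p, q, Re, Im. simpl. f_equal. ring. }
    auto_derive; [repeat split; auto; lra|].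
    change (fun x => p x) with p. change (fun x => q x) with q. rewrite E1, E2. simpl.
    change (@eq R) with (@eq R). field. lra.
  - apply (is_derive_ext (fun s => - q s / (p s * p s + q s * q s))%R).
    { intros s. unfold Cinv, p, q, Re, Im. simpl. f_equal. ring. }
    auto_derive; [repeat split; auto; lra|].
    change (fun x => p x) with p. change (fun x => q x) with q. rewrite E1, E2. simpl.
    field. lra.
Qed.

Lemma CDer_pow (f : R -> C) t l n :
  CDer f t l -> CDer (fun s => f s ^ S n) t (Cnat (S n) * f t ^ n * l).
Proof.
  intros F. induction n as [|n IH].
  - apply (CDer_ext f); [intros; simpl; ring|].
    eapply CDer_eq; [|exact F]. unfold Cnat. simpl. ring.
  - apply (CDer_ext (fun s => f s * f s ^ S n)); [intros; reflexivity|].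
    eapply CDer_eq; [|apply CDer_mult; [exact F|exact IH]].
    rewrite (Cnat_S (S n)). simpl. ring.
Qed.

Definition bc (b : C) (m : nat) : C := poch b m / Cfact m.

Lemma bc_0 b : bc b 0 = 1.
Proof. unfold bc. change (Cfact 0) with (RtoC 1). simpl. field. Qed.

(** Taylor's formula along the segment from [u0] to [u0 - v]: the derivative of
    [u^(-b)] of order [m] in the segment parameter is
    [(b)_m v^m u^(-b-m)]. *)
Lemma binomial_remainder (b u0 v : C) (M : nat) (K : R) :
  (forall s, 0 <= s <= 1 -> slit (u0 - RtoC s * v)) ->
  (forall s, 0 <= s <= 1 ->
    Cmod (poch b (S M)) / INR (fact M) * (Cmod (Cexp (- b * Clg (u0 - RtoC s * v))) *
      (Cmod v * / Cmod (u0 - RtoC s * v)) ^ S M * (1 - s) ^ M) <= K) ->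
  Rle (Cmod (Cexp (- b * Clg (u0 - v)) -
        sum_n (fun m => (bc b m * (v ^ m * (Cexp (- b * Clg u0) * (/ u0) ^ m)))%C) M)) (2 * K).
Proof.
  intros S HK.
  set (u := fun s : R => u0 - RtoC s * v) in *.
  assert (Du : forall s, CDer u s (- v)).
  { intros s. apply (CDer_ext (fun s => u0 + (- v) * RtoC s)).
    - intros r. unfold u. ring.
    - eapply CDer_eq; [|apply CDer_plus; [apply CDer_const|apply CDer_scal, (CDer_real (fun s => s)), @is_derive_id]].
      change (RtoC one) with (RtoC 1). ring. }
  set (f := fun (m : nat) (s : R) => poch b m * v ^ m * (Cexp (- b * Clg (u s)) * (/ u s) ^ m)).
  assert (Df : forall m s, 0 <= s <= 1 -> CDer (f m) s (f (Datatypes.S m) s)).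
  { intros m s Hs. assert (N := slit_neq0 _ (S s Hs)).
    assert (DE : CDer (fun s => Cexp (- b * Clg (u s))) s (b * v * / u s * Cexp (- b * Clg (u s)))).
    { eapply CDer_eq; [|apply CDer_Cexp, CDer_scal, CDer_Clg; [now apply S|apply Du]].
      cbv beta. unfold Cdiv. ring. }
    unfold f. apply CDer_scal with (c := poch b m * v ^ m) in DE as DE0.
    destruct m as [|m].
    - apply (CDer_ext (fun s => poch b 0 * v ^ 0 * Cexp (- b * Clg (u s)))); [intros; simpl; ring|].
      eapply CDer_eq; [|exact DE0]. simpl. unfold Cnat. simpl. ring.
    - eapply CDer_eq; [|apply CDer_scal, CDer_mult; [exact DE|apply CDer_pow, CDer_inv; [exact N|apply Du]]].
      cbv beta. change (poch b (Datatypes.S (Datatypes.S m))) with (poch b (Datatypes.S m) * (b + Cnat (Datatypes.S m))).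
      rewrite !Cpow_S. ring. }
  pose proof (taylor_bound f M K Df) as T.
  replace (Cexp (- b * Clg (u0 - v))) with (f 0%nat 1%R).
  2:{ unfold f, u. simpl. rewrite !Cmult_1_l. apply Cmult_1_r. }
  erewrite sum_n_ext; [apply T|].
  - intros s Hs. eapply Rle_trans; [|apply (HK s Hs)]. right.
    unfold f. rewrite !Cmod_mult, !Cmod_pow, Cmod_inv by (apply slit_neq0; now apply S).
    rewrite Rpow_mult_distr. unfold Rdiv. change (u0 - RtoC s * v) with (u s). ring.
  - intros m. unfold f, u, bc. cbv beta.
    replace (u0 - RtoC 0 * v) with u0 by ring. unfold Cdiv. cring.
Qed.

(** ** The slit plane and the kernel [(1 - x t)^(-b)] *)

Lemma slit_iff u : slit u <-> Im u <> 0%R \/ (0 < Re u).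
Proof.
  unfold slit. generalize (Cmod_sqr_sum u) (Cmod_ge_0 u). set (r := Cmod u).
  intros H H0. split.
  - intros P. destruct (Req_dec (Im u) 0) as [E|E]; [right|now left].
    rewrite E in H. nra.
  - intros [P|P]; [|lra].
    assert (0 < Im u * Im u) by nra.
    destruct (Rlt_dec 0 (r + Re u)) as [Q|Q]; [exact Q|]. nra.
Qed.

Lemma Re_div_Cmod_bound (u : C) : u <> 0 -> -1 <= Re u / Cmod u <= 1.
Proof.
  intros Hu. apply Cmod_gt_0 in Hu. generalize (re_le_Cmod u). intros H.
  apply Rabs_le_between in H.
  split; apply (Rmult_le_reg_r (Cmod u)); auto;
    unfold Rdiv; rewrite Rmult_assoc, Rinv_l by lra; lra.
Qed.

Lemma cut_plane_slit x : cut_plane x <-> slit (1 - x).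
Proof.
  assert (A : forall u : C, u <> 0 -> Rabs (Carg u) = acos (Re u / Cmod u)%R).
  { intros u _. unfold Carg. generalize (acos_bound (Re u / Cmod u)). intros B.
    destruct (Rle_dec 0 (Im u)); [rewrite Rabs_pos_eq|rewrite Rabs_Ropp, Rabs_pos_eq]; lra. }
  split.
  - intros [N H]. assert (U : 1 - x <> 0) by (intros E; apply N; symmetry; now apply Ceq_minus).
    rewrite A in H by easy. unfold slit.
    assert (P := proj1 (Cmod_gt_0 _) U).
    destruct (Rlt_dec 0 (Cmod (1 - x) + Re (1 - x))) as [Q|Q]; [exact Q|exfalso].
    assert (E : Re (1 - x) = (- Cmod (1 - x))%R).
    { generalize (re_le_Cmod (1 - x)). intros B. apply Rabs_le_between in B. lra. }
    replace (Re (1 - x) / Cmod (1 - x))%R with (-1)%R in H.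
    + replace (-1)%R with (- (1))%R in H by ring. rewrite acos_opp, acos_1 in H. lra.
    + rewrite E. field. lra.
  - intros S. assert (U := slit_neq0 _ S). split.
    + intros ->. apply U. ring.
    + rewrite A by easy. destruct (acos_bound (Re (1 - x) / Cmod (1 - x))) as [_ [H|H]]; [exact H|exfalso].
      assert (C := cos_acos _ (Re_div_Cmod_bound _ U)). rewrite H, cos_PI in C.
      assert (P := proj1 (Cmod_gt_0 _) U). unfold slit in S.
      assert (Re (1 - x) = -1 * Cmod (1 - x))%R; [rewrite C; field; lra|lra].
Qed.

Lemma slit_star x t : slit (1 - x) -> 0 <= t <= 1 -> slit (1 - x * RtoC t).
Proof.
  rewrite !slit_iff. intros H Ht.
  rewrite re_minus, im_minus, re_scal_r, im_scal_r in *. simpl in *.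
  destruct (Req_dec (Im x) 0) as [E|E].
  - right. destruct H as [H|H]; [lra|]. destruct (Req_dec t 1) as [->|T]; [lra|]. nra.
  - destruct (Req_dec t 0) as [->|T]; [right; lra|left]. intros Q.
    assert (Im x * t = 0)%R by lra. apply Rmult_integral in H0. tauto.
Qed.

Lemma slit_open x0 : slit (1 - x0) ->
  exists r, 0 < r /\ forall x, Cmod (x - x0) < r -> slit (1 - x).
Proof.
  rewrite slit_iff, re_minus, im_minus. simpl. intros [H|H].
  - exists (Rabs (Im x0)). split; [apply Rabs_pos_lt; lra|].
    intros x Hx. apply slit_iff. left. rewrite im_minus. simpl. intros E.
    generalize (im_le_Cmod (x - x0)). rewrite im_minus.
    replace (Im x) with 0%R by lra. rewrite Rminus_0_l, Rabs_Ropp. lra.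
  - exists (1 - Re x0)%R. split; [lra|].
    intros x Hx. apply slit_iff. right. rewrite re_minus. simpl.
    generalize (re_le_Cmod (x - x0)). rewrite re_minus. intros B. apply Rabs_le_between in B. lra.
Qed.

(** Off the real axis the distance from 0 to the line of the points [1 - x t] is
    [|Im x| / |x|]. *)
Lemma slit_lower x : slit (1 - x) ->
  exists r, 0 < r /\ forall t, 0 <= t <= 1 -> r <= Cmod (1 - x * RtoC t).
Proof.
  intros H. apply slit_iff in H. rewrite re_minus, im_minus in H. simpl in H.
  destruct (Req_dec (Im x) 0) as [E|E].
  - destruct H as [H|H]; [lra|].
    exists (Rmin 1 (1 - Re x)). split; [apply Rmin_glb_lt; lra|].
    intros t Ht. generalize (re_le_Cmod (1 - x * RtoC t)). rewrite re_minus, re_scal_r. simpl.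
    intros B. apply Rabs_le_between in B.
    generalize (Rmin_l 1 (1 - Re x)) (Rmin_r 1 (1 - Re x)). nra.
  - set (p := Re x) in *. set (q := Im x) in *.
    assert (Q : 0 < q * q) by nra.
    assert (S : 0 < p * p + q * q) by nra.
    exists (sqrt (q * q / (p * p + q * q))). split.
    + apply sqrt_lt_R0. now apply Rdiv_lt_0_compat.
    + intros t _. unfold Cmod. apply sqrt_le_1_alt.
      change (fst (1 - x * RtoC t)) with (Re (1 - x * RtoC t)).
      change (snd (1 - x * RtoC t)) with (Im (1 - x * RtoC t)).
      rewrite re_minus, im_minus, re_scal_r, im_scal_r. simpl. fold p q.
      apply (Rmult_le_reg_r (p * p + q * q)); [easy|].
      unfold Rdiv. rewrite Rmult_assoc, Rinv_l by lra.
      generalize (Rle_0_sqr ((p * p + q * q) * t - p)). unfold Rsqr. nra.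
Qed.

Lemma Cexp_Clg_bound b r R : 0 < r ->
  exists K, 0 < K /\ forall u, r <= Cmod u <= R -> Cmod (Cexp (- b * Clg u)) <= K.
Proof.
  intros Hr. exists (exp (Cmod b * (Rabs (ln r) + Rabs (ln R) + PI))). split; [apply exp_pos|].
  intros u Hu. rewrite Cmod_Cexp. apply exp_le_compat.
  eapply Rle_trans; [apply Rle_abs|]. eapply Rle_trans; [apply re_le_Cmod|].
  rewrite Cmod_mult, Cmod_opp. apply Rmult_le_compat_l; [apply Cmod_ge_0|].
  eapply Rle_trans; [apply Cmod_le_Re_Im|]. apply Rplus_le_compat; [|apply Im_Clg_bound].
  simpl. assert (ln r <= ln (Cmod u)) by (apply ln_le; lra).
  assert (ln (Cmod u) <= ln R) by (apply ln_le; lra).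
  generalize (Rle_abs (ln R)) (Rle_abs (- ln r)) (Rabs_pos (ln r)) (Rabs_pos (ln R)). rewrite Rabs_Ropp.
  intros. apply Rabs_le. lra.
Qed.

(** [(1 - x t)^(-b)], with the power that is smooth for [x] in the cut plane. *)
Definition kern (b x : C) (t : R) : C := Cexp (- b * Clg (1 - x * RtoC t)).

Lemma CDer_affine x t : CDer (fun t => 1 - x * RtoC t) t (- x).
Proof.
  apply (CDer_ext (fun t => 1 + (- x) * RtoC t)); [intros; ring|].
  eapply CDer_eq; [|apply CDer_plus; [apply CDer_const|apply CDer_scal, (CDer_real (fun s => s)), @is_derive_id]].
  change (RtoC one) with (RtoC 1). ring.
Qed.

Lemma C01_kern b x : slit (1 - x) -> C01 (kern b x).
Proof.
  intros S t Ht. eapply CDer_Ccont. unfold kern. apply CDer_Cexp, CDer_scal, CDer_Clg.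
  - now apply slit_star.
  - apply CDer_affine.
Qed.

Lemma C01_inv x : slit (1 - x) -> C01 (fun t => / (1 - x * RtoC t)).
Proof.
  intros S t Ht. eapply CDer_Ccont. apply CDer_inv; [|apply CDer_affine].
  apply slit_neq0. now apply slit_star.
Qed.

Lemma kern_range x t : 0 <= t <= 1 -> Cmod (1 - x * RtoC t) <= 1 + Cmod x.
Proof.
  intros Ht. eapply Rle_trans; [apply Cmod_triangle_minus|].
  rewrite Cmod_1, Cmod_mult, Cmod_R, Rabs_pos_eq by lra. generalize (Cmod_ge_0 x). nra.
Qed.

Lemma kern_bound b x : slit (1 - x) ->
  exists K, 0 < K /\ forall t, 0 <= t <= 1 -> Cmod (kern b x t) <= K.
Proof.
  intros S. destruct (slit_lower x S) as [r [Hr Hl]].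
  destruct (Cexp_Clg_bound b r (1 + Cmod x) Hr) as [K [HK H]].
  exists K. split; [exact HK|]. intros t Ht. apply H. split; [now apply Hl|now apply kern_range].
Qed.

Lemma Clg_1 : Clg 1 = 0.
Proof. rewrite Clg_real by lra. now rewrite ln_1. Qed.

(** The binomial series itself converges only for [|x t| < 1], but its remainder
    needs no convergence: for [x] in the cut plane the points [1 - x s t] stay
    away from 0, so the derivatives in Taylor's formula are bounded uniformly
    on the interval. *)
Lemma kern_taylor b x N : slit (1 - x) ->
  exists K, 0 < K /\ forall t, 0 <= t <= 1 ->
    Rle (Cmod (kern b x t - sum_n (fun m => (bc b m * x ^ m * RtoC t ^ m)%C) N)) (K * t ^ S N).
Proof.
  intros S. destruct (slit_lower x S) as [r [Hr Hl]].
  destruct (Cexp_Clg_bound b r (1 + Cmod x) Hr) as [K0 [HK H]].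
  set (A := (Cmod (poch b (Datatypes.S N)) / INR (fact N))%R).
  assert (HA : 0 <= A).
  { pos. }
  assert (HX : 0 <= Cmod x * / r).
  { pos. }
  set (B := ((Cmod x * / r) ^ Datatypes.S N)%R).
  assert (HB : 0 <= B) by now apply pow_le.
  exists (2 * (A * (K0 * B)) + 1)%R. split.
  { assert (0 <= A * (K0 * B)); [|lra]. pos. }
  intros t Ht.
  assert (Pt : 0 <= t ^ Datatypes.S N) by (apply pow_le; lra).
  apply Rle_trans with (2 * (A * (K0 * B) * t ^ Datatypes.S N))%R; [|nra].
  unfold kern.
  erewrite sum_n_ext; [apply (binomial_remainder b 1 (x * RtoC t) N)|].
  - intros s Hs. replace (1 - RtoC s * (x * RtoC t)) with (1 - x * RtoC (s * t)) by (rewrite RtoC_mult; ring).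
    apply slit_star; [exact S|nra].
  - intros s Hs. replace (1 - RtoC s * (x * RtoC t)) with (1 - x * RtoC (s * t)) by (rewrite RtoC_mult; ring).
    assert (Hst : 0 <= s * t <= 1) by nra.
    fold A. replace (A * (K0 * B) * t ^ Datatypes.S N)%R with (A * (K0 * (B * t ^ Datatypes.S N)))%R by ring. apply Rmult_le_compat_l; [exact HA|].
    assert (L := Hl _ Hst).
    assert (E1 : Cmod (Cexp (- b * Clg (1 - x * RtoC (s * t)))) <= K0).
    { apply H. split; [exact L|now apply kern_range]. }
    assert (E2 : (Cmod (x * RtoC t) * / Cmod (1 - x * RtoC (s * t))) ^ Datatypes.S N <= B * t ^ Datatypes.S N).
    { unfold B. rewrite <- Rpow_mult_distr. apply pow_incr. split.
      - pos.
      - rewrite Cmod_mult, Cmod_R, Rabs_pos_eq by lra.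
        replace (Cmod x * / r * t)%R with (Cmod x * t * / r)%R by ring.
        apply Rmult_le_compat_l; [pos|].
        apply Rinv_le_contravar; lra. }
    assert (E3 := pow_01 (1 - s) N ltac:(lra)).
    assert (E4 := Cmod_ge_0 (Cexp (- b * Clg (1 - x * RtoC (s * t))))).
    set (X := Cmod (Cexp (- b * Clg (1 - x * RtoC (s * t))))) in *.
    assert (E5 : 0 <= (Cmod (x * RtoC t) * / Cmod (1 - x * RtoC (s * t))) ^ Datatypes.S N).
    { pos. }
    set (Y := ((Cmod (x * RtoC t) * / Cmod (1 - x * RtoC (s * t))) ^ Datatypes.S N)%R) in *.
    set (Z := ((1 - s) ^ N)%R) in *.
    rewrite Rmult_assoc. apply Rmult_le_compat; [lra|nra|lra|nra].
  - intros m. cbv beta. rewrite Clg_1, Cmult_0_r, Cexp_0.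
    replace (/ 1) with (RtoC 1) by field. rewrite Cpow_1_l, Cpow_mult_l. cring.
Qed.

(** Along the segment from [1 - x0 t] to [1 - x t] the modulus is at least
    [(1 - s q) |1 - x0 t|], so that the weight [1 - s] in the remainder pays for
    the approach to the singularity: [(1 - s) q / (1 - s q) <= q]. This gives
    the geometric factor [q^M], uniformly in [t]. *)
Lemma kern_expand b x0 x q : 0 <= q < 1 ->
  (forall s, 0 <= s <= 1 -> slit (1 - (x0 + RtoC s * (x - x0)))) ->
  (forall t, 0 <= t <= 1 -> Cmod (x - x0) * t <= q * Cmod (1 - x0 * RtoC t)) ->
  exists K, 0 < K /\ forall M t, 0 <= t <= 1 ->
    Rle (Cmod (kern b x t - sum_n (fun m => (bc b m * ((x - x0) * RtoC t) ^ m *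
            (kern b x0 t * (/ (1 - x0 * RtoC t)) ^ m))%C) M))
        (K * (Cmod (poch b (S M)) / INR (fact M) * q ^ M)).
Proof.
  intros Hq Sl Hv.
  assert (S0 : slit (1 - x0)).
  { replace (1 - x0) with (1 - (x0 + RtoC 0 * (x - x0))) by ring. apply Sl. lra. }
  destruct (slit_lower x0 S0) as [r [Hr Hl]].
  set (r' := ((1 - q) * r)%R). assert (Hr' : 0 < r') by pos.
  set (R0 := (1 + Cmod x0 + Cmod (x - x0))%R).
  destruct (Cexp_Clg_bound b r' R0 Hr') as [K0 [HK H]].
  set (D := Cmod (x - x0)) in *. assert (HD : 0 <= D) by apply Cmod_ge_0.
  exists (2 * (K0 * (D * / r')) + 1)%R.
  assert (HDr : 0 <= D * / r') by pos.
  split. { assert (0 <= K0 * (D * / r')); [|lra]. pos. }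
  intros M t Ht.
  set (A := (Cmod (poch b (S M)) / INR (fact M))%R).
  assert (HA : 0 <= A).
  { pos. }
  assert (Pq : 0 <= q ^ M) by (apply pow_le; lra).
  apply Rle_trans with (2 * (A * (K0 * (D * / r' * q ^ M))))%R; [|assert (0 <= A * q ^ M) by pos; nra].
  unfold kern.
  replace (1 - x * RtoC t) with ((1 - x0 * RtoC t) - (x - x0) * RtoC t) by ring.
  apply Rle_trans with (2 := Rle_refl _).
  erewrite sum_n_ext; [apply (binomial_remainder b (1 - x0 * RtoC t) ((x - x0) * RtoC t) M)|].
  - intros s Hs.
    replace (1 - x0 * RtoC t - RtoC s * ((x - x0) * RtoC t)) with (1 - (x0 + RtoC s * (x - x0)) * RtoC t) by ring.
    apply slit_star; [now apply Sl|exact Ht].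
  - intros s Hs. fold A. apply Rmult_le_compat_l; [exact HA|].
    set (u := 1 - x0 * RtoC t - RtoC s * ((x - x0) * RtoC t)).
    assert (Ev : Cmod ((x - x0) * RtoC t) = (D * t)%R).
    { rewrite Cmod_mult, Cmod_R, Rabs_pos_eq by lra. reflexivity. }
    assert (Esv : Cmod (RtoC s * ((x - x0) * RtoC t)) = (s * (D * t))%R).
    { rewrite Cmod_mult, Ev, Cmod_R, Rabs_pos_eq by lra. reflexivity. }
    specialize (Hv t Ht). assert (Ll := Hl t Ht).
    set (c0 := Cmod (1 - x0 * RtoC t)) in *.
    assert (Dt : 0 <= D * t) by pos.
    assert (U1 : c0 - s * (D * t) <= Cmod u).
    { rewrite <- Esv. apply Cmod_triangle_rev. }
    assert (U2 : r' <= Cmod u).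
    { unfold r'. assert (s * (D * t) <= q * c0) by nra. nra. }
    assert (U3 : Cmod u <= R0).
    { eapply Rle_trans; [apply Cmod_triangle_minus|]. rewrite Esv. unfold R0.
      generalize (kern_range x0 t Ht). fold c0. intros. assert (s * (D * t) <= D) by nra. lra. }
    assert (Hu : 0 < / Cmod u) by (apply Rinv_0_lt_compat; lra).
    assert (E1 : Cmod (Cexp (- b * Clg u)) <= K0) by now apply H.
    assert (E2 : D * t * / Cmod u * (1 - s) <= q).
    { apply (Rmult_le_reg_r (Cmod u)); [lra|].
      replace (D * t * / Cmod u * (1 - s) * Cmod u)%R with (D * t * (1 - s))%R by (field; lra).
      assert (0 <= (1 - q) * (s * (D * t))) by pos.
      assert (q * (c0 - s * (D * t)) <= q * Cmod u) by (apply Rmult_le_compat_l; lra). lra. }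
    assert (E3 : D * t * / Cmod u <= D * / r').
    { apply Rmult_le_compat; [lra|lra|nra|]. apply Rinv_le_contravar; lra. }
    rewrite Ev, Rmult_assoc.
    apply Rmult_le_compat; [apply Cmod_ge_0| |exact E1|].
    + pos.
    + simpl. rewrite Rmult_assoc, <- Rpow_mult_distr.
      apply Rmult_le_compat; [pos| |exact E3|].
      * pos.
      * apply pow_incr. split; [|exact E2]. pos.
  - intros m. unfold Cdiv. cring.
Qed.

(** ** Ratio test for null sequences *)

Lemma lim_0_ratio (w : nat -> R) q N : 0 <= q < 1 -> (forall n, 0 <= w n)%R ->
  (forall n, (N <= n)%nat -> w (S n) <= q * w n) -> is_lim_seq w 0.
Proof.
  intros Hq H0 H.
  apply (is_lim_seq_incr_n _ N).
  apply (is_lim_seq_le_le (fun _ => 0%R) _ (fun n => w N * q ^ n)%R).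
  - intros n. split; [apply H0|]. induction n as [|n IH]; simpl.
    + lra.
    + replace (S (n + N)) with (S (n + N)) by reflexivity.
      eapply Rle_trans; [apply H; lia|]. nra.
  - apply is_lim_seq_const.
  - replace (Finite 0) with (Rbar_mult (w N) 0) by (simpl; f_equal; ring).
    apply is_lim_seq_scal_l. apply is_lim_seq_geom. rewrite Rabs_pos_eq; lra.
Qed.

Lemma archimed_nat (x : R) : exists N, forall n, (N <= n)%nat -> x <= INR n.
Proof.
  destruct (INR_unbounded x) as [N HN]. exists N. intros n Hn. apply le_INR in Hn. lra.
Qed.

Lemma poch_q_lim b q : 0 <= q < 1 ->
  is_lim_seq (fun M => Cmod (poch b (S M)) / INR (fact M) * q ^ M)%R 0.
Proof.
  intros Hq.
  destruct (archimed_nat (2 * Cmod b * / (1 - q) + 1)) as [N HN].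
  assert (P : forall n, 0 < / INR (fact n)) by (intros; apply Rinv_0_lt_compat, INR_fact_lt_0).
  apply (lim_0_ratio _ ((1 + q) / 2) N); [lra| |].
  - intros n. pos.
  - intros n Hn. specialize (HN n Hn).
    change (poch b (S (S n))) with (poch b (S n) * (b + Cnat (S n))).
    rewrite Cmod_mult, fact_simpl, mult_INR. unfold Rdiv. rewrite Rinv_mult.
    assert (E : Cmod (b + Cnat (S n)) <= Cmod b + INR (S n)).
    { eapply Rle_trans; [apply Cmod_triangle|]. unfold Cnat. rewrite Cmod_R, Rabs_pos_eq by apply pos_INR. lra. }
    assert (I : 0 < INR (S n)) by (apply lt_0_INR; lia).
    assert (B : Cmod b <= (1 - q) / 2 * INR (S n)).
    { rewrite S_INR. apply (Rmult_le_reg_r (2 * / (1 - q))).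
      - apply Rmult_lt_0_compat; [lra|]. apply Rinv_0_lt_compat. lra.
      - replace ((1 - q) / 2 * (INR n + 1) * (2 * / (1 - q)))%R with (INR n + 1)%R by (field; lra). lra. }
    assert (F : q * (Cmod (b + Cnat (S n)) * / INR (S n)) <= (1 + q) / 2).
    { apply (Rmult_le_reg_r (INR (S n))); [easy|].
      replace (q * (Cmod (b + Cnat (S n)) * / INR (S n)) * INR (S n))%R with (q * Cmod (b + Cnat (S n)))%R by (field; lra).
      assert (q * Cmod (b + Cnat (S n)) <= q * (Cmod b + INR (S n))) by (apply Rmult_le_compat_l; lra).
      assert (0 <= (1 - q) * Cmod b) by pos. lra. }
    assert (G : 0 <= Cmod (poch b (S n)) * / INR (fact n) * q ^ n).
    { pos. }
    simpl (q ^ S n)%R. set (X := Cmod (b + Cnat (S n))) in *.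
    replace (Cmod (poch b (S n)) * X * (/ INR (S n) * / INR (fact n)) * (q * q ^ n))%R
      with (q * (X * / INR (S n)) * (Cmod (poch b (S n)) * / INR (fact n) * q ^ n))%R by ring.
    replace ((1 + q) * / 2)%R with ((1 + q) / 2)%R by reflexivity.
    now apply Rmult_le_compat_r.
Qed.

Lemma exp_q_lim r : 0 <= r -> is_lim_seq (fun M => r ^ S M / INR (fact M))%R 0.
Proof.
  intros Hr. destruct (archimed_nat (2 * r)) as [N HN].
  assert (P : forall n, 0 < / INR (fact n)) by (intros; apply Rinv_0_lt_compat, INR_fact_lt_0).
  apply (lim_0_ratio _ (1/2) N); [lra| |].
  - intros n. pos.
  - intros n Hn. specialize (HN n Hn).
    assert (I : 0 < INR (S n)) by (apply lt_0_INR; lia).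
    assert (G : 0 <= r ^ S n * / INR (fact n)) by pos.
    rewrite fact_simpl, mult_INR. unfold Rdiv. rewrite Rinv_mult.
    replace (r ^ S (S n) * (/ INR (S n) * / INR (fact n)))%R with (r * / INR (S n) * (r ^ S n * / INR (fact n)))%R by (simpl; ring).
    apply Rmult_le_compat_r; [exact G|].
    apply (Rmult_le_reg_r (INR (S n))); [easy|]. rewrite Rmult_assoc, Rinv_l by lra. rewrite S_INR. lra.
Qed.

(** * Limits and series of complex sequences *)

Definition Clim (u : nat -> C) (l : C) : Prop := is_lim_seq (fun n => Cmod (u n - l)) 0.

Lemma lim_0_le (u v : nat -> R) : (forall n, 0 <= u n <= v n)%R -> is_lim_seq v 0 -> is_lim_seq u 0.
Proof.
  intros H V. apply (is_lim_seq_le_le (fun _ => 0%R) u v); [exact H|apply is_lim_seq_const|exact V].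
Qed.

Lemma Clim_bound (u : nat -> C) l (e : nat -> R) :
  (forall n, Cmod (u n - l) <= e n) -> is_lim_seq e 0 -> Clim u l.
Proof. intros H E. apply (lim_0_le _ e); [|exact E]. intros n; split; [apply Cmod_ge_0|apply H]. Qed.

Lemma lim_0_abs (u : nat -> R) (l : R) : is_lim_seq (fun n => Rabs (u n - l)) 0 -> is_lim_seq u l.
Proof.
  intros H. apply is_lim_seq_spec. apply is_lim_seq_spec in H. intros eps.
  destruct (H eps) as [N HN]. exists N. intros n Hn. specialize (HN n Hn).
  rewrite Rminus_0_r, Rabs_Rabsolu in HN. exact HN.
Qed.

Lemma Clim_Re u l : Clim u l -> is_lim_seq (fun n => Re (u n)) (Re l).
Proof.
  intros H. apply lim_0_abs. apply (lim_0_le _ (fun n => Cmod (u n - l))); [|exact H].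
  intros n; split; [apply Rabs_pos|]. rewrite <- re_minus. apply re_le_Cmod.
Qed.

Lemma Clim_Im u l : Clim u l -> is_lim_seq (fun n => Im (u n)) (Im l).
Proof.
  intros H. apply lim_0_abs. apply (lim_0_le _ (fun n => Cmod (u n - l))); [|exact H].
  intros n; split; [apply Rabs_pos|]. rewrite <- im_minus. apply im_le_Cmod.
Qed.

Lemma lim_plus_0 u v : is_lim_seq u 0 -> is_lim_seq v 0 -> is_lim_seq (fun n => u n + v n)%R 0.
Proof. intros U V. replace 0%R with (0 + 0)%R by ring. now apply is_lim_seq_plus'. Qed.

Lemma lim_scal_0 k u : is_lim_seq u 0 -> is_lim_seq (fun n => k * u n)%R 0.
Proof.
  intros U. replace (Finite 0) with (Rbar_mult k 0) by (simpl; f_equal; ring).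
  now apply is_lim_seq_scal_l.
Qed.

Lemma lim_mult_0 u v : is_lim_seq u 0 -> is_lim_seq v 0 -> is_lim_seq (fun n => u n * v n)%R 0.
Proof. intros U V. replace 0%R with (0 * 0)%R by ring. now apply is_lim_seq_mult'. Qed.

Lemma Clim_comp u l : is_lim_seq (fun n => Re (u n)) (Re l) -> is_lim_seq (fun n => Im (u n)) (Im l) -> Clim u l.
Proof.
  assert (K : forall (v : nat -> R) (m : R), is_lim_seq v m -> is_lim_seq (fun n => Rabs (v n - m)) 0).
  { intros v m H. apply is_lim_seq_spec. apply is_lim_seq_spec in H. intros eps.
    destruct (H eps) as [N HN]. exists N. intros n Hn. specialize (HN n Hn).
    rewrite Rminus_0_r, Rabs_Rabsolu. exact HN. }
  intros H1 H2. apply (Clim_bound _ _ (fun n => Rabs (Re (u n) - Re l) + Rabs (Im (u n) - Im l))%R).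
  - intros n. rewrite <- re_minus, <- im_minus. apply Cmod_le_Re_Im.
  - apply lim_plus_0; now apply K.
Qed.

Lemma Clim_unique u l l' : Clim u l -> Clim u l' -> l = l'.
Proof.
  intros H H'. apply C_eq.
  - apply Clim_Re in H. apply Clim_Re in H'. apply is_lim_seq_unique in H. apply is_lim_seq_unique in H'.
    rewrite H in H'. now injection H'.
  - apply Clim_Im in H. apply Clim_Im in H'. apply is_lim_seq_unique in H. apply is_lim_seq_unique in H'.
    rewrite H in H'. now injection H'.
Qed.

Lemma CLim_seq_eq u l : Clim u l -> CLim_seq u = l.
Proof.
  intros H. unfold CLim_seq.
  rewrite (is_lim_seq_unique _ _ (Clim_Re _ _ H)), (is_lim_seq_unique _ _ (Clim_Im _ _ H)).
  now destruct l.
Qed.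

Lemma Clim_eq u l l' : l = l' -> Clim u l -> Clim u l'.
Proof. now intros ->. Qed.

Lemma Clim_const c : Clim (fun _ => c) c.
Proof.
  apply (Clim_bound _ _ (fun _ => 0%R)); [|apply is_lim_seq_const].
  intros _. replace (c - c) with (RtoC 0) by ring. rewrite Cmod_0. lra.
Qed.

Lemma Clim_ext_loc u v l N : (forall n, (N <= n)%nat -> u n = v n) -> Clim u l -> Clim v l.
Proof.
  intros E. apply is_lim_seq_ext_loc. exists N. intros n Hn. now rewrite E.
Qed.

Lemma Clim_ext u v l : (forall n, u n = v n) -> Clim u l -> Clim v l.
Proof. intros E. apply (Clim_ext_loc _ _ _ 0). intros; apply E. Qed.

Lemma Clim_plus u v l m : Clim u l -> Clim v m -> Clim (fun n => u n + v n) (l + m).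
Proof.
  intros U V. apply (Clim_bound _ _ (fun n => Cmod (u n - l) + Cmod (v n - m))%R).
  - intros n. replace (u n + v n - (l + m)) with ((u n - l) + (v n - m)) by ring. apply Cmod_triangle.
  - now apply lim_plus_0.
Qed.

Lemma Clim_mult u v l m : Clim u l -> Clim v m -> Clim (fun n => u n * v n) (l * m).
Proof.
  intros U V.
  apply (Clim_bound _ _ (fun n => Cmod (u n - l) * Cmod (v n - m) + (Cmod l * Cmod (v n - m) + Cmod m * Cmod (u n - l)))%R).
  - intros n. replace (u n * v n - l * m) with ((u n - l) * (v n - m) + (l * (v n - m) + m * (u n - l))) by ring.
    rewrite <- !Cmod_mult. eapply Rle_trans; [apply Cmod_triangle|]. apply Rplus_le_compat_l, Cmod_triangle.
  - apply lim_plus_0; [now apply lim_mult_0|]. apply lim_plus_0; now apply lim_scal_0.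
Qed.

Lemma Clim_scal c u l : Clim u l -> Clim (fun n => c * u n) (c * l).
Proof. intros U. apply Clim_mult; [apply Clim_const|exact U]. Qed.

Lemma Clim_Cmod u l : Clim u l -> is_lim_seq (fun n => Cmod (u n)) (Cmod l).
Proof.
  intros U. apply lim_0_abs. apply (lim_0_le _ (fun n => Cmod (u n - l))); [|exact U].
  intros n. split; [apply Rabs_pos|]. apply Rabs_le.
  generalize (Cmod_triangle_rev (u n) l) (Cmod_triangle_rev l (u n)). rewrite (Cmod_minus_sym l). lra.
Qed.

Lemma Clim_inv (u : nat -> C) (l : C) : l <> 0 -> (forall n, u n <> 0) -> Clim u l -> Clim (fun n => / u n) (/ l).
Proof.
  intros L N U. unfold Clim.
  apply (is_lim_seq_ext (fun n => / Cmod l * (Cmod (u n - l) * / Cmod (u n)))%R).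
  - intros n. rewrite <- !Cmod_inv, <- !Cmod_mult by auto.
    replace (/ l * ((u n - l) * / u n)) with (- (/ u n - / l)) by (field; auto). apply Cmod_opp.
  - apply lim_scal_0. replace 0%R with (0 * / Cmod l)%R by ring. apply is_lim_seq_mult'; [exact U|].
    assert (P : Cmod l <> 0%R). { intros E. apply L. now apply Cmod_eq_0. }
    apply (is_lim_seq_inv _ (Cmod l)); [now apply Clim_Cmod|]. intros E. now injection E.
Qed.

Lemma Clim_decr u l : Clim (fun n => u (S n)) l -> Clim u l.
Proof. intros U. apply (is_lim_seq_incr_1 (fun n => Cmod (u n - l))). exact U. Qed.

Notation Cis_series := (is_series (K := C_AbsRing) (V := C_NormedModule)).
Notation Cis_pseries := (is_pseries (K := C_AbsRing) (V := C_NormedModule)).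

Lemma Cis_series_Clim (u : nat -> C) (l : C) : Cis_series u l <-> Clim (sum_n u) l.
Proof.
  unfold is_series, Clim. split.
  - intros H. apply is_lim_seq_spec. intros eps.
    assert (L : locally (T := C_NormedModule) l (fun z => (Cmod (z - l) < eps))).
    { apply (locally_le_locally_norm (V := C_NormedModule)). exists eps. intros z Hz. exact Hz. }
    destruct (H _ L) as [N HN]. exists N. intros n Hn.
    rewrite Rminus_0_r, Rabs_pos_eq by apply Cmod_ge_0. exact (HN n Hn).
  - intros H P HP. apply (locally_norm_le_locally (V := C_NormedModule)) in HP.
    destruct HP as [eps HP]. apply is_lim_seq_spec in H. destruct (H eps) as [N HN].
    exists N. intros n Hn. apply HP. specialize (HN n Hn).
    rewrite Rminus_0_r, Rabs_pos_eq in HN by apply Cmod_ge_0. exact HN.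
Qed.

Lemma pow_n_Cpow (z : C) n : pow_n (K := C_AbsRing) z n = z ^ n.
Proof. induction n as [|n IH]; simpl; [reflexivity|]. rewrite IH. reflexivity. Qed.

Lemma Cis_pseries_Clim (u : nat -> C) (z l : C) :
  Cis_pseries u z l <-> Clim (sum_n (fun n => u n * z ^ n)) l.
Proof.
  unfold is_pseries. rewrite Cis_series_Clim.
  assert (E : forall n, sum_n (fun k => scal (pow_n (K := C_AbsRing) z k) (u k)) n = sum_n (fun n => u n * z ^ n) n).
  { intros n. apply sum_n_ext. intros k. rewrite pow_n_Cpow. apply Cmult_comm. }
  split; apply Clim_ext; intros n; now rewrite E.
Qed.

Lemma sum_n_Re (u : nat -> C) n : sum_n (fun k => Re (u k)) n = Re (sum_n u n).
Proof.
  induction n as [|n IH]; [now rewrite !sum_O|].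
  rewrite sum_n_C_S, re_plus, <- IH. now rewrite sum_Sn.
Qed.

Lemma sum_n_Im (u : nat -> C) n : sum_n (fun k => Im (u k)) n = Im (sum_n u n).
Proof.
  induction n as [|n IH]; [now rewrite !sum_O|].
  rewrite sum_n_C_S, im_plus, <- IH. now rewrite sum_Sn.
Qed.

Lemma CSeries_eq (u : nat -> C) (l : C) : Clim (sum_n u) l -> CSeries u = l.
Proof.
  intros H. unfold CSeries, Series.
  rewrite (Lim_seq_ext _ _ (sum_n_Re u)), (Lim_seq_ext _ _ (sum_n_Im u)).
  rewrite (is_lim_seq_unique _ _ (Clim_Re _ _ H)), (is_lim_seq_unique _ _ (Clim_Im _ _ H)).
  now destruct l.
Qed.

Lemma sum_n_Cplus (u v : nat -> C) n : sum_n (fun k => u k + v k) n = sum_n u n + sum_n v n.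
Proof. apply (sum_n_plus (G := C_AbelianMonoid)). Qed.

Lemma sum_n_Cscal (c : C) (u : nat -> C) n : sum_n (fun k => c * u k) n = c * sum_n u n.
Proof. apply (sum_n_mult_l (K := C_Ring)). Qed.

Lemma Cmod_sum (u : nat -> C) n : Cmod (sum_n u n) <= sum_n (fun k => Cmod (u k)) n.
Proof.
  induction n as [|n IH]; [rewrite !sum_O; lra|].
  rewrite sum_n_C_S, sum_Sn. eapply Rle_trans; [apply Cmod_triangle|].
  unfold plus; simpl. lra.
Qed.

Lemma Cinv_neq0 (z : C) : z <> 0 -> / z <> 0.
Proof. intros H E. apply C1_nz. rewrite <- (Cinv_r z), E by easy. ring. Qed.

(** * Beta integrals *)

Definition beta_int (a d : C) : C := CInt (fun t => rpow (a - 1) t * rpow (d - 1) (1 - t)).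

Lemma C01_rpow s : 0 < Re s -> C01 (rpow s).
Proof. intros H t _. now apply Ccont_rpow. Qed.

Lemma continuous_1m t : continuous (fun t : R => (1 - t)%R) t.
Proof. apply (ex_derive_continuous (fun t : R => (1 - t)%R)). auto_derive. trivial. Qed.

Lemma C01_rpow1 s : 0 < Re s -> C01 (fun t => rpow s (1 - t)).
Proof. intros H t _. apply (Ccont_comp (rpow s)); [apply continuous_1m|now apply Ccont_rpow]. Qed.

Lemma Re_m1 a : 1 < Re a -> 0 < Re (a - 1).
Proof. rewrite re_minus. simpl. lra. Qed.

Lemma C01_beta_int a d : 1 < Re a -> 1 < Re d -> C01 (fun t => rpow (a - 1) t * rpow (d - 1) (1 - t)).
Proof.
  intros Ha Hd. apply (C01_mult (rpow (a - 1)) (fun t => rpow (d - 1) (1 - t))).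
  - now apply C01_rpow, Re_m1.
  - now apply C01_rpow1, Re_m1.
Qed.

Lemma Re_p1 a : 1 < Re a -> 1 < Re (a + 1).
Proof. rewrite re_plus. simpl. lra. Qed.

Lemma beta_int_split a d : 1 < Re a -> 1 < Re d -> beta_int a d = beta_int (a + 1) d + beta_int a (d + 1).
Proof.
  intros Ha Hd. unfold beta_int. rewrite <- CInt_plus by (apply C01_beta_int; auto using Re_p1).
  apply CInt_ext. intros t Ht.
  replace (a + 1 - 1) with (a - 1 + 1) by ring. replace (d + 1 - 1) with (d - 1 + 1) by ring.
  rewrite !rpow_S, RtoC_minus. ring.
Qed.

Lemma beta_int_parts a d : 1 < Re a -> 1 < Re d -> a * beta_int a (d + 1) = d * beta_int (a + 1) d.
Proof.
  intros Ha Hd.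
  assert (E : CInt (fun t => a * (rpow (a - 1) t * rpow (d + 1 - 1) (1 - t)) +
                      (- d) * (rpow (a + 1 - 1) t * rpow (d - 1) (1 - t))) = 0).
  { rewrite (CInt_FTC (fun t => rpow a t * rpow d (1 - t))).
    - cbv beta. rewrite !rpow_1, (rpow_neg a 0), (rpow_neg d (1 - 1)) by lra. ring.
    - intros t _. replace (a + 1 - 1) with a by ring. replace (d + 1 - 1) with d by ring.
      eapply CDer_eq; [|apply CDer_mult; [now apply CDer_rpow|]].
      2:{ apply (CDer_comp (rpow d) (fun t => 1 - t)%R t (d * rpow (d - 1) (1 - t)) (-1)); [now apply CDer_rpow|].
          auto_derive; [trivial|ring]. }
      cbv beta. ring.
    - apply C01_plus; apply C01_scal, C01_beta_int; auto using Re_p1. }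
  assert (C1 := C01_beta_int a (d + 1) Ha (Re_p1 d Hd)).
  assert (C2 := C01_beta_int (a + 1) d (Re_p1 a Ha) Hd).
  rewrite (CInt_plus _ _ (C01_scal a _ C1) (C01_scal (- d) _ C2)) in E.
  rewrite (CInt_scal a _ C1), (CInt_scal (- d) _ C2) in E.
  fold (beta_int a (d + 1)) (beta_int (a + 1) d) in E.
  rewrite <- (Cplus_0_r (d * beta_int (a + 1) d)), <- E. ring.
Qed.

Lemma beta_int_S_l a d : 1 < Re a -> 1 < Re d -> beta_int (a + 1) d * (a + d) = a * beta_int a d.
Proof.
  intros Ha Hd. rewrite (beta_int_split a d) by easy.
  transitivity (a * beta_int (a + 1) d + d * beta_int (a + 1) d); [ring|]. rewrite <- beta_int_parts by easy. ring.
Qed.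

Lemma beta_int_S_r a d : 1 < Re a -> 1 < Re d -> beta_int a (d + 1) * (a + d) = d * beta_int a d.
Proof.
  intros Ha Hd. rewrite (beta_int_split a d) by easy.
  transitivity (a * beta_int a (d + 1) + d * beta_int a (d + 1)); [ring|]. rewrite beta_int_parts by easy. ring.
Qed.

Lemma Re_Cnat n : Re (Cnat n) = INR n.
Proof. reflexivity. Qed.

Lemma Re_pn a n : 1 < Re a -> 1 < Re (a + Cnat n).
Proof. rewrite re_plus, Re_Cnat. generalize (pos_INR n). lra. Qed.

Lemma beta_int_n_l a d n : 1 < Re a -> 1 < Re d -> beta_int (a + Cnat n) d * poch (a + d) n = poch a n * beta_int a d.
Proof.
  intros Ha Hd. induction n as [|n IH].
  - simpl. replace (a + Cnat 0) with a by (unfold Cnat; simpl; ring). ring.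
  - rewrite Cnat_S. simpl. replace (a + (Cnat n + 1)) with (a + Cnat n + 1) by ring.
    transitivity (poch (a + d) n * (beta_int (a + Cnat n + 1) d * (a + Cnat n + d))); [ring|].
    rewrite beta_int_S_l by auto using Re_pn.
    transitivity ((a + Cnat n) * (beta_int (a + Cnat n) d * poch (a + d) n)); [ring|]. rewrite IH. ring.
Qed.

Lemma beta_int_n_r a d n : 1 < Re a -> 1 < Re d -> beta_int a (d + Cnat n) * poch (a + d) n = poch d n * beta_int a d.
Proof.
  intros Ha Hd. induction n as [|n IH].
  - simpl. replace (d + Cnat 0) with d by (unfold Cnat; simpl; ring). ring.
  - rewrite Cnat_S. simpl. replace (d + (Cnat n + 1)) with (d + Cnat n + 1) by ring.
    transitivity (poch (a + d) n * (beta_int a (d + Cnat n + 1) * (a + (d + Cnat n)))); [ring|].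
    rewrite beta_int_S_r by auto using Re_pn.
    transitivity ((d + Cnat n) * (beta_int a (d + Cnat n) * poch (a + d) n)); [ring|]. rewrite IH. ring.
Qed.

Lemma Re_neq0 a : 0 < Re a -> a <> 0.
Proof. intros H ->. simpl in H. lra. Qed.

(** An elementary value: [B(a, 2) = 1 / (a (a + 1))]. *)
Lemma beta_int_2_neq0 a : 1 < Re a -> beta_int a 2 <> 0.
Proof.
  intros Ha.
  assert (Na : a <> 0) by (apply Re_neq0; lra).
  assert (Na1 : a + 1 <> 0) by (apply Re_neq0; rewrite re_plus; simpl; lra).
  assert (E : beta_int a 2 = / a * / (a + 1)).
  { unfold beta_int.
    rewrite (CInt_ext _ (fun t => rpow (a - 1) t + (- (1)) * rpow (a + 1 - 1) t)).
    2:{ intros t Ht. replace (2 - 1) with (RtoC 1) by ring. rewrite rpow_one by lra.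
        replace (a + 1 - 1) with (a - 1 + 1) by ring. rewrite rpow_S, RtoC_minus. ring. }
    rewrite (CInt_FTC (fun t => / a * rpow a t + (- / (a + 1)) * rpow (a + 1) t)).
    - cbv beta. rewrite !rpow_1, !(rpow_neg _ 0) by lra. field. auto.
    - intros t _. eapply CDer_eq; [|apply CDer_plus; apply CDer_scal, CDer_rpow; auto using Re_p1].
      field. auto.
    - apply C01_plus; [|apply C01_scal]; apply C01_rpow; rewrite ?re_minus, ?re_plus; simpl; lra. }
  rewrite E. apply Cmult_neq_0; now apply Cinv_neq0.
Qed.

(** * The Gamma function *)

(** The hypothesis is a form of [p (n+1) / p n = 1 + O(1/n^2)] that telescopes.
    From a late index [N] on, the increments sum to at most half of [|p N|], so
    the sequence is Cauchy and stays away from 0. *)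
Lemma lim_of_ratio (p : nat -> C) (K : R) (n0 : nat) : 0 <= K -> (1 <= n0)%nat ->
  (forall n, (n0 <= n)%nat -> Cmod (p (S n) - p n) <= Cmod (p n) * (K * (/ INR n - / INR (S n)))) ->
  exists l, Clim p l /\ ((forall n, p n <> 0) -> l <> 0).
Proof.
  intros HK Hn0 H.
  destruct (archimed_nat (4 * K)) as [N1 HN1].
  set (N0 := Nat.max n0 N1).
  (* By induction on [k]: as long as the bound holds, [|p (N + k)| <= 2 |p N|],
     which bounds the next increment. *)
  assert (claim : forall N k, (N0 <= N)%nat ->
    Cmod (p (N + k)%nat - p N) <= Cmod (p N) * (2 * K * (/ INR N - / INR (N + k)))).
  { intros N k HN.
    assert (B : forall k, 0 < / INR (N + k) <= / INR N).
    { intros j. split; [apply Rinv_0_lt_compat, lt_0_INR; lia|].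
      apply Rinv_le_contravar; [apply lt_0_INR; lia|apply le_INR; lia]. }
    assert (B4 : 4 * K * / INR N <= 1).
    { assert (0 < INR N) by (apply lt_0_INR; lia).
      apply (Rmult_le_reg_r (INR N)); [easy|]. rewrite Rmult_assoc, Rinv_l by lra.
      specialize (HN1 N ltac:(lia)). lra. }
    induction k as [|k IH].
    - rewrite Nat.add_0_r. replace (p N - p N) with (RtoC 0) by ring. rewrite Cmod_0. lra.
    - replace (N + S k)%nat with (S (N + k)) by lia.
      replace (p (S (N + k)) - p N) with ((p (S (N + k)) - p (N + k)%nat) + (p (N + k)%nat - p N)) by ring.
      eapply Rle_trans; [apply Cmod_triangle|].
      specialize (H (N + k)%nat ltac:(lia)).
      assert (C2 : Cmod (p (N + k)%nat) <= 2 * Cmod (p N)).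
      { replace (p (N + k)%nat) with ((p (N + k)%nat - p N) + p N) by ring.
        eapply Rle_trans; [apply Cmod_triangle|].
        assert (Cmod (p N) * (2 * K * (/ INR N - / INR (N + k))) <= Cmod (p N) * 1); [|lra].
        apply Rmult_le_compat_l; [apply Cmod_ge_0|]. generalize (B k). nra. }
      assert (D : 0 <= / INR (N + k) - / INR (S (N + k))).
      { assert (/ INR (S (N + k)) <= / INR (N + k)); [|lra].
        apply Rinv_le_contravar; [apply lt_0_INR; lia|apply le_INR; lia]. }
      assert (Cmod (p (N + k)%nat) * (K * (/ INR (N + k) - / INR (S (N + k))))
        <= 2 * Cmod (p N) * (K * (/ INR (N + k) - / INR (S (N + k))))).
      { apply Rmult_le_compat_r; [now apply Rmult_le_pos|exact C2]. }
      lra. }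
  assert (far : forall N n, (N0 <= N <= n)%nat -> Cmod (p n - p N) <= Cmod (p N) * (2 * K * / INR N)).
  { intros N n Hn. replace n with (N + (n - N))%nat by lia.
    eapply Rle_trans; [apply claim; lia|]. apply Rmult_le_compat_l; [apply Cmod_ge_0|].
    apply Rmult_le_compat_l; [lra|].
    assert (0 < / INR (N + (n - N))) by (apply Rinv_0_lt_compat, lt_0_INR; lia). lra. }
  set (P := Cmod (p N0)). assert (HP : 0 <= P) by apply Cmod_ge_0.
  assert (half : 2 * K * / INR N0 <= 1 / 2).
  { assert (0 < INR N0) by (apply lt_0_INR; lia).
    apply (Rmult_le_reg_r (INR N0)); [easy|]. rewrite Rmult_assoc, Rinv_l by lra.
    specialize (HN1 N0 ltac:(lia)). lra. }
  assert (up : forall n, (N0 <= n)%nat -> P / 2 <= Cmod (p n) <= 2 * P).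
  { intros n Hn. assert (F := far N0 n ltac:(lia)). fold P in F.
    assert (P * (2 * K * / INR N0) <= P * (1 / 2)) by (now apply Rmult_le_compat_l).
    generalize (Cmod_triangle_rev (p n) (p N0)) (Cmod_triangle_rev (p N0) (p n)).
    rewrite (Cmod_minus_sym (p N0)). fold P. lra. }
  assert (cauchy : forall eps : posreal, exists N, forall n m, (N <= n)%nat -> (N <= m)%nat -> Cmod (p n - p m) < eps).
  { intros eps. destruct (archimed_nat (16 * P * K * / eps + 1)) as [N HN].
    exists (Nat.max N N0).
    assert (Q : forall n, (Nat.max N N0 <= n)%nat -> Cmod (p n - p (Nat.max N N0)) < eps / 2).
    { intros n Hn. eapply Rle_lt_trans; [apply far; lia|].
      set (N' := Nat.max N N0) in *. specialize (HN N' ltac:(lia)).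
      assert (I : 0 < INR N') by (apply lt_0_INR; lia).
      eapply Rle_lt_trans; [apply Rmult_le_compat_r; [|apply (up N'); lia]|].
      - apply Rmult_le_pos; [lra|]. left. now apply Rinv_0_lt_compat.
      - apply (Rmult_lt_reg_r (INR N')); [easy|].
        replace (2 * P * (2 * K * / INR N') * INR N')%R with (4 * P * K)%R by (field; lra).
        destruct eps as [e He]; simpl in *.
        assert (16 * P * K * / e * e < INR N' * e) by (apply Rmult_lt_compat_r; lra).
        rewrite Rmult_assoc, Rinv_l in H0 by lra.
        assert (0 <= P * K) by now apply Rmult_le_pos. lra. }
    intros n m Hn Hm.
    replace (p n - p m) with ((p n - p (Nat.max N N0)) - (p m - p (Nat.max N N0))) by ring.
    eapply Rle_lt_trans; [apply Cmod_triangle_minus|]. generalize (Q n Hn) (Q m Hm). lra. }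
  assert (c1 : ex_finite_lim_seq (fun n => Re (p n))).
  { apply ex_lim_seq_cauchy_corr. intros eps. destruct (cauchy eps) as [N HN]. exists N.
    intros n m Hn Hm. eapply Rle_lt_trans; [|apply (HN n m Hn Hm)]. rewrite <- re_minus. apply re_le_Cmod. }
  assert (c2 : ex_finite_lim_seq (fun n => Im (p n))).
  { apply ex_lim_seq_cauchy_corr. intros eps. destruct (cauchy eps) as [N HN]. exists N.
    intros n m Hn Hm. eapply Rle_lt_trans; [|apply (HN n m Hn Hm)]. rewrite <- im_minus. apply im_le_Cmod. }
  destruct c1 as [l1 L1]. destruct c2 as [l2 L2].
  assert (L : Clim p (l1, l2)) by now apply Clim_comp.
  exists (l1, l2). split; [exact L|]. intros Np E.
  apply Clim_Cmod in L. rewrite E, Cmod_0 in L.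
  assert (P0 : 0 < P) by (apply Cmod_gt_0, Np).
  assert (Rbar_le (P / 2)%R 0%R); [|simpl in *; lra].
  apply (is_lim_seq_le_loc (fun _ => (P / 2)%R) (fun n => Cmod (p n))).
  - exists N0. intros n Hn. now apply up.
  - apply is_lim_seq_const.
  - exact L.
Qed.

Definition euler_seq (a : C) (n : nat) : C := Cfact n * Cpower (Cnat n) a / poch a (S n).

Lemma Cpower_nat a n : (1 <= n)%nat -> Cpower (Cnat n) a = rpow a (INR n).
Proof.
  intros Hn. assert (0 < INR n) by (apply lt_0_INR; lia).
  rewrite rpow_pos by easy. unfold Cpower. f_equal. f_equal. unfold Clog, Cnat.
  rewrite Cmod_R, Rabs_pos_eq by lra. unfold RtoC at 2. f_equal.
  unfold Carg. rewrite Cmod_R, Rabs_pos_eq by lra. simpl.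
  destruct (Rle_dec 0 0); [|lra]. unfold Rdiv. rewrite Rinv_r by lra. apply acos_1.
Qed.

Lemma not_nonpos_neq a n : ~ nonpos_int a -> a + Cnat n <> 0.
Proof. intros H E. apply H. exists n. rewrite <- (Cplus_0_r (- Cnat n)), <- E. ring. Qed.

Lemma not_nonpos_S a : ~ nonpos_int a -> ~ nonpos_int (a + 1).
Proof.
  intros H [n E]. apply H. exists (S n). rewrite Cnat_S.
  replace a with (a + 1 - 1) by ring. rewrite E. ring.
Qed.

Lemma not_nonpos_plus a n : ~ nonpos_int a -> ~ nonpos_int (a + Cnat n).
Proof.
  intros H. induction n as [|n IH].
  - replace (a + Cnat 0) with a by (unfold Cnat; simpl; ring). exact H.
  - rewrite Cnat_S, Cplus_assoc. now apply not_nonpos_S.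
Qed.

Lemma not_nonpos_0 a : ~ nonpos_int a -> a <> 0.
Proof. intros H E. apply H. exists 0%nat. rewrite E. unfold Cnat. simpl. ring. Qed.

Lemma poch_neq0 a n : ~ nonpos_int a -> poch a n <> 0.
Proof.
  intros H. induction n as [|n IH]; simpl; [apply C1_nz|].
  apply Cmult_neq_0; [exact IH|now apply not_nonpos_neq].
Qed.

Lemma not_nonpos_Re a : 0 < Re a -> ~ nonpos_int a.
Proof. intros H [n ->]. rewrite re_opp, Re_Cnat in H. generalize (pos_INR n). lra. Qed.

Lemma Cpower_neq0 z w : Cpower z w <> 0.
Proof. apply Cexp_neq0. Qed.

Lemma euler_seq_neq0 a n : ~ nonpos_int a -> euler_seq a n <> 0.
Proof.
  intros H. unfold euler_seq, Cdiv. apply Cmult_neq_0; [apply Cmult_neq_0|].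
  - apply Cfact_neq0.
  - apply Cpower_neq0.
  - now apply Cinv_neq0, poch_neq0.
Qed.

Lemma ln_le_sub1 x : 0 < x -> ln x <= x - 1.
Proof.
  intros H. rewrite <- (ln_exp (x - 1)). apply ln_le; [easy|]. generalize (exp_ineq1_le (x - 1)). lra.
Qed.

Lemma ln_succ_bounds x : 0 < x -> / (x + 1) <= ln (x + 1) - ln x <= / x.
Proof.
  intros H. split.
  - assert (ln (x / (x + 1)) <= x / (x + 1) - 1) by (apply ln_le_sub1, Rdiv_lt_0_compat; lra).
    rewrite ln_div in H0 by lra. replace (x / (x + 1) - 1)%R with (- / (x + 1))%R in H0 by (field; lra). lra.
  - assert (ln ((x + 1) / x) <= (x + 1) / x - 1) by (apply ln_le_sub1, Rdiv_lt_0_compat; lra).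
    rewrite ln_div in H0 by lra. replace ((x + 1) / x - 1)%R with (/ x)%R in H0 by (field; lra). lra.
Qed.

(** The ratio of consecutive terms is [(n+1) (1 + 1/n)^a / (a + n + 1)], and
    [(1 + 1/n)^a = 1 + a/n + O(1/n^2)]. *)
Lemma euler_seq_ratio a : ~ nonpos_int a -> exists K n0, 0 <= K /\ (1 <= n0)%nat /\
  forall n, (n0 <= n)%nat ->
   Cmod (euler_seq a (S n) - euler_seq a n) <= Cmod (euler_seq a n) * (K * (/ INR n - / INR (S n))).
Proof.
  intros Ha. destruct (archimed_nat (2 * Cmod a)) as [N HN].
  set (A := Cmod a). assert (HA : 0 <= A) by apply Cmod_ge_0.
  set (E := (2 * (A ^ 2 * exp A))%R).
  assert (HE : 0 <= E).
  { unfold E. generalize (exp_pos A). assert (0 <= A ^ 2) by (apply pow_le; easy). intros. nra. }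
  exists (2 * (2 * E + A))%R, (S N). split; [lra|]. split; [lia|]. intros n Hn.
  set (x := INR n). assert (Hx : 1 <= x) by (change 1%R with (INR 1); apply le_INR; lia).
  assert (Hx2 : 2 * A <= x) by (apply HN; lia).
  rewrite S_INR. fold x.
  set (lam := (ln (x + 1) - ln x)%R).
  assert (Hl := ln_succ_bounds x ltac:(lra)). fold lam in Hl.
  set (w := a * RtoC lam).
  assert (Nan : a + Cnat (S n) <> 0) by now apply not_nonpos_neq.
  assert (Np : poch a (S n) <> 0) by now apply poch_neq0.
  assert (E1 : euler_seq a (S n) - euler_seq a n = euler_seq a n * ((Cnat (S n) * (Cexp w - 1 - w) + (Cnat (S n) * w - a)) * / (a + Cnat (S n)))).
  { unfold euler_seq. rewrite !Cpower_nat by lia.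
    rewrite !rpow_pos by (apply lt_0_INR; lia).
    replace (a * RtoC (ln (INR (S n)))) with (a * RtoC (ln (INR n)) + w).
    2:{ unfold w, lam, x. rewrite <- S_INR, RtoC_minus. ring. }
    rewrite Cexp_plus, Cfact_S. change (poch a (S (S n))) with (poch a (S n) * (a + Cnat (S n))).
    field. auto. }
  rewrite E1, Cmod_mult. apply Rmult_le_compat_l; [apply Cmod_ge_0|].
  rewrite Cmod_mult, Cmod_inv by easy.
  assert (D : (x + 1) / 2 <= Cmod (a + Cnat (S n))).
  { replace (a + Cnat (S n)) with (Cnat (S n) - - a) by ring.
    eapply Rle_trans; [|apply Cmod_triangle_rev]. rewrite Cmod_opp. unfold Cnat.
    rewrite Cmod_R, S_INR, Rabs_pos_eq by (fold x; lra). fold x A. lra. }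
  assert (W : (Cmod w = A * lam)%R).
  { unfold w. rewrite Cmod_mult, Cmod_R, Rabs_pos_eq; [reflexivity|].
    assert (0 < / (x + 1)) by (apply Rinv_0_lt_compat; lra). lra. }
  assert (Pl : 0 < / (x + 1)) by (apply Rinv_0_lt_compat; lra).
  assert (Px : 0 < / x <= 1).
  { split; [apply Rinv_0_lt_compat; lra|]. rewrite <- Rinv_1. apply Rinv_le_contravar; lra. }
  assert (B1 : Cmod (Cexp w - 1 - w) <= E * (/ x * / x)).
  { eapply Rle_trans; [apply Cexp_minus_1_w|]. rewrite W. unfold E.
    rewrite Rmult_assoc. apply Rmult_le_compat_l; [lra|].
    rewrite Rpow_mult_distr.
    assert (exp (A * lam) <= exp A) by (apply exp_le_compat; nra).
    assert (lam ^ 2 <= / x * / x) by (simpl; nra).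
    assert (0 <= A ^ 2) by (apply pow_le; easy).
    generalize (exp_pos (A * lam)); intros.
    replace (A ^ 2 * exp A * (/ x * / x))%R with ((A ^ 2 * (/ x * / x)) * exp A)%R by ring.
    apply Rmult_le_compat; [|lra| |lra].
    - apply Rmult_le_pos; [easy|]. apply pow_le. lra.
    - now apply Rmult_le_compat_l. }
  assert (B2 : Cmod (Cnat (S n) * w - a) <= A * / x).
  { replace (Cnat (S n) * w - a) with (a * RtoC ((x + 1) * lam - 1)).
    - rewrite Cmod_mult, Cmod_R. apply Rmult_le_compat_l; [easy|]. apply Rabs_le.
      assert (F1 : ((x + 1) * / (x + 1) = 1)%R) by (field; lra).
      assert (F2 : (x * / x = 1)%R) by (field; lra). split; nra.
    - unfold w, Cnat. rewrite S_INR. fold x. rewrite RtoC_minus, RtoC_mult. ring. }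
  assert (B3 : Cmod (Cnat (S n) * (Cexp w - 1 - w) + (Cnat (S n) * w - a)) <= (2 * E + A) * / x).
  { eapply Rle_trans; [apply Cmod_triangle|]. rewrite Cmod_mult. unfold Cnat at 1.
    rewrite Cmod_R, S_INR, Rabs_pos_eq by (fold x; lra). fold x.
    assert ((x + 1) * Cmod (Cexp w - 1 - w) <= (2 * x) * (E * (/ x * / x))).
    { apply Rmult_le_compat; [lra|apply Cmod_ge_0|lra|exact B1]. }
    replace (2 * x * (E * (/ x * / x)))%R with (2 * E * / x)%R in H by (field; lra). lra. }
  replace (2 * (2 * E + A) * (/ x - / (x + 1)))%R with ((2 * E + A) * / x * (2 * / (x + 1)))%R by (field; lra).
  apply Rmult_le_compat; [apply Cmod_ge_0| |exact B3|].
  - left. apply Rinv_0_lt_compat. lra.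
  - replace (2 * / (x + 1))%R with (/ ((x + 1) / 2))%R by (field; lra). apply Rinv_le_contravar; lra.
Qed.

Lemma CGamma_spec a : ~ nonpos_int a -> Clim (euler_seq a) (CGamma a) /\ CGamma a <> 0.
Proof.
  intros Ha. destruct (euler_seq_ratio a Ha) as [K [n0 [HK [Hn0 H]]]].
  destruct (lim_of_ratio (euler_seq a) K n0 HK Hn0 H) as [l [L N]].
  replace (CGamma a) with l; [split; [exact L|]|].
  - apply N. intros n. now apply euler_seq_neq0.
  - symmetry. apply CLim_seq_eq. exact L.
Qed.

Lemma CGamma_neq0 a : ~ nonpos_int a -> CGamma a <> 0.
Proof. intros H. now apply CGamma_spec. Qed.

Lemma Clim_inv_nat a : Clim (fun n => / (a + Cnat n)) 0.
Proof.
  destruct (archimed_nat (2 * Cmod a + 1)) as [N HN].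
  unfold Clim.
  apply (is_lim_seq_le_le_loc (fun _ => 0%R) _ (fun n => 2 * / INR n)%R).
  - exists (S N). intros n Hn. split; [apply Cmod_ge_0|].
    specialize (HN n ltac:(lia)). assert (A := Cmod_ge_0 a).
    assert (D : INR n / 2 <= Cmod (a + Cnat n)).
    { replace (a + Cnat n) with (Cnat n - - a) by ring.
      eapply Rle_trans; [|apply Cmod_triangle_rev]. rewrite Cmod_opp. unfold Cnat.
      rewrite Cmod_R, Rabs_pos_eq by lra. lra. }
    replace (/ (a + Cnat n) - 0) with (/ (a + Cnat n)) by ring.
    rewrite Cmod_inv by (apply Cmod_neq0; lra).
    replace (2 * / INR n)%R with (/ (INR n / 2))%R by (field; lra). apply Rinv_le_contravar; lra.
  - apply is_lim_seq_const.
  - apply lim_scal_0. replace (Finite 0) with (Rbar_inv p_infty) by reflexivity.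
    apply is_lim_seq_inv; [apply is_lim_seq_INR|discriminate].
Qed.

Lemma Clim_shift_ratio c d : ~ nonpos_int d -> Clim (fun n => (c + Cnat n) * / (d + Cnat n)) 1.
Proof.
  intros Hd. apply (Clim_ext (fun n => 1 + (c - d) * / (d + Cnat n))).
  - intros n. field. now apply not_nonpos_neq.
  - apply (Clim_eq _ (1 + (c - d) * 0)); [ring|].
    apply Clim_plus; [apply Clim_const|apply Clim_scal, Clim_inv_nat].
Qed.

Lemma poch_shift a n : a * poch (a + 1) n = poch a (S n).
Proof.
  induction n as [|n IH].
  - simpl. unfold Cnat. simpl. ring.
  - change (poch (a + 1) (S n)) with (poch (a + 1) n * (a + 1 + Cnat n)).
    change (poch a (S (S n))) with (poch a (S n) * (a + Cnat (S n))).
    rewrite <- IH, Cnat_S. ring.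
Qed.

Lemma CGamma_S a : ~ nonpos_int a -> CGamma (a + 1) = a * CGamma a.
Proof.
  intros Ha. assert (Ha1 := not_nonpos_S a Ha).
  destruct (CGamma_spec a Ha) as [L _]. destruct (CGamma_spec _ Ha1) as [L1 _].
  apply (Clim_unique _ _ _ L1).
  apply (Clim_ext_loc (fun n => a * euler_seq a n * ((0 + Cnat n) * / (a + 1 + Cnat n))) _ _ 1).
  - intros n Hn. unfold euler_seq. rewrite !Cpower_nat by lia.
    rewrite rpow_S. fold (Cnat n).
    assert (Na := not_nonpos_0 a Ha). assert (Nn := not_nonpos_neq (a + 1) n Ha1).
    assert (P1 := poch_neq0 (a + 1) n Ha1).
    rewrite <- poch_shift. simpl. field. auto.
  - replace (a * CGamma a) with (a * CGamma a * 1) by ring. apply Clim_mult.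
    + now apply Clim_scal.
    + now apply Clim_shift_ratio.
Qed.

(** The constant in Watson's lemma, read off from Euler's limit formula. *)
Lemma beta_int_lim a d : 1 < Re a -> 1 < Re d ->
  Clim (fun n => rpow a (INR n) * beta_int a (d + Cnat n)) (beta_int a d * (CGamma (a + d) * / CGamma d)).
Proof.
  intros Ha Hd.
  assert (Nd : ~ nonpos_int d) by (apply not_nonpos_Re; lra).
  assert (Nc : ~ nonpos_int (a + d)) by (apply not_nonpos_Re; rewrite re_plus; lra).
  destruct (CGamma_spec d Nd) as [Ld Gd]. destruct (CGamma_spec _ Nc) as [Lc _].
  apply (Clim_ext_loc (fun n => beta_int a d * (euler_seq (a + d) n * / euler_seq d n) * ((a + d + Cnat n) * / (d + Cnat n))) _ _ 1).
  - intros n Hn. assert (I := beta_int_n_r a d n Ha Hd).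
    assert (Pc := poch_neq0 _ n Nc). assert (Pd := poch_neq0 _ n Nd).
    assert (Qc := not_nonpos_neq _ n Nc). assert (Qd := not_nonpos_neq _ n Nd).
    replace (beta_int a (d + Cnat n)) with (poch d n * beta_int a d / poch (a + d) n) by (rewrite <- I; field; auto).
    unfold euler_seq. rewrite !Cpower_nat, rpow_plus by lia. simpl.
    field. repeat split; auto using Cfact_neq0.
    rewrite <- Cpower_nat by lia. apply Cpower_neq0.
  - replace (beta_int a d * (CGamma (a + d) * / CGamma d)) with (beta_int a d * (CGamma (a + d) * / CGamma d) * 1) by ring.
    apply Clim_mult; [|now apply Clim_shift_ratio].
    apply Clim_scal, Clim_mult; [exact Lc|]. apply Clim_inv; [exact Gd| |exact Ld].
    intros n. now apply euler_seq_neq0.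
Qed.

(** * Laplace integrals *)

(** Writing [1 - t] as [1 - (1/2) (2 t)] makes the kernel estimates available
    for [t] up to [1/2]; at [x = 1] itself they fail. *)
Lemma kern_half d t : t < 1 -> kern (1 - d) (RtoC (1/2)) (2 * t) = rpow (d - 1) (1 - t).
Proof.
  intros Ht. rewrite rpow_pos by lra. unfold kern.
  replace (1 - RtoC (1/2) * RtoC (2 * t)) with (RtoC (1 - t)).
  - rewrite Clg_real by lra. f_equal. ring.
  - rewrite <- RtoC_mult, <- RtoC_minus. f_equal. field.
Qed.

Lemma sum_n_bound (u : nat -> C) (v : nat -> R) n :
  (forall k, Cmod (u k) <= v k) -> Cmod (sum_n u n) <= sum_n v n.
Proof.
  intros H. eapply Rle_trans; [apply Cmod_sum|]. induction n as [|n IH].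
  - rewrite !sum_O. apply H.
  - rewrite !sum_Sn. unfold plus; simpl. generalize (H (S n)). lra.
Qed.

(** On [0, 1/2] this is the estimate for the kernel at [x = 1/2]; on [1/2, 1]
    both functions are bounded and [t^(N+1)] is bounded below. *)
Lemma onemt_taylor d N : 1 < Re d -> exists K, 0 < K /\ forall t, 0 <= t <= 1 ->
  Rle (Cmod (rpow (d - 1) (1 - t) - sum_n (fun m => (bc (1 - d) m * RtoC t ^ m)%C) N)) (K * t ^ S N).
Proof.
  intros Hd.
  assert (Sl : slit (1 - RtoC (1/2))).
  { apply slit_iff. right. rewrite <- RtoC_minus. simpl. lra. }
  destruct (kern_taylor (1 - d) (RtoC (1/2)) N Sl) as [K1 [HK1 H1]].
  set (K2 := sum_n (fun k => Cmod (bc (1 - d) k)) N).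
  assert (P2 : 0 < 2 ^ S N) by (apply pow_lt; lra).
  assert (B2 : forall t, 0 <= t <= 1 -> Rle (Cmod (sum_n (fun m => (bc (1 - d) m * RtoC t ^ m)%C) N)) K2).
  { intros t Ht. apply sum_n_bound. intros k. rewrite Cmod_mult, Cmod_pow, Cmod_R, Rabs_pos_eq by lra.
    generalize (pow_01 t k Ht) (Cmod_ge_0 (bc (1 - d) k)). nra. }
  assert (K2pos : 0 <= K2).
  { eapply Rle_trans; [apply Cmod_ge_0|]. apply (B2 0%R). lra. }
  exists ((K1 + 1 + K2) * 2 ^ S N)%R. split; [apply Rmult_lt_0_compat; lra|].
  intros t Ht. assert (Pt : 0 <= t ^ S N) by (apply pow_le; lra).
  destruct (Rle_dec t (1/2)) as [Hs|Hs].
  - specialize (H1 (2 * t)%R ltac:(lra)). rewrite kern_half in H1 by lra.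
    rewrite Rpow_mult_distr in H1.
    erewrite sum_n_ext.
    + eapply Rle_trans; [exact H1|].
      replace (K1 * (2 ^ S N * t ^ S N))%R with (K1 * 2 ^ S N * t ^ S N)%R by ring.
      apply Rmult_le_compat_r; [exact Pt|]. apply Rmult_le_compat_r; lra.
    + intros m. cbv beta. rewrite <- Cmult_assoc, <- Cpow_mult_l. f_equal. f_equal.
      rewrite <- RtoC_mult. f_equal. field.
  - eapply Rle_trans; [apply Cmod_triangle_minus|].
    assert (1 <= 2 ^ S N * t ^ S N).
    { rewrite <- Rpow_mult_distr. apply pow_R1_Rle. lra. }
    assert (Cmod (rpow (d - 1) (1 - t)) <= 1).
    { apply Cmod_rpow_le_1; [lra|]. left. now apply Re_m1. }
    specialize (B2 t Ht).
    rewrite Rmult_assoc. set (X := (2 ^ S N * t ^ S N)%R) in *. nra.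
Qed.

Lemma pow_exp_bound s k : 0 < s -> 0 < k ->
  exists K, 0 < K /\ forall r, 0 < r -> Rpower r s * exp (- (k * r)) <= K.
Proof.
  intros Hs Hk. exists (exp (s * (ln (s / k) - 1))). split; [apply exp_pos|].
  intros r Hr. unfold Rpower. rewrite <- exp_plus. apply exp_le_compat.
  assert (Q : ln (r * (k / s)) <= r * (k / s) - 1).
  { apply ln_le_sub1. apply Rmult_lt_0_compat; [easy|now apply Rdiv_lt_0_compat]. }
  rewrite ln_mult in Q by (try easy; now apply Rdiv_lt_0_compat).
  rewrite ln_div in * by easy.
  assert (s * (ln r + (ln k - ln s)) <= s * (r * (k / s) - 1)) by (apply Rmult_le_compat_l; lra).
  replace (s * (r * (k / s) - 1))%R with (k * r - s)%R in H by (field; lra). lra.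
Qed.

(** The modulus of [rpow] is used for [t^s] because [Rpower 0 s] is 1, which
    would make the integrand discontinuous at 0. *)
Definition real_laplace (s k : R) : R := RInt (fun t => Cmod (rpow (RtoC s) t) * exp (- (k * t)))%R 0 1.

Lemma continuous_real_laplace s k t : 0 < s -> continuous (fun t => Cmod (rpow (RtoC s) t) * exp (- (k * t)))%R t.
Proof.
  intros Hs. apply @continuous_mult.
  - apply continuous_Cmod. now apply Ccont_rpow.
  - apply (ex_derive_continuous (fun t => exp (- (k * t)))). auto_derive. trivial.
Qed.

Lemma ex_real_laplace s k : 0 < s -> ex_RInt (fun t => Cmod (rpow (RtoC s) t) * exp (- (k * t)))%R 0 1.
Proof. intros Hs. apply ex_RInt_01. intros t _. now apply continuous_real_laplace. Qed.

Lemma Cmod_rpow_real s t : 0 < t -> Cmod (rpow (RtoC s) t) = Rpower t s.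
Proof. intros H. now rewrite Cmod_rpow. Qed.

(** Half of the exponential absorbs the power, [t^s e^(-k t/2) <= K k^(-s)], and
    the other half integrates to at most [2/k]. *)
Lemma real_laplace_bound s : 0 < s -> exists K, 0 < K /\ forall k, 0 < k ->
  real_laplace s k <= K * Rpower k (- s - 1).
Proof.
  intros Hs. destruct (pow_exp_bound s (1/2) Hs ltac:(lra)) as [K [HK H]].
  exists (2 * K)%R. split; [lra|]. intros k Hk.
  set (A := (K * Rpower k (- s))%R).
  assert (PA : 0 < A) by (apply Rmult_lt_0_compat; [lra|apply exp_pos]).
  assert (I : is_RInt (fun t => A * exp (- (k / 2 * t)))%R 0 1 (minus (- A * (2 / k) * exp (- (k / 2 * 1))) (- A * (2 / k) * exp (- (k / 2 * 0))))%R).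
  { apply (is_RInt_derive (fun t => - A * (2 / k) * exp (- (k / 2 * t)))%R).
    - intros t _. auto_derive; [trivial|]. field. lra.
    - intros t _. apply (ex_derive_continuous (fun t => A * exp (- (k / 2 * t)))%R). auto_derive. trivial. }
  apply Rle_trans with (RInt (fun t => A * exp (- (k / 2 * t)))%R 0 1).
  - apply RInt_le; [lra|now apply ex_real_laplace|eexists; exact I|].
    intros t Ht. rewrite Cmod_rpow_real by lra.
    assert (Kt : 0 < k * t) by (apply Rmult_lt_0_compat; lra).
    specialize (H (k * t)%R Kt).
    rewrite <- Rpower_mult_distr in H by lra.
    unfold A. rewrite Rpower_Ropp.
    assert (Pk : 0 < Rpower k s) by apply exp_pos.
    replace (exp (- (k * t))) with (exp (- (1 / 2 * (k * t))) * exp (- (k / 2 * t)))%R.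
    2:{ rewrite <- exp_plus. f_equal. field. }
    rewrite <- Rmult_assoc. apply Rmult_le_compat_r; [left; apply exp_pos|].
    apply (Rmult_le_reg_l (Rpower k s)); [easy|].
    replace (Rpower k s * (K * / Rpower k s))%R with K by (field; lra). lra.
  - rewrite (is_RInt_unique _ _ _ _ I). unfold minus, plus, opp; simpl.
    rewrite Rmult_0_r, Ropp_0, exp_0.
    replace (- s - 1)%R with (- s + - (1))%R by ring. rewrite Rpower_plus, Rpower_Ropp, Rpower_Ropp, Rpower_1 by lra.
    unfold A. rewrite Rpower_Ropp.
    set (e := exp (- (k / 2 * 1))). assert (0 < e) by apply exp_pos.
    assert (0 < K * / Rpower k s * (2 * / k)).
    { rewrite <- Rpower_Ropp. apply Rmult_lt_0_compat; [exact PA|]. apply Rmult_lt_0_compat; [lra|].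
      now apply Rinv_0_lt_compat. }
    unfold Rdiv. nra.
Qed.

Definition laplace_int (a z : C) : C := CInt (fun t => rpow (a - 1) t * Cexp (- z * RtoC t)).

Lemma C01_exp z : C01 (fun t => Cexp (z * RtoC t)).
Proof. intros t Ht. apply Ccont_Cexp, Ccont_mult; [apply Ccont_const|now apply C01_t]. Qed.

Lemma C01_laplace a z : 1 < Re a -> C01 (fun t => rpow (a - 1) t * Cexp (- z * RtoC t)).
Proof.
  intros Ha. apply (C01_mult (rpow (a - 1)) (fun t => Cexp (- z * RtoC t))).
  - now apply C01_rpow, Re_m1.
  - apply C01_exp.
Qed.

Lemma laplace_int_parts a z : 1 < Re a -> a * laplace_int a z = Cexp (- z) + z * laplace_int (a + 1) z.
Proof.
  intros Ha. assert (Ha1 := Re_p1 a Ha).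
  assert (E : CInt (fun t => a * (rpow (a - 1) t * Cexp (- z * RtoC t)) +
                      (- z) * (rpow (a + 1 - 1) t * Cexp (- z * RtoC t))) = Cexp (- z)).
  { rewrite (CInt_FTC (fun t => rpow a t * Cexp (- z * RtoC t))).
    - cbv beta. rewrite rpow_1, rpow_neg by lra. rewrite Cmult_1_r. ring.
    - intros t _. replace (a + 1 - 1) with a by ring.
      eapply CDer_eq; [|apply CDer_mult; [now apply CDer_rpow|]].
      2:{ apply CDer_Cexp, CDer_scal, (CDer_real (fun s => s)), @is_derive_id. }
      change (RtoC one) with (RtoC 1). cring.
    - apply C01_plus; apply C01_scal; now apply C01_laplace. }
  assert (C1 := C01_laplace a z Ha). assert (C2 := C01_laplace (a + 1) z Ha1).
  rewrite (CInt_plus _ _ (C01_scal a _ C1) (C01_scal (- z) _ C2)) in E.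
  rewrite (CInt_scal a _ C1), (CInt_scal (- z) _ C2) in E.
  fold (laplace_int a z) (laplace_int (a + 1) z) in E. rewrite <- E. ring.
Qed.

Lemma exp_pow_nat t n : exp (- (INR n * t)) = (exp (- t) ^ n)%R.
Proof.
  induction n as [|n IH]; [simpl; rewrite Rmult_0_l, Ropp_0; apply exp_0|].
  rewrite S_INR. simpl. rewrite <- IH, <- exp_plus. f_equal. ring.
Qed.

Lemma bernoulli y n : 0 <= y <= 1 -> 1 - INR n * y <= (1 - y) ^ n.
Proof.
  intros Hy. induction n as [|n IH]; [simpl; lra|].
  rewrite S_INR. simpl. assert (H := pow_01 (1 - y) n ltac:(lra)).
  assert (y * (1 - y) ^ n <= y * 1) by (apply Rmult_le_compat_l; lra). lra.
Qed.

(** [1 - t^2 <= (1 - t) e^t <= 1], raised to the power [n] with Bernoulli's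
    inequality. *)
Lemma one_minus_pow_exp t n : 0 <= t <= 1 ->
  0 <= (1 - t) ^ n <= exp (- (INR n * t)) /\
  exp (- (INR n * t)) - (1 - t) ^ n <= INR n * (t ^ 2 * exp (- (INR n * t))).
Proof.
  intros Ht. rewrite exp_pow_nat.
  assert (L := exp_ineq1_le (- t)). assert (L2 := exp_ineq1_le t).
  assert (E : (exp (- t) * exp t = 1)%R) by (rewrite <- exp_plus, Rplus_opp_l; apply exp_0).
  assert (P := exp_pos (- t)).
  assert (T : 0 <= t ^ 2 <= 1) by now apply pow_01.
  split; [split; [pos|apply pow_incr; lra]|].
  assert (B : exp (- t) * (1 - t ^ 2) <= 1 - t).
  { replace (1 - t ^ 2)%R with ((1 - t) * (1 + t))%R by (simpl; ring).
    assert ((1 - t) * (exp (- t) * (1 + t)) <= (1 - t) * (exp (- t) * exp t)); [|rewrite E in H; lra].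
    apply Rmult_le_compat_l; [lra|]. apply Rmult_le_compat_l; lra. }
  assert (B2 : (exp (- t) * (1 - t ^ 2)) ^ n <= (1 - t) ^ n).
  { apply pow_incr. split; [pos|exact B]. }
  rewrite Rpow_mult_distr in B2.
  assert (exp (- t) ^ n * (1 - INR n * t ^ 2) <= exp (- t) ^ n * (1 - t ^ 2) ^ n).
  { apply Rmult_le_compat_l; [pos|now apply bernoulli]. }
  lra.
Qed.

Lemma rpow_1mt_nat d n t : rpow (d + Cnat n - 1) (1 - t) = RtoC (1 - t) ^ n * rpow (d - 1) (1 - t).
Proof. replace (d + Cnat n - 1) with (d - 1 + Cnat n) by ring. apply rpow_nat. Qed.

Lemma Cexp_real x : Cexp (RtoC x) = RtoC (exp x).
Proof. apply C_eq; rewrite ?Re_Cexp, ?Im_Cexp; simpl; rewrite ?cos_0, ?sin_0; ring. Qed.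

(** At [z = n] the exponential [e^(-n t)] may be replaced with
    [(1 - t)^(d-1+n)], which turns the Laplace integral into a Beta integral;
    the error is [O(1/n)] relative to [n^(-a)]. *)
Lemma laplace_int_lim_const a d : 1 < Re a -> 1 < Re d ->
  Clim (fun n => rpow a (INR n) * laplace_int a (Cnat n)) (beta_int a d * (CGamma (a + d) * / CGamma d)).
Proof.
  intros Ha Hd.
  apply (Clim_ext (fun n => rpow a (INR n) * beta_int a (d + Cnat n) + rpow a (INR n) * (laplace_int a (Cnat n) - beta_int a (d + Cnat n)))).
  { intros n. ring. }
  apply (Clim_eq _ (beta_int a d * (CGamma (a + d) * / CGamma d) + 0)); [ring|].
  apply Clim_plus; [now apply beta_int_lim|].
  destruct (onemt_taylor d 0 Hd) as [K [HK H]].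
  destruct (real_laplace_bound (Re a) ltac:(lra)) as [K1 [HK1 W1]].
  destruct (real_laplace_bound (Re a + 1) ltac:(lra)) as [K2 [HK2 W2]].
  unfold Clim.
  apply (is_lim_seq_le_le_loc (fun _ => 0%R) _ (fun n => (2 * (K * K1 + K2)) * / INR n)%R).
  2: apply is_lim_seq_const.
  2:{ apply lim_scal_0. replace (Finite 0) with (Rbar_inv p_infty) by reflexivity.
      apply is_lim_seq_inv; [apply is_lim_seq_INR|discriminate]. }
  exists 1%nat. intros n Hn. split; [apply Cmod_ge_0|].
  set (x := INR n). assert (Hx : 1 <= x) by (change 1%R with (INR 1); apply le_INR; lia).
  replace (rpow a x * (laplace_int a (Cnat n) - beta_int a (d + Cnat n)) - 0) with
    (rpow a x * (laplace_int a (Cnat n) - beta_int a (d + Cnat n))) by ring.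
  rewrite Cmod_mult, Cmod_rpow by lra.
  unfold laplace_int, beta_int.
  rewrite <- CInt_minus; [|now apply C01_laplace|apply C01_beta_int; auto using Re_pn].
  set (g := fun t => (K * (Cmod (rpow (RtoC (Re a)) t) * exp (- (x * t))) +
                x * (Cmod (rpow (RtoC (Re a + 1)) t) * exp (- (x * t))))%R).
  assert (G1 := ex_real_laplace (Re a) x ltac:(lra)). assert (G2 := ex_real_laplace (Re a + 1) x ltac:(lra)).
  assert (I : is_RInt g 0 1 (K * real_laplace (Re a) x + x * real_laplace (Re a + 1) x)%R).
  { apply (is_RInt_plus (V := R_NormedModule)); apply (is_RInt_scal (V := R_NormedModule)); apply (RInt_correct (V := R_CompleteNormedModule)); assumption. }
  assert (B : Rle (Cmod (CInt (fun t => (rpow (a - 1) t * Cexp (- Cnat n * RtoC t) - rpow (a - 1) t * rpow (d + Cnat n - 1) (1 - t))%C))) (2 * RInt g 0 1)).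
  { apply CInt_bound.
    - apply C01_minus; [now apply C01_laplace|apply C01_beta_int; auto using Re_pn].
    - eexists; exact I.
    - intros t Ht.
      replace (rpow (a - 1) t * Cexp (- Cnat n * RtoC t) - rpow (a - 1) t * rpow (d + Cnat n - 1) (1 - t)) with
        (rpow (a - 1) t * (RtoC ((1 - t) ^ n) * (1 - rpow (d - 1) (1 - t)) + RtoC (exp (- (x * t)) - (1 - t) ^ n))).
      2:{ rewrite rpow_1mt_nat. unfold Cnat. fold x.
          replace (- RtoC x * RtoC t) with (RtoC (- (x * t))) by (rewrite RtoC_opp, RtoC_mult; ring).
          rewrite Cexp_real, RtoC_minus, RtoC_pow. ring. }
      rewrite Cmod_mult, Cmod_rpow by lra.
      rewrite re_minus. simpl (Re 1).
      assert (T : Rpower t (Re a) = (Rpower t (Re a - 1) * t)%R).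
      { rewrite <- (Rpower_1 t) at 3 by lra. rewrite <- Rpower_plus. f_equal. ring. }
      unfold g. rewrite !Cmod_rpow_real, Rpower_plus, Rpower_1, T by lra.
      set (P := Rpower t (Re a - 1)). assert (HP : 0 < P) by apply exp_pos.
      destruct (one_minus_pow_exp t n ltac:(lra)) as [A1 A2]. fold x in A1, A2.
      specialize (H t ltac:(lra)). rewrite sum_O, bc_0 in H.
      replace (rpow (d - 1) (1 - t) - 1 * RtoC t ^ 0) with (rpow (d - 1) (1 - t) - 1) in H by (simpl; ring).
      rewrite Cmod_minus_sym in H. simpl (t ^ 1)%R in H. rewrite Rmult_1_r in H.
      set (e := exp (- (x * t))) in *.
      assert (A3 : Cmod (RtoC ((1 - t) ^ n) * (1 - rpow (d - 1) (1 - t)) + RtoC (e - (1 - t) ^ n)) <= e * (K * t) + x * (t ^ 2 * e)).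
      { eapply Rle_trans; [apply Cmod_triangle|]. rewrite Cmod_mult, !Cmod_R.
        apply Rplus_le_compat.
        - rewrite Rabs_pos_eq by lra. apply Rmult_le_compat; [lra|apply Cmod_ge_0|lra|exact H].
        - rewrite Rabs_pos_eq by lra. lra. }
      eapply Rle_trans; [apply Rmult_le_compat_l; [lra|exact A3]|]. right. simpl. ring. }
  eapply Rle_trans; [apply Rmult_le_compat_l; [left; apply exp_pos|exact B]|].
  rewrite (is_RInt_unique _ _ _ _ I).
  specialize (W1 x ltac:(lra)). specialize (W2 x ltac:(lra)).
  assert (P0 : 0 < Rpower x (Re a)) by apply exp_pos.
  assert (P1 : Rpower x (- Re a - 1) = (/ Rpower x (Re a) * / x)%R).
  { replace (- Re a - 1)%R with (- Re a + - (1))%R by ring. rewrite Rpower_plus, !Rpower_Ropp, Rpower_1 by lra. reflexivity. }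
  assert (P2 : Rpower x (- (Re a + 1) - 1) = (/ Rpower x (Re a) * / x * / x)%R).
  { replace (- (Re a + 1) - 1)%R with (- Re a + - (1) + - (1))%R by ring.
    rewrite !Rpower_plus, !Rpower_Ropp, Rpower_1 by lra. reflexivity. }
  rewrite P1 in W1. rewrite P2 in W2.
  set (Y := Rpower x (Re a)) in *.
  assert (Z1 : K * real_laplace (Re a) x <= K * (K1 * (/ Y * / x))) by (apply Rmult_le_compat_l; lra).
  assert (Z2 : x * real_laplace (Re a + 1) x <= x * (K2 * (/ Y * / x * / x))).
  { apply Rmult_le_compat_l; [lra|exact W2]. }
  apply Rle_trans with (Y * (2 * (K * (K1 * (/ Y * / x)) + x * (K2 * (/ Y * / x * / x)))))%R.
  - apply Rmult_le_compat_l; lra.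
  - right. field. lra.
Qed.

(** ** Laplace integrals in a sector *)

Lemma is_derive_eps (f : R -> R) t l : is_derive f t l <-> forall eta, 0 < eta ->
  exists d, 0 < d /\ forall h, Rabs h < d ->
    Rabs (f (t + h)%R - f t - h * l) <= eta * Rabs h.
Proof.
  split.
  - intros F eta He. apply is_derive_Reals in F. destruct (F eta He) as [d Hd].
    exists d. split; [apply cond_pos|]. intros h Hh.
    destruct (Req_dec h 0) as [->|N].
    + rewrite Rplus_0_r, Rmult_0_l, Rabs_R0. replace (f t - f t - 0)%R with 0%R by ring.
      rewrite Rabs_R0. lra.
    + replace (f (t + h) - f t - h * l)%R with (((f (t + h) - f t) / h - l) * h)%R by (field; easy).
      rewrite Rabs_mult. apply Rmult_le_compat_r; [apply Rabs_pos|]. left. now apply Hd.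
  - intros H. apply is_derive_Reals. intros eps He.
    destruct (H (eps / 2)%R ltac:(lra)) as [d [Hd Q]]. exists (mkposreal d Hd). intros h N Hh.
    specialize (Q h Hh). assert (P := Rabs_pos_lt h N).
    replace ((f (t + h) - f t) / h - l)%R with ((f (t + h) - f t - h * l) / h)%R by (field; easy).
    unfold Rdiv. rewrite Rabs_mult, Rabs_inv. apply (Rmult_lt_reg_r (Rabs h)); [easy|].
    rewrite Rmult_assoc, Rinv_l by lra. nra.
Qed.

Lemma CDer_eps (f : R -> C) t l : CDer f t l <-> forall eta, 0 < eta ->
  exists d, 0 < d /\ forall h, Rabs h < d ->
    Cmod (f (t + h)%R - f t - RtoC h * l) <= eta * Rabs h.
Proof.
  unfold CDer. rewrite !is_derive_eps. split.
  - intros [H1 H2] eta He. destruct (H1 (eta / 2)%R ltac:(lra)) as [d1 [P1 Q1]].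
    destruct (H2 (eta / 2)%R ltac:(lra)) as [d2 [P2 Q2]].
    exists (Rmin d1 d2). split; [now apply Rmin_glb_lt|]. intros h Hh.
    specialize (Q1 h (Rlt_le_trans _ _ _ Hh (Rmin_l _ _))).
    specialize (Q2 h (Rlt_le_trans _ _ _ Hh (Rmin_r _ _))).
    eapply Rle_trans; [apply Cmod_le_Re_Im|].
    rewrite !re_minus, !im_minus, re_scal_l, im_scal_l. lra.
  - intros H. split; intros eta He; destruct (H eta He) as [d [Hd Q]]; exists d;
      (split; [easy|]); intros h Hh; (eapply Rle_trans; [|exact (Q h Hh)]).
    + rewrite <- re_scal_l, <- !re_minus. apply re_le_Cmod.
    + rewrite <- im_scal_l, <- !im_minus. apply im_le_Cmod.
Qed.

(** An error bound of second order in [w] stands for the complex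
    differentiability of [g]. *)
Lemma CDer_chain (g : C -> C) (path : R -> C) s (l g' : C) (K : R) : 0 <= K ->
  (forall w, Cmod w <= 1 -> Cmod (g (path s + w)%C - g (path s) - g' * w) <= K * Cmod w ^ 2) ->
  CDer path s l -> CDer (fun r => g (path r)) s (g' * l).
Proof.
  intros HK H D. apply CDer_eps. intros eta He.
  set (G := Cmod g'). set (Q := (Cmod l + 1)%R).
  assert (HG : 0 <= G) by apply Cmod_ge_0.
  assert (HQ : 1 <= Q) by (unfold Q; generalize (Cmod_ge_0 l); lra).
  set (e1 := Rmin 1 (eta / 2 / (G + 1))).
  assert (He1 : 0 < e1).
  { apply Rmin_glb_lt; [lra|]. apply Rdiv_lt_0_compat; lra. }
  destruct (proj1 (CDer_eps _ _ _) D e1 He1) as [d [Hd B]].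
  set (d' := Rmin d (Rmin (/ Q) (eta / 2 / ((K + 1) * (Q * Q))))).
  assert (HKQ : 0 < (K + 1) * (Q * Q)) by nra.
  exists d'. split.
  { apply Rmin_glb_lt; [easy|]. apply Rmin_glb_lt; [apply Rinv_0_lt_compat; lra|]. apply Rdiv_lt_0_compat; lra. }
  intros h Hh.
  assert (h1 : Rabs h < d) by (eapply Rlt_le_trans; [exact Hh|apply Rmin_l]).
  assert (h2 : Rabs h < / Q).
  { eapply Rlt_le_trans; [exact Hh|]. eapply Rle_trans; [apply Rmin_r|apply Rmin_l]. }
  assert (h3 : Rabs h < eta / 2 / ((K + 1) * (Q * Q))).
  { eapply Rlt_le_trans; [exact Hh|]. eapply Rle_trans; [apply Rmin_r|apply Rmin_r]. }
  specialize (B h h1).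
  assert (Ph := Rabs_pos h).
  set (w := path (s + h)%R - path s) in *.
  assert (e1a : e1 <= 1) by apply Rmin_l.
  assert (e1b : e1 * (G + 1) <= eta / 2).
  { apply Rle_trans with (eta / 2 / (G + 1) * (G + 1))%R.
    - apply Rmult_le_compat_r; [lra|apply Rmin_r].
    - right. field. lra. }
  assert (Wb : Cmod w <= Q * Rabs h).
  { replace w with ((w - RtoC h * l) + RtoC h * l) by ring.
    eapply Rle_trans; [apply Cmod_triangle|]. rewrite Cmod_mult, Cmod_R. unfold Q. nra. }
  assert (W1 : Cmod w <= 1).
  { assert (Q * Rabs h <= Q * / Q) by (apply Rmult_le_compat_l; lra). rewrite Rinv_r in H0 by lra. lra. }
  specialize (H w W1).
  replace (path (s + h)%R) with (path s + w) by (unfold w; ring).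
  replace (g (path s + w) - g (path s) - RtoC h * (g' * l)) with
    ((g (path s + w) - g (path s) - g' * w) + g' * (w - RtoC h * l)) by ring.
  eapply Rle_trans; [apply Cmod_triangle|]. rewrite Cmod_mult. fold G.
  assert (X1 : G * Cmod (w - RtoC h * l) <= eta / 2 * Rabs h).
  { assert (G * Cmod (w - RtoC h * l) <= G * (e1 * Rabs h)) by (now apply Rmult_le_compat_l).
    assert (G * e1 <= eta / 2) by nra. nra. }
  assert (X2 : K * Cmod w ^ 2 <= eta / 2 * Rabs h).
  { assert (Cmod w ^ 2 <= (Q * Rabs h) ^ 2) by (apply pow_incr; split; [apply Cmod_ge_0|easy]).
    assert (K * Cmod w ^ 2 <= (K + 1) * (Q * Rabs h) ^ 2).
    { apply Rmult_le_compat; [lra|apply pow_le, Cmod_ge_0|lra|easy]. }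
    assert (Rabs h * ((K + 1) * (Q * Q)) <= eta / 2).
    { apply Rle_trans with (eta / 2 / ((K + 1) * (Q * Q)) * ((K + 1) * (Q * Q)))%R.
      - apply Rmult_le_compat_r; lra.
      - right. field. lra. }
    replace ((K + 1) * (Q * Rabs h) ^ 2)%R with (Rabs h * ((K + 1) * (Q * Q)) * Rabs h)%R in H1 by (simpl; ring).
    nra. }
  lra.
Qed.

Lemma laplace_int_diff a z : 1 < Re a -> exists K, 0 <= K /\ forall w, Cmod w <= 1 ->
  Cmod (laplace_int a (z + w)%C - laplace_int a z - (- laplace_int (a + 1) z) * w) <= K * Cmod w ^ 2.
Proof.
  intros Ha. assert (Ha1 := Re_p1 a Ha).
  exists (2 * (exp (Cmod z) * (2 * exp 1)))%R. split.
  { generalize (exp_pos (Cmod z)) (exp_pos 1). intros. assert (0 < exp (Cmod z) * exp 1) by now apply Rmult_lt_0_compat. lra. }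
  intros w Hw.
  assert (E : laplace_int a (z + w) - laplace_int a z - - laplace_int (a + 1) z * w =
     CInt (fun t => rpow (a - 1) t * Cexp (- z * RtoC t) * (Cexp (- w * RtoC t) - 1 - (- w * RtoC t)))).
  { unfold laplace_int. replace (CInt (fun t => rpow (a - 1) t * Cexp (- (z + w) * RtoC t)) -
       CInt (fun t => rpow (a - 1) t * Cexp (- z * RtoC t)) -
       - CInt (fun t => rpow (a + 1 - 1) t * Cexp (- z * RtoC t)) * w)
     with ((CInt (fun t => rpow (a - 1) t * Cexp (- (z + w) * RtoC t)) -
       CInt (fun t => rpow (a - 1) t * Cexp (- z * RtoC t))) +
       w * CInt (fun t => rpow (a + 1 - 1) t * Cexp (- z * RtoC t))) by ring.
    assert (C1 := C01_laplace a (z + w) Ha). assert (C2 := C01_laplace a z Ha). assert (C3 := C01_laplace (a + 1) z Ha1).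
    rewrite <- (CInt_minus _ _ C1 C2), <- (CInt_scal w _ C3), <- (CInt_plus _ _ (C01_minus _ _ C1 C2) (C01_scal w _ C3)).
    apply CInt_ext. intros t Ht. replace (a + 1 - 1) with (a - 1 + 1) by ring. rewrite rpow_S.
    replace (- (z + w) * RtoC t) with (- z * RtoC t + - w * RtoC t) by ring. rewrite Cexp_plus. ring. }
  rewrite E.
  replace (2 * (exp (Cmod z) * (2 * exp 1)) * Cmod w ^ 2)%R with (2 * (exp (Cmod z) * (2 * exp 1) * Cmod w ^ 2))%R by ring.
  apply CInt_bound_const.
  - apply C01_mult; [now apply C01_laplace|].
    apply C01_minus; [apply C01_minus; [apply C01_exp|apply C01_const]|apply C01_scal, C01_t].
  - intros t Ht. rewrite !Cmod_mult.
    assert (Q1 : Cmod (rpow (a - 1) t) <= 1) by (apply Cmod_rpow_le_1; [lra|left; now apply Re_m1]).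
    assert (Q2 : Cmod (Cexp (- z * RtoC t)) <= exp (Cmod z)).
    { rewrite Cmod_Cexp. apply exp_le_compat. eapply Rle_trans; [apply Rle_abs|]. eapply Rle_trans; [apply re_le_Cmod|].
      rewrite Cmod_mult, Cmod_opp, Cmod_R, Rabs_pos_eq by lra. generalize (Cmod_ge_0 z). nra. }
    assert (Wt : Cmod (- w * RtoC t) <= Cmod w).
    { rewrite Cmod_mult, Cmod_opp, Cmod_R, Rabs_pos_eq by lra. generalize (Cmod_ge_0 w). nra. }
    assert (Q3 : Cmod (Cexp (- w * RtoC t) - 1 - - w * RtoC t) <= 2 * (Cmod w ^ 2 * exp 1)).
    { eapply Rle_trans; [apply Cexp_minus_1_w|]. apply Rmult_le_compat_l; [lra|].
      apply Rmult_le_compat; [apply pow_le, Cmod_ge_0|left; apply exp_pos| |apply exp_le_compat; lra].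
      apply pow_incr. split; [apply Cmod_ge_0|exact Wt]. }
    assert (X := Cmod_ge_0 (rpow (a - 1) t)). assert (Y := Cmod_ge_0 (Cexp (- z * RtoC t))).
    assert (Z := Cmod_ge_0 (Cexp (- w * RtoC t) - 1 - - w * RtoC t)).
    replace (exp (Cmod z) * (2 * exp 1) * Cmod w ^ 2)%R with (1 * exp (Cmod z) * (2 * (Cmod w ^ 2 * exp 1)))%R by ring.
    apply Rmult_le_compat; [now apply Rmult_le_pos|easy| |easy].
    now apply Rmult_le_compat.
Qed.

Definition laplace_log (a lam : C) : C := Cexp (a * lam) * laplace_int a (Cexp lam).

(** By partial integration the derivative of [z^a G(z)] is the boundary term
    [z^(a-1) e^(-z)], here in the coordinate [lam = log z]. *)
Lemma CDer_laplace_log a (lam : R -> C) s l : 1 < Re a -> CDer lam s l ->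
  CDer (fun r => laplace_log a (lam r)) s (l * Cexp (a * lam s) * Cexp (- Cexp (lam s))).
Proof.
  intros Ha D. destruct (laplace_int_diff a (Cexp (lam s)) Ha) as [K [HK H]].
  unfold laplace_log.
  eapply CDer_eq; [|apply CDer_mult; [apply CDer_Cexp, CDer_scal, D|
    apply (CDer_chain (laplace_int a) (fun r => Cexp (lam r)) s (l * Cexp (lam s)) _ K HK H), CDer_Cexp, D]].
  cbv beta. transitivity (l * Cexp (a * lam s) * (a * laplace_int a (Cexp (lam s)) - Cexp (lam s) * laplace_int (a + 1) (Cexp (lam s)))).
  - ring.
  - rewrite laplace_int_parts by easy. ring.
Qed.

Lemma Cexp_ln r : 0 < r -> Cexp (RtoC (ln r)) = RtoC r.
Proof. intros H. now rewrite Cexp_real, exp_ln. Qed.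

(** The derivative of [r^a G(r)] is exponentially small, so the function is
    exponentially close to its limit; the limit may be taken along the
    integers. *)
Lemma laplace_int_asym_real a L : 1 < Re a -> Clim (fun n => rpow a (INR n) * laplace_int a (Cnat n)) L ->
  exists K, 0 < K /\ forall r, 0 < r -> Cmod (laplace_log a (RtoC (ln r)) - L) <= K * exp (- (1 / 2 * r)).
Proof.
  intros Ha HL. destruct (pow_exp_bound (Re a - 1) (1/2) ltac:(lra) ltac:(lra)) as [K [HK H]].
  exists (4 * K)%R. split; [lra|]. intros r Hr.
  assert (B : forall q, r <= q -> Cmod (laplace_log a (RtoC (ln q)) - laplace_log a (RtoC (ln r))) <= 4 * K * exp (- (1 / 2 * r))).
  { intros q Hq.
    (* Half of the decay [e^(-s)] absorbs the power [s^(a-1)]; the rest has the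
       primitive [-2 e^(-s/2)]. *)
    eapply Rle_trans; [apply (mean_value (fun s => laplace_log a (RtoC (ln s))) (fun s => RtoC (/ s) * Cexp (a * RtoC (ln s)) * Cexp (- Cexp (RtoC (ln s))))
       (fun s => - 2 * K * exp (- (1 / 2 * s)))%R (fun s => K * exp (- (1 / 2 * s)))%R r q Hq)|].
    - intros s Hs. apply (CDer_laplace_log a (fun s => RtoC (ln s)) s (RtoC (/ s)) Ha). apply (CDer_real ln), is_derive_ln. lra.
    - intros s Hs. auto_derive; [trivial|]. field.
    - intros s Hs. rewrite Cexp_ln by lra. rewrite !Cmod_mult, !Cmod_Cexp, Cmod_R, Rabs_pos_eq by (left; apply Rinv_0_lt_compat; lra).
      rewrite re_scal_r. simpl (Re (- RtoC s)).
      specialize (H s ltac:(lra)).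
      replace (/ s * exp (Re a * ln s) * exp (- s))%R with (Rpower s (Re a - 1) * exp (- (1 / 2 * s)) * exp (- (1 / 2 * s)))%R.
      + apply Rmult_le_compat_r; [left; apply exp_pos|exact H].
      + unfold Rpower. rewrite Rmult_assoc, <- exp_plus.
        replace (/ s)%R with (exp (- ln s)) by (rewrite exp_Ropp, exp_ln by lra; reflexivity).
        rewrite <- !exp_plus. f_equal. field.
    - generalize (exp_pos (- (1 / 2 * q))). intros. assert (0 < K * exp (- (1 / 2 * q))) by (now apply Rmult_lt_0_compat). lra. }
  assert (M : is_lim_seq (fun n => Cmod (rpow a (INR n) * laplace_int a (Cnat n) + (- laplace_log a (RtoC (ln r))))) (Cmod (L + - laplace_log a (RtoC (ln r))))).
  { apply Clim_Cmod, Clim_plus; [exact HL|apply Clim_const]. }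
  rewrite Cmod_minus_sym.
  assert (Rbar_le (Cmod (L + - laplace_log a (RtoC (ln r)))) (4 * K * exp (- (1 / 2 * r)))%R); [|assumption].
  apply (is_lim_seq_le_loc (fun n => Cmod (rpow a (INR n) * laplace_int a (Cnat n) + (- laplace_log a (RtoC (ln r))))) (fun _ => (4 * K * exp (- (1 / 2 * r)))%R)).
  - destruct (archimed_nat (r + 1)) as [N HN]. exists N. intros n Hn. specialize (HN n Hn).
    replace (rpow a (INR n) * laplace_int a (Cnat n)) with (laplace_log a (RtoC (ln (INR n)))).
    + apply B. lra.
    + unfold laplace_log. rewrite Cexp_ln, rpow_pos by lra. reflexivity.
  - exact M.
  - apply is_lim_seq_const.
Qed.

Lemma cos_sector delta th : 0 < delta <= PI / 2 -> Rabs th <= PI / 2 - delta ->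
  sin delta <= cos th.
Proof.
  intros Hd Hth. rewrite <- cos_shift.
  replace (cos th) with (cos (Rabs th)).
  - assert (P := PI_RGT_0). apply cos_decr_1; generalize (Rabs_pos th); lra.
  - unfold Rabs. destruct (Rcase_abs th); [apply cos_neg|reflexivity].
Qed.

(** Along the arc of radius [r] from the real axis to the given point the real
    part is at least [r sin delta], so the derivative of [z^a G(z)] is
    exponentially small there too. *)
Lemma laplace_int_asym a L delta : 1 < Re a -> 0 < delta <= PI / 2 ->
  Clim (fun n => rpow a (INR n) * laplace_int a (Cnat n)) L ->
  exists K, 0 < K /\ forall r th, 1 <= r -> Rabs th <= PI / 2 - delta ->
    Cmod (laplace_log a (ln r, th) - L) <= K * exp (- (sin delta / 2 * r)).
Proof.
  intros Ha Hdel HL.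
  destruct (laplace_int_asym_real a L Ha HL) as [K1 [HK1 H1]].
  assert (Pd : 0 < sin delta) by (apply sin_gt_0; [lra|generalize PI_RGT_0; lra]).
  assert (Pd1 := SIN_bound delta).
  destruct (pow_exp_bound (Re a) (sin delta / 2) ltac:(lra) ltac:(lra)) as [K2 [HK2 H2]].
  set (A := exp (Cmod a * PI)). assert (HA : 0 < A) by apply exp_pos.
  assert (PIp := PI_RGT_0).
  exists (K1 + 2 * (PI * A * K2))%R. split.
  { assert (0 < PI * A * K2) by (apply Rmult_lt_0_compat; [apply Rmult_lt_0_compat|]; assumption). lra. }
  intros r th Hr Hth.
  replace (laplace_log a (ln r, th) - L) with ((laplace_log a (ln r, th) - laplace_log a (RtoC (ln r))) + (laplace_log a (RtoC (ln r)) - L)) by ring.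
  eapply Rle_trans; [apply Cmod_triangle|].
  set (e := exp (- (sin delta / 2 * r))).
  assert (X1 : Cmod (laplace_log a (RtoC (ln r)) - L) <= K1 * e).
  { eapply Rle_trans; [apply H1; lra|]. apply Rmult_le_compat_l; [lra|]. apply exp_le_compat. nra. }
  assert (X2 : Cmod (laplace_log a (ln r, th) - laplace_log a (RtoC (ln r))) <= 2 * (PI * A * K2 * e)).
  { set (lam := fun s : R => (ln r, s * th)%R : C).
    replace (laplace_log a (ln r, th)) with (laplace_log a (lam 1%R)) by (unfold lam; rewrite Rmult_1_l; reflexivity).
    replace (laplace_log a (RtoC (ln r))) with (laplace_log a (lam 0%R)) by (unfold lam; rewrite Rmult_0_l; reflexivity).
    apply (mean_value_const (fun s => laplace_log a (lam s)) (fun s => (0%R, th) * Cexp (a * lam s) * Cexp (- Cexp (lam s)))).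
    - intros s _. apply CDer_laplace_log; [easy|]. split; simpl; [apply @is_derive_const|].
      auto_derive; [trivial|ring].
    - intros s Hs. rewrite !Cmod_mult, !Cmod_Cexp.
      assert (T : Rabs (s * th) <= PI / 2 - delta).
      { rewrite Rabs_mult, Rabs_pos_eq by lra. generalize (Rabs_pos th). nra. }
      assert (Y1 : Cmod (0%R, th) <= PI).
      { eapply Rle_trans; [apply Cmod_le_Re_Im|]. simpl. rewrite Rabs_R0. lra. }
      assert (Y2 : exp (Re (a * lam s)) <= A * Rpower r (Re a)).
      { unfold A, Rpower. rewrite <- exp_plus. apply exp_le_compat. rewrite re_mult. unfold lam; simpl.
        assert (- (Im a * (s * th)) <= Cmod a * PI); [|lra].
        eapply Rle_trans; [apply Rle_abs|]. rewrite Rabs_Ropp, Rabs_mult.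
        apply Rmult_le_compat; [apply Rabs_pos|apply Rabs_pos|apply im_le_Cmod|lra]. }
      assert (Y3 : exp (Re (- Cexp (lam s))) <= exp (- (sin delta / 2 * r)) * e).
      { unfold e. rewrite <- exp_plus. apply exp_le_compat. rewrite re_opp, Re_Cexp. unfold lam; simpl.
        rewrite exp_ln by lra.
        assert (C := cos_sector delta (s * th) Hdel T). nra. }
      specialize (H2 r ltac:(lra)).
      apply Rle_trans with (PI * (A * Rpower r (Re a)) * (exp (- (sin delta / 2 * r)) * e))%R.
      + apply Rmult_le_compat; [|left; apply exp_pos| |exact Y3].
        * apply Rmult_le_pos; [apply Cmod_ge_0|left; apply exp_pos].
        * apply Rmult_le_compat; [apply Cmod_ge_0|left; apply exp_pos|exact Y1|exact Y2].
      + replace (PI * (A * Rpower r (Re a)) * (exp (- (sin delta / 2 * r)) * e))%R with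
          (PI * A * (Rpower r (Re a) * exp (- (sin delta / 2 * r))) * e)%R by ring.
        apply Rmult_le_compat_r; [left; apply exp_pos|]. apply Rmult_le_compat_l; [|exact H2].
        apply Rmult_le_pos; lra. }
  lra.
Qed.

(** * Power series and analytic continuation to the cut plane *)

Definition shift (u : nat -> C) (n : nat) : C := match n with O => 0 | S m => u m end.

Lemma ps_ext (u v : nat -> C) w l : (forall n, u n = v n) -> Cis_pseries u w l -> Cis_pseries v w l.
Proof.
  intros E. rewrite !Cis_pseries_Clim. apply Clim_ext. intros n. apply sum_n_ext. intros k. now rewrite E.
Qed.

Lemma ps_plus (u v : nat -> C) w l m :
  Cis_pseries u w l -> Cis_pseries v w m -> Cis_pseries (fun n => u n + v n) w (l + m).
Proof.
  rewrite !Cis_pseries_Clim. intros U V. eapply Clim_ext; [|apply Clim_plus; [exact U|exact V]].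
  intros n. cbv beta. rewrite <- sum_n_Cplus. apply sum_n_ext. intros k. cring.
Qed.

Lemma ps_scal (c : C) (u : nat -> C) w l : Cis_pseries u w l -> Cis_pseries (fun n => c * u n) w (c * l).
Proof.
  rewrite !Cis_pseries_Clim. intros U. eapply Clim_ext; [|apply Clim_scal; exact U].
  intros n. cbv beta. rewrite <- sum_n_Cscal. apply sum_n_ext. intros k. cring.
Qed.

Lemma sum_n_shift (u : nat -> C) w n :
  sum_n (fun k => shift u k * w ^ k) (S n) = w * sum_n (fun k => u k * w ^ k) n.
Proof.
  induction n as [|n IH].
  - rewrite sum_n_C_S, !sum_O. simpl. ring.
  - rewrite sum_n_C_S, IH, sum_n_C_S. simpl. ring.
Qed.

Lemma ps_shift (u : nat -> C) w l : Cis_pseries u w l -> Cis_pseries (shift u) w (w * l).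
Proof.
  rewrite !Cis_pseries_Clim. intros U. apply Clim_decr.
  eapply Clim_ext; [|apply Clim_scal; exact U]. intros n. symmetry. apply sum_n_shift.
Qed.

(** [is_hyp2f1 a b c] is the case [u = gauss_coef a b c]. Allowing arbitrary
    Taylor coefficients lets linear relations between hypergeometric functions
    be checked on coefficients. *)
Definition continues (u : nat -> C) (f : C -> C) : Prop :=
  analytic_on cut_plane f /\ forall x, Cmod x < 1 -> Cis_pseries u x (f x).

Lemma continues_ext u v f : (forall n, u n = v n) -> continues u f -> continues v f.
Proof. intros E [A B]. split; [exact A|]. intros x Hx. now apply (ps_ext u), B. Qed.

Lemma analytic_plus D f g : analytic_on D f -> analytic_on D g -> analytic_on D (fun x => f x + g x).
Proof.
  intros F G z Hz. destruct (F z Hz) as [r1 [u [P1 U]]]. destruct (G z Hz) as [r2 [v [P2 V]]].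
  exists (Rmin r1 r2), (fun n => u n + v n). split; [now apply Rmin_glb_lt|].
  intros y Hy. apply ps_plus.
  - apply U. eapply Rlt_le_trans; [exact Hy|apply Rmin_l].
  - apply V. eapply Rlt_le_trans; [exact Hy|apply Rmin_r].
Qed.

Lemma analytic_scal D c f : analytic_on D f -> analytic_on D (fun x => c * f x).
Proof.
  intros F z Hz. destruct (F z Hz) as [r1 [u [P1 U]]].
  exists r1, (fun n => c * u n). split; [easy|]. intros y Hy. now apply ps_scal, U.
Qed.

Lemma ps_eq (u : nat -> C) w l l' : l = l' -> Cis_pseries u w l -> Cis_pseries u w l'.
Proof. now intros ->. Qed.

Lemma analytic_mulx D f : analytic_on D f -> analytic_on D (fun x => x * f x).
Proof.
  intros F z Hz. destruct (F z Hz) as [r1 [u [P1 U]]].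
  exists r1, (fun n => shift u n + z * u n). split; [easy|]. intros y Hy.
  eapply ps_eq; [|apply ps_plus; [apply ps_shift|apply ps_scal]; apply (U y Hy)]. cring.
Qed.

Lemma continues_plus u v f g : continues u f -> continues v g -> continues (fun n => u n + v n) (fun x => f x + g x).
Proof.
  intros [A1 B1] [A2 B2]. split; [now apply analytic_plus|]. intros x Hx. apply ps_plus; auto.
Qed.

Lemma continues_scal c u f : continues u f -> continues (fun n => c * u n) (fun x => c * f x).
Proof. intros [A B]. split; [now apply analytic_scal|]. intros x Hx. apply ps_scal; auto. Qed.

Lemma continues_mulx u f : continues u f -> continues (shift u) (fun x => x * f x).
Proof. intros [A B]. split; [now apply analytic_mulx|]. intros x Hx. apply ps_shift; auto. Qed.

(** ** The identity theorem *)

Lemma ps_coef_bound (u : nat -> C) (r : R) (l : C) : 0 < r -> Cis_pseries u (RtoC r) l ->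
  exists K, 0 < K /\ forall n, Cmod (u n) * r ^ n <= K.
Proof.
  intros Hr H.
  destruct (filterlim_bounded (K := C_AbsRing) (V := C_NormedModule) (sum_n (fun n => scal (pow_n (K := C_AbsRing) (RtoC r) n) (u n)))) as [M HM].
  { exists l. exact H. }
  set (s := sum_n (fun n => u n * RtoC r ^ n)).
  assert (HM' : forall n, Cmod (s n) <= M).
  { intros n. replace (s n) with (sum_n (fun n => scal (pow_n (K := C_AbsRing) (RtoC r) n) (u n)) n).
    - apply HM.
    - apply sum_n_ext. intros k. rewrite pow_n_Cpow. apply Cmult_comm. }
  assert (M0 : 0 <= M) by (eapply Rle_trans; [apply Cmod_ge_0|apply (HM' 0%nat)]).
  exists (2 * M + 1)%R. split; [lra|]. intros n.
  replace (Cmod (u n) * r ^ n)%R with (Cmod (u n * RtoC r ^ n)).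
  2:{ rewrite Cmod_mult, Cmod_pow, Cmod_R, Rabs_pos_eq by lra. reflexivity. }
  destruct n as [|n].
  - generalize (HM' 0%nat). unfold s. rewrite sum_O. lra.
  - replace (u (S n) * RtoC r ^ S n) with (s (S n) - s n).
    + eapply Rle_trans; [apply Cmod_triangle_minus|]. generalize (HM' n) (HM' (S n)). lra.
    + unfold s. rewrite sum_n_C_S. ring.
Qed.

Lemma sum_n_zero_below (u : nat -> C) n : (forall k, (k < n)%nat -> u k = 0) -> sum_n u n = u n.
Proof.
  intros H. destruct n as [|n]; [apply sum_O|]. rewrite sum_n_C_S.
  replace (sum_n u n) with (RtoC 0); [cring|].
  assert (Z : forall m, (m <= n)%nat -> sum_n u m = RtoC 0).
  { induction m as [|m IH]; intros Hm; [rewrite sum_O; apply H; lia|].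
    rewrite sum_n_C_S, IH, H by lia. cring. }
  symmetry. apply Z. lia.
Qed.

(** If [u n] were the first nonzero coefficient, then [u n w^n = O(|w|^(n+1))] at
    the zeros [w] of the sum, which are arbitrarily small. *)
Lemma ps_coef_zero (u : nat -> C) (r : R) (h : C -> C) : 0 < r ->
  (forall w, Cmod w < r -> Cis_pseries u w (h w)) ->
  (forall eps, 0 < eps -> exists w, 0 < Cmod w < eps /\ h w = 0) ->
  forall n, u n = 0.
Proof.
  intros Hr H Z.
  set (p := (r / 2)%R). assert (Pp : 0 < p) by (unfold p; lra).
  destruct (ps_coef_bound u p (h (RtoC p)) Pp) as [K [HK B]].
  { apply H. rewrite Cmod_R, Rabs_pos_eq by lra. unfold p. lra. }
  intros n. induction n as [n IH] using (well_founded_induction Wf_nat.lt_wf).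
  destruct (Req_dec (Cmod (u n)) 0) as [E|E]; [now apply Cmod_eq_0|exfalso].
  assert (P : 0 < Cmod (u n)) by (generalize (Cmod_ge_0 (u n)); lra).
  assert (Pn : 0 < p ^ S n) by now apply pow_lt.
  destruct (Z (Rmin (p / 2) (Cmod (u n) * p ^ S n / (2 * K)))) as [w [Hw Hz]].
  { apply Rmin_glb_lt; [lra|]. apply Rdiv_lt_0_compat; [now apply Rmult_lt_0_compat|lra]. }
  assert (w1 : Cmod w < p / 2) by (eapply Rlt_le_trans; [apply Hw|apply Rmin_l]).
  assert (w2 : Cmod w < Cmod (u n) * p ^ S n / (2 * K)) by (eapply Rlt_le_trans; [apply Hw|apply Rmin_r]).
  set (q := (Cmod w / p)%R).
  assert (Hq : 0 <= q <= 1 / 2).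
  { unfold q. split; [apply Rmult_le_pos; [apply Cmod_ge_0|left; now apply Rinv_0_lt_compat]|].
    apply (Rmult_le_reg_r p); [easy|]. unfold Rdiv at 1. rewrite Rmult_assoc, Rinv_l by lra. lra. }
  assert (T : forall k, Cmod (u k * w ^ k) <= K * q ^ k).
  { intros k. rewrite Cmod_mult, Cmod_pow. unfold q, Rdiv. rewrite Rpow_mult_distr, pow_inv.
    assert (0 < p ^ k) by now apply pow_lt.
    replace (Cmod (u k) * Cmod w ^ k)%R with (Cmod (u k) * p ^ k * (Cmod w ^ k * / p ^ k))%R by (field; lra).
    apply Rmult_le_compat_r; [|apply B].
    apply Rmult_le_pos; [apply pow_le, Cmod_ge_0|left; now apply Rinv_0_lt_compat]. }
  set (s := fun k => u k * w ^ k) in *.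
  assert (S0 : sum_n s n = s n).
  { apply sum_n_zero_below. intros k Hk. unfold s. rewrite IH by easy. ring. }
  assert (SB : forall j, Cmod (sum_n s (n + j) - s n) <= 2 * K * (q ^ S n - q ^ S (n + j))).
  { induction j as [|j IHj].
    - rewrite Nat.add_0_r, S0. replace (s n - s n) with (RtoC 0) by ring. rewrite Cmod_0. lra.
    - replace (n + S j)%nat with (S (n + j)) by lia. rewrite sum_n_C_S.
      replace (sum_n s (n + j) + s (S (n + j)) - s n) with ((sum_n s (n + j) - s n) + s (S (n + j))) by ring.
      eapply Rle_trans; [apply Cmod_triangle|].
      assert (Ts := T (S (n + j))). fold (s (S (n + j))) in Ts.
      change (q ^ S (S (n + j)))%R with (q * q ^ S (n + j))%R.
      assert (0 <= q ^ S (n + j)) by (apply pow_le; lra).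
      assert (0 <= K * q ^ S (n + j)) by (apply Rmult_le_pos; lra).
      assert (q * (K * q ^ S (n + j)) <= 1 / 2 * (K * q ^ S (n + j))) by (apply Rmult_le_compat_r; lra). lra. }
  assert (L : Clim (sum_n s) 0).
  { rewrite <- Hz. apply Cis_pseries_Clim, H. unfold p in w1. lra. }
  assert (F : Cmod (s n) <= 2 * K * q ^ S n).
  { assert (L1 : is_lim_seq (fun m => Cmod (sum_n s m + - s n)) (Cmod (0 + - s n))).
    { apply Clim_Cmod, Clim_plus; [exact L|apply Clim_const]. }
    replace (Cmod (s n)) with (Cmod (0 + - s n)) by (rewrite Cplus_0_l; apply Cmod_opp).
    assert (Rbar_le (Cmod (0 + - s n)) (2 * K * q ^ S n)%R); [|assumption].
    apply (is_lim_seq_le_loc (fun m => Cmod (sum_n s m + - s n)) (fun _ => (2 * K * q ^ S n)%R)).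
    - exists n. intros m Hm. replace m with (n + (m - n))%nat by lia.
      eapply Rle_trans; [apply SB|].
      assert (0 <= q ^ S (n + (m - n))) by (apply pow_le; lra). nra.
    - exact L1.
    - apply is_lim_seq_const. }
  unfold s in F. rewrite Cmod_mult, Cmod_pow in F. unfold q, Rdiv in F.
  rewrite Rpow_mult_distr, pow_inv in F.
  assert (Pw : 0 < Cmod w ^ n) by (apply pow_lt; lra).
  assert (F2 : Cmod (u n) * p ^ S n <= 2 * K * Cmod w).
  { apply (Rmult_le_reg_r (Cmod w ^ n)); [easy|].
    replace (2 * K * Cmod w * Cmod w ^ n)%R with (2 * K * (Cmod w ^ S n * / p ^ S n) * p ^ S n)%R.
    - replace (Cmod (u n) * p ^ S n * Cmod w ^ n)%R with (Cmod (u n) * Cmod w ^ n * p ^ S n)%R by ring.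
      apply Rmult_le_compat_r; lra.
    - simpl (Cmod w ^ S n)%R. field. lra. }
  apply (Rmult_lt_compat_r (2 * K)) in w2; [|lra].
  unfold Rdiv in w2. rewrite Rmult_assoc, Rinv_l in w2 by lra. lra.
Qed.

(** The cut plane is star-shaped about 0, so it is enough to follow the zeros of
    the difference along the segment from 0 to [x]: where they would stop, they
    accumulate, and the local Taylor coefficients vanish. *)
Lemma continues_unique u f g : continues u f -> continues u g -> forall x, cut_plane x -> f x = g x.
Proof.
  intros [A1 B1] [A2 B2] x Hx.
  apply cut_plane_slit in Hx.
  set (h := fun z => f z + (-(1)) * g z).
  assert (Ah : analytic_on cut_plane h) by (apply analytic_plus; [exact A1|now apply analytic_scal]).
  assert (Dh : forall z, Cmod z < 1 -> h z = 0).
  { intros z Hz. unfold h.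
    assert (f z = g z) as ->; [|ring].
    assert (U := B1 z Hz). assert (V := B2 z Hz). rewrite Cis_pseries_Clim in U, V. exact (Clim_unique _ _ _ U V). }
  assert (Fin : h x = 0 -> f x = g x).
  { unfold h. intros E. apply Ceq_minus. rewrite <- E. ring. }
  apply Fin. clear Fin.
  destruct (Req_dec (Cmod x) 0) as [E0|E0]; [apply Dh; lra|].
  assert (Px : 0 < Cmod x) by (generalize (Cmod_ge_0 x); lra).
  set (E := fun s : R => (0 <= s <= 1) /\ forall s', 0 <= s' <= s -> h (x * RtoC s') = 0).
  destruct (completeness E) as [m [Um Lm]].
  { exists 1%R. intros s [Hs _]. lra. }
  { exists 0%R. split; [lra|]. intros s' Hs'. apply Dh. rewrite Cmod_mult, Cmod_R, Rabs_pos_eq by lra.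
    replace s' with 0%R by lra. lra. }
  assert (m1 : m <= 1) by (apply Lm; intros s [Hs _]; lra).
  assert (below : forall s', 0 <= s' < m -> h (x * RtoC s') = 0).
  { intros s' Hs'. destruct (excluded_middle_informative (exists e, E e /\ s' < e)) as [[e [[_ He] Hlt]]|N].
    - apply He. lra.
    - exfalso. assert (m <= s'); [|lra]. apply Lm. intros e He.
      destruct (Rle_dec e s'); [easy|]. exfalso. apply N. exists e. split; [easy|lra]. }
  assert (m0 : 0 < m).
  { assert (0 < Rmin 1 (/ (2 * Cmod x))).
    { apply Rmin_glb_lt; [lra|]. apply Rinv_0_lt_compat. lra. }
    apply Rlt_le_trans with (1 := H). apply Um. split.
    - split; [lra|apply Rmin_l].
    - intros s' Hs'. apply Dh. rewrite Cmod_mult, Cmod_R, Rabs_pos_eq by lra.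
      assert (s' <= / (2 * Cmod x)) by (eapply Rle_trans; [apply Hs'|apply Rmin_r]).
      apply Rle_lt_trans with (Cmod x * / (2 * Cmod x))%R; [apply Rmult_le_compat_l; lra|].
      replace (Cmod x * / (2 * Cmod x))%R with (1/2)%R by (field; lra). lra. }
  set (z0 := x * RtoC m).
  assert (Cz : cut_plane z0) by (apply cut_plane_slit; apply slit_star; [exact Hx|lra]).
  destruct (Ah z0 Cz) as [r [v [Hr V]]].
  assert (Sub : forall s, Cmod (x * RtoC s - z0) = (Cmod x * Rabs (s - m))%R).
  { intros s. unfold z0. replace (x * RtoC s - x * RtoC m) with (x * RtoC (s - m)) by (rewrite RtoC_minus; ring).
    now rewrite Cmod_mult, Cmod_R. }
  assert (Zv : forall n, v n = 0).
  { apply (ps_coef_zero v r (fun w => h (z0 + w)) Hr).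
    - intros w Hw. replace w with (z0 + w - z0) at 1 by ring. apply V. now replace (z0 + w - z0) with w by ring.
    - intros eps He.
      set (s := Rmax (m / 2) (m - eps / (2 * Cmod x))).
      assert (Pe : 0 < eps / (2 * Cmod x)) by (apply Rdiv_lt_0_compat; lra).
      assert (s1 : s < m) by (apply Rmax_lub_lt; lra).
      assert (s2 := Rmax_l (m / 2) (m - eps / (2 * Cmod x))). assert (s3 := Rmax_r (m / 2) (m - eps / (2 * Cmod x))).
      fold s in s2, s3.
      exists (x * RtoC s - z0). split.
      + rewrite Sub, Rabs_left by lra. split; [apply Rmult_lt_0_compat; lra|].
        apply Rle_lt_trans with (Cmod x * (eps / (2 * Cmod x)))%R; [apply Rmult_le_compat_l; lra|].
        replace (Cmod x * (eps / (2 * Cmod x)))%R with (eps / 2)%R by (field; lra). lra.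
      + replace (z0 + (x * RtoC s - z0)) with (x * RtoC s) by ring. apply below. lra. }
  assert (near : forall z, Cmod (z - z0) < r -> h z = 0).
  { intros z Hz. specialize (V z Hz). apply Cis_pseries_Clim in V.
    apply (Clim_unique _ _ _ V). apply (Clim_ext (fun _ => 0)); [|apply Clim_const].
    intros n. induction n as [|n IH]; [rewrite sum_O, Zv; ring|]. rewrite sum_n_C_S, <- IH, Zv. ring. }
  destruct (Req_dec m 1) as [M1|M1].
  - replace x with (x * RtoC m) by (rewrite M1; ring). apply near. fold z0.
    replace (z0 - z0) with (RtoC 0) by ring. now rewrite Cmod_0.
  - exfalso.
    assert (Pr : 0 < r / (2 * Cmod x)) by (apply Rdiv_lt_0_compat; lra).
    set (s1 := Rmin 1 (m + r / (2 * Cmod x))).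
    assert (s1 <= m); [|assert (m < s1) by (apply Rmin_glb_lt; lra); lra].
    assert (Hs1 := Rmin_l 1 (m + r / (2 * Cmod x))). assert (Hs2 := Rmin_r 1 (m + r / (2 * Cmod x))). fold s1 in Hs1, Hs2.
    apply Um. split; [split; [apply Rmin_glb; lra|exact Hs1]|].
    intros s' Hs'. destruct (Rlt_dec s' m) as [L|L]; [apply below; lra|].
    apply near. rewrite Sub, Rabs_pos_eq by lra.
    apply Rle_lt_trans with (Cmod x * (r / (2 * Cmod x)))%R; [apply Rmult_le_compat_l; lra|].
    replace (Cmod x * (r / (2 * Cmod x)))%R with (r / 2)%R by (field; lra). lra.
Qed.

(** ** Euler integrals *)

Definition weight (a d : C) (n : nat) (t : R) : C :=
  RtoC t ^ n * (rpow (a - 1) t * rpow (d - 1) (1 - t)).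

Definition euler_int (a d b : C) (n : nat) (x : C) : C := CInt (fun t => weight a d n t * kern b x t).

Lemma C01_weight a d n : 1 < Re a -> 1 < Re d -> C01 (weight a d n).
Proof.
  intros Ha Hd. apply C01_mult; [apply C01_pow, C01_t|now apply C01_beta_int].
Qed.

Lemma weight_bound a d n t : 1 < Re a -> 1 < Re d -> 0 < t < 1 -> Cmod (weight a d n t) <= 1.
Proof.
  intros Ha Hd Ht. unfold weight. rewrite !Cmod_mult, Cmod_pow, Cmod_R, Rabs_pos_eq by lra.
  assert (P := pow_01 t n ltac:(lra)).
  assert (Q1 : Cmod (rpow (a - 1) t) <= 1) by (apply Cmod_rpow_le_1; [lra|left; now apply Re_m1]).
  assert (Q2 : Cmod (rpow (d - 1) (1 - t)) <= 1) by (apply Cmod_rpow_le_1; [lra|left; now apply Re_m1]).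
  assert (0 <= Cmod (rpow (a - 1) t)) by apply Cmod_ge_0.
  assert (0 <= Cmod (rpow (d - 1) (1 - t))) by apply Cmod_ge_0.
  assert (0 <= Cmod (rpow (a - 1) t) * Cmod (rpow (d - 1) (1 - t)) <= 1) by nra. nra.
Qed.

Lemma weight_moment a d n : CInt (weight a d n) = beta_int (a + Cnat n) d.
Proof.
  apply CInt_ext. intros t Ht. unfold weight.
  replace (a + Cnat n - 1) with (a - 1 + Cnat n) by ring. rewrite rpow_nat. ring.
Qed.

Definition euler_coef (a d b : C) (n : nat) (x0 : C) (m : nat) : C :=
  bc b m * CInt (fun t => weight a d n t * (RtoC t ^ m * (kern b x0 t * (/ (1 - x0 * RtoC t)) ^ m))).

(** Term-by-term integration of the expansion of the kernel about [x0], whose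
    remainder is uniform in [t]. *)
Lemma euler_expand a d b n x0 x q : 1 < Re a -> 1 < Re d -> 0 <= q < 1 ->
  (forall s, 0 <= s <= 1 -> slit (1 - (x0 + RtoC s * (x - x0)))) ->
  (forall t, 0 <= t <= 1 -> Cmod (x - x0) * t <= q * Cmod (1 - x0 * RtoC t)) ->
  Cis_pseries (euler_coef a d b n x0) (x - x0) (euler_int a d b n x).
Proof.
  intros Ha Hd Hq Sl Hv.
  assert (S0 : slit (1 - x0)).
  { replace (1 - x0) with (1 - (x0 + RtoC 0 * (x - x0))) by ring. apply Sl. lra. }
  assert (S1 : slit (1 - x)).
  { replace (1 - x) with (1 - (x0 + RtoC 1 * (x - x0))) by ring. apply Sl. lra. }
  destruct (kern_expand b x0 x q Hq Sl Hv) as [K [HK H]].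
  apply Cis_pseries_Clim.
  apply (Clim_bound _ _ (fun M => (2 * K) * (Cmod (poch b (S M)) / INR (fact M) * q ^ M))%R).
  2: now apply lim_scal_0, poch_q_lim.
  intros M.
  assert (Cw := C01_weight a d n Ha Hd).
  assert (Ck : forall m, C01 (fun t => RtoC t ^ m * (kern b x0 t * (/ (1 - x0 * RtoC t)) ^ m))).
  { intros m. apply C01_mult; [apply C01_pow, C01_t|].
    apply C01_mult; [now apply C01_kern|]. apply (C01_pow (fun t => / (1 - x0 * RtoC t))). now apply C01_inv. }
  assert (E : sum_n (fun m => euler_coef a d b n x0 m * (x - x0) ^ m) M =
    CInt (fun t => weight a d n t * sum_n (fun m => bc b m * ((x - x0) * RtoC t) ^ m * (kern b x0 t * (/ (1 - x0 * RtoC t)) ^ m)) M)).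
  { transitivity (CInt (fun t => sum_n (fun m => (bc b m * (x - x0) ^ m) * (weight a d n t * (RtoC t ^ m * (kern b x0 t * (/ (1 - x0 * RtoC t)) ^ m)))) M)).
    - rewrite (CInt_sum (fun m t => (bc b m * (x - x0) ^ m) * (weight a d n t * (RtoC t ^ m * (kern b x0 t * (/ (1 - x0 * RtoC t)) ^ m))))).
      + apply sum_n_ext. intros m. rewrite CInt_scal by (now apply C01_mult). unfold euler_coef. cring.
      + intros m. apply C01_scal. now apply C01_mult.
    - apply CInt_ext. intros t Ht. rewrite <- sum_n_Cscal. apply sum_n_ext. intros m.
      rewrite Cpow_mult_l. cring. }
  rewrite E, Cmod_minus_sym. unfold euler_int.
  assert (Cs : C01 (fun t => sum_n (fun m => bc b m * ((x - x0) * RtoC t) ^ m * (kern b x0 t * (/ (1 - x0 * RtoC t)) ^ m)) M)).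
  { apply (C01_sum (fun m t => bc b m * ((x - x0) * RtoC t) ^ m * (kern b x0 t * (/ (1 - x0 * RtoC t)) ^ m))).
    intros m. apply C01_mult.
    - apply C01_scal. apply C01_pow, C01_scal, C01_t.
    - apply C01_mult; [now apply C01_kern|]. apply (C01_pow (fun t => / (1 - x0 * RtoC t))). now apply C01_inv. }
  set (S := fun t => sum_n (fun m => bc b m * ((x - x0) * RtoC t) ^ m * (kern b x0 t * (/ (1 - x0 * RtoC t)) ^ m)) M) in *.
  assert (Ck1 : C01 (fun t => weight a d n t * kern b x t)) by (apply C01_mult; [exact Cw|now apply C01_kern]).
  assert (Cs1 : C01 (fun t => weight a d n t * S t)) by (apply C01_mult; [exact Cw|exact Cs]).
  change (Rle (Cmod (CInt (fun t => weight a d n t * kern b x t) - CInt (fun t => weight a d n t * S t)))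
     (2 * K * (Cmod (poch b (Datatypes.S M)) / INR (fact M) * q ^ M))).
  rewrite <- (CInt_minus _ _ Ck1 Cs1).
  rewrite Rmult_assoc. apply CInt_bound_const; [now apply C01_minus|].
  intros t Ht. specialize (H M t ltac:(lra)).
    fold (S t) in H.
    replace (weight a d n t * kern b x t - weight a d n t * S t) with (weight a d n t * (kern b x t - S t)) by ring.
    rewrite Cmod_mult. eapply Rle_trans; [|exact H].
    rewrite <- (Rmult_1_l (Cmod (kern b x t - S t))) at 2.
    apply Rmult_le_compat_r; [apply Cmod_ge_0|now apply weight_bound].
Qed.

(** A small disk about [x0] satisfies the conditions for the expansion with
    [q = 1/2]; about [x0 = 0] they hold on the whole unit disk with
    [q = |x|]. *)
Lemma euler_continues a d b n : 1 < Re a -> 1 < Re d ->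
  continues (fun m => bc b m * beta_int (a + Cnat (n + m)) d) (euler_int a d b n).
Proof.
  intros Ha Hd. split.
  - intros x0 Hx0. apply cut_plane_slit in Hx0.
    destruct (slit_open x0 Hx0) as [r1 [Hr1 O]]. destruct (slit_lower x0 Hx0) as [r2 [Hr2 L]].
    exists (Rmin r1 (r2 / 2)), (euler_coef a d b n x0). split; [apply Rmin_glb_lt; lra|].
    intros x Hx. apply (euler_expand a d b n x0 x (1 / 2) Ha Hd); [lra| |].
    + intros s Hs. apply O. replace (x0 + RtoC s * (x - x0) - x0) with (RtoC s * (x - x0)) by ring.
      rewrite Cmod_mult, Cmod_R, Rabs_pos_eq by lra.
      assert (Cmod (x - x0) < r1) by (eapply Rlt_le_trans; [exact Hx|apply Rmin_l]).
      generalize (Cmod_ge_0 (x - x0)). nra.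
    + intros t Ht. specialize (L t Ht).
      assert (Cmod (x - x0) < r2 / 2) by (eapply Rlt_le_trans; [exact Hx|apply Rmin_r]).
      generalize (Cmod_ge_0 (x - x0)). nra.
  - intros x Hx. apply (ps_ext (euler_coef a d b n 0)).
    + intros m. unfold euler_coef. f_equal.
      replace (Cnat (n + m)) with (Cnat (n + m)) by reflexivity. rewrite <- weight_moment.
      apply CInt_ext. intros t Ht. unfold weight, kern.
      replace (1 - 0 * RtoC t) with (RtoC 1) by ring. rewrite Clg_1, Cmult_0_r, Cexp_0.
      replace (/ 1) with (RtoC 1) by field. rewrite Cpow_1_l, Cpow_add_r. ring.
    + replace x with (x - 0) at 1 by ring. apply (euler_expand a d b n 0 x (Cmod x) Ha Hd).
      * split; [apply Cmod_ge_0|exact Hx].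
      * intros s Hs. apply slit_iff. right.
        replace (1 - (0 + RtoC s * (x - 0))) with (1 - RtoC s * x) by ring.
        rewrite re_minus, re_scal_l. simpl.
        generalize (re_le_Cmod x). intros B. apply Rabs_le_between in B. nra.
      * intros t Ht. replace (1 - 0 * RtoC t) with (RtoC 1) by ring. replace (x - 0) with x by ring.
        rewrite Cmod_1. generalize (Cmod_ge_0 x). nra.
Qed.

(** * Contiguous relations *)

Definition poch_ratio (a c : C) (n : nat) : C := poch a n / poch c n.

Lemma poch_ratio_0 a c : poch_ratio a c 0 = 1.
Proof. unfold poch_ratio. simpl. field. Qed.

Lemma poch_add a n m : poch a (n + m) = poch a n * poch (a + Cnat n) m.
Proof.
  induction m as [|m IH].
  - rewrite Nat.add_0_r. simpl. ring.
  - rewrite Nat.add_succ_r. simpl. rewrite IH.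
    replace (Cnat (n + m)) with (Cnat n + Cnat m).
    + ring.
    + unfold Cnat. now rewrite plus_INR, RtoC_plus.
Qed.

Lemma bc_S b m : Cnat (S m) * bc b (S m) = b * bc (b + 1) m.
Proof.
  unfold bc. rewrite Cfact_S, <- poch_shift. field. split; [apply Cfact_neq0|apply Cnat_S_neq0].
Qed.

Lemma gauss_coef_rat a b c m : ~ nonpos_int c -> gauss_coef a b c m = poch_ratio a c m * bc b m.
Proof.
  intros Hc. unfold gauss_coef, poch_ratio, bc. field. split; [apply Cfact_neq0|now apply poch_neq0].
Qed.

(** Multiplied by [(b)_m x^m y^n / (m! n!)] with [N = m + n] and summed, such a
    relation between Pochhammer ratios becomes one between Humbert functions:
    the factor [N] splits into [n], which yields a factor [y], and [m], which
    yields [b x] and raises [b] by one. *)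
Definition contiguous (a c a1 c1 k a2 c2 : C) : Prop :=
  forall N, poch_ratio a c N = poch_ratio a1 c1 N + k * (Cnat N * poch_ratio a2 c2 (N - 1)).

Lemma Cnat_0 : Cnat 0 = 0.
Proof. reflexivity. Qed.

Lemma contiguous_aux a c n : ~ nonpos_int c ->
  c <> 0 /\ c + 1 <> 0 /\ poch (c + 1) n <> 0 /\ c + 1 + Cnat n <> 0 /\
  c * (c + 1) * poch (c + 2) n = c * poch (c + 1) n * (c + 1 + Cnat n) /\
  a * poch (a + 1) n = poch a (S n).
Proof.
  intros Hc. assert (Hc1 := not_nonpos_S c Hc).
  repeat split.
  - now apply not_nonpos_0.
  - now apply not_nonpos_0.
  - now apply poch_neq0.
  - now apply not_nonpos_neq.
  - replace (c + 2) with (c + 1 + 1) by ring.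
    transitivity (c * ((c + 1) * poch (c + 1 + 1) n)); [ring|]. rewrite poch_shift. simpl. ring.
  - apply poch_shift.
Qed.

Lemma poch_2_neq0 c n : ~ nonpos_int c -> poch (c + 2) n <> 0.
Proof.
  intros Hc. apply poch_neq0. replace (c + 2) with (c + 1 + 1) by ring. now apply not_nonpos_S, not_nonpos_S.
Qed.

Lemma contiguous_d a c : ~ nonpos_int c -> contiguous a c a (c + 1) (a / (c * (c + 1))) (a + 1) (c + 2).
Proof.
  intros Hc [|n].
  - rewrite !poch_ratio_0, Cnat_0. ring.
  - destruct (contiguous_aux a c n Hc) as [N1 [N2 [N3 [N4 [E1 E2]]]]].
    assert (N5 := poch_2_neq0 c n Hc).
    rewrite Nat.sub_succ, Nat.sub_0_r. unfold poch_ratio.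
    rewrite <- E2, <- (poch_shift c n).
    replace (a / (c * (c + 1)) * (Cnat (S n) * (poch (a + 1) n / poch (c + 2) n))) with
      (a * Cnat (S n) * poch (a + 1) n / (c * (c + 1) * poch (c + 2) n)) by (field; auto).
    rewrite E1. simpl. rewrite Cnat_S. field. auto.
Qed.

Lemma contiguous_a a c : ~ nonpos_int c ->
  contiguous a c (a + 1) (c + 1) (- ((c - a) / (c * (c + 1)))) (a + 1) (c + 2).
Proof.
  intros Hc [|n].
  - rewrite !poch_ratio_0, Cnat_0. ring.
  - destruct (contiguous_aux a c n Hc) as [N1 [N2 [N3 [N4 [E1 E2]]]]].
    assert (N5 := poch_2_neq0 c n Hc).
    rewrite Nat.sub_succ, Nat.sub_0_r. unfold poch_ratio.
    rewrite <- E2, <- (poch_shift c n).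
    replace (- ((c - a) / (c * (c + 1))) * (Cnat (S n) * (poch (a + 1) n / poch (c + 2) n))) with
      (- ((c - a) * Cnat (S n) * poch (a + 1) n / (c * (c + 1) * poch (c + 2) n))) by (field; auto).
    rewrite E1. simpl. rewrite Cnat_S. field. auto.
Qed.

Definition admissible (a c : C) : Prop := ~ nonpos_int c /\ ~ nonpos_int (c - a).

Lemma admissible_d a c : admissible a c -> admissible a (c + 1).
Proof.
  intros [H1 H2]. split; [now apply not_nonpos_S|].
  replace (c + 1 - a) with (c - a + 1) by ring. now apply not_nonpos_S.
Qed.

Lemma admissible_a a c : admissible a c -> admissible (a + 1) (c + 1).
Proof.
  intros [H1 H2]. split; [now apply not_nonpos_S|].
  now replace (c + 1 - (a + 1)) with (c - a) by ring.
Qed.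

Lemma admissible_ad a c : admissible a c -> admissible (a + 1) (c + 2).
Proof.
  intros H. replace (c + 2) with (c + 1 + 1) by ring. now apply admissible_d, admissible_a.
Qed.

Lemma admissible_n a c n : admissible a c -> admissible (a + Cnat n) (c + Cnat n).
Proof.
  intros [H1 H2]. split; [now apply not_nonpos_plus|].
  now replace (c + Cnat n - (a + Cnat n)) with (c - a) by ring.
Qed.

(** Raising [c] alone and then [a] and [c] together reaches the region where
    the Euler integral converges absolutely. *)
Lemma parameter_induction (P : C -> C -> Prop) :
  (forall a c, 1 < Re a -> 1 < Re (c - a) -> P a c) ->
  (forall a c, admissible a c -> P a (c + 1) -> P (a + 1) (c + 2) -> P a c) ->
  (forall a c, admissible a c -> P (a + 1) (c + 1) -> P (a + 1) (c + 2) -> P a c) ->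
  forall a c, admissible a c -> P a c.
Proof.
  intros B D A.
  assert (Q : forall k a c, 1 < Re a -> admissible a c -> 1 < Re (c - a) + INR k -> P a c).
  { induction k as [|k IH]; intros a c Ha O Hk.
    - apply B; [easy|]. change (INR 0) with 0%R in Hk. lra.
    - rewrite S_INR in Hk. apply D; [easy| |].
      + apply IH; [easy|now apply admissible_d|].
        replace (c + 1 - a) with (c - a + 1) by ring. rewrite re_plus. simpl (Re 1). lra.
      + apply IH; [now apply Re_p1|now apply admissible_ad|].
        replace (c + 2 - (a + 1)) with (c - a + 1) by ring. rewrite re_plus. simpl (Re 1). lra. }
  assert (Q2 : forall k a c, admissible a c -> 1 < Re a + INR k -> P a c).
  { induction k as [|k IH]; intros a c O Hk.
    - destruct (archimed_nat (2 - Re (c - a))) as [N HN].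
      change (INR 0) with 0%R in Hk. apply (Q N); [lra|easy|]. specialize (HN N (Nat.le_refl N)). lra.
    - rewrite S_INR in Hk. apply A; [easy| |].
      + apply IH; [now apply admissible_a|]. rewrite re_plus. simpl (Re 1). lra.
      + apply IH; [now apply admissible_ad|]. rewrite re_plus. simpl (Re 1). lra. }
  intros a c O. destruct (archimed_nat (2 - Re a)) as [N HN].
  apply (Q2 N); [easy|]. specialize (HN N (Nat.le_refl N)). lra.
Qed.

(** ** Existence of the continuation of the Gauss series *)

(** This is [Gamma(a)], by the Beta-Gamma relation; the form with [d] is the one
    that Euler's limit formula produces. *)
Definition beta_const (a d : C) : C := beta_int a d * (CGamma (a + d) * / CGamma d).

Lemma beta_const_neq0 a d : 1 < Re a -> 1 < Re d -> beta_const a d <> 0.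
Proof.
  intros Ha Hd. unfold beta_const.
  (* The limit does not depend on [d], and at [d = 2] the Beta integral is
     elementary. *)
  rewrite (Clim_unique _ _ _ (laplace_int_lim_const a d Ha Hd) (laplace_int_lim_const a 2 Ha ltac:(simpl; lra))).
  apply Cmult_neq_0; [now apply beta_int_2_neq0|].
  apply Cmult_neq_0; [|apply Cinv_neq0]; apply CGamma_neq0, not_nonpos_Re; rewrite ?re_plus; simpl; lra.
Qed.

Lemma beta_int_neq0 a d : 1 < Re a -> 1 < Re d -> beta_int a d <> 0.
Proof.
  intros Ha Hd E. apply (beta_const_neq0 a d Ha Hd). unfold beta_const. rewrite E. ring.
Qed.

(** Row [n] of the double series, as coefficients of a power series in [x]. *)
Definition hcoef (a b c : C) (n m : nat) : C := poch_ratio a c (n + m) * bc b m.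

Lemma euler_hcoef a b c n : 1 < Re a -> 1 < Re (c - a) ->
  continues (hcoef a b c n) (fun x => / beta_int a (c - a) * euler_int a (c - a) b n x).
Proof.
  intros Ha Hd. eapply continues_ext; [|apply continues_scal, euler_continues; assumption].
  intros m. unfold hcoef, poch_ratio. cbv beta.
  assert (B := beta_int_neq0 a _ Ha Hd). assert (I := beta_int_n_l a _ (n + m) Ha Hd).
  replace (a + (c - a)) with c in I by ring.
  assert (N : poch c (n + m) <> 0).
  { apply poch_neq0, not_nonpos_Re. replace c with (a + (c - a)) by ring. rewrite re_plus. lra. }
  transitivity (bc b m * (beta_int (a + Cnat (n + m)) (c - a) * poch c (n + m)) / (beta_int a (c - a) * poch c (n + m))).
  - field. auto.
  - rewrite I. field. auto.
Qed.

Lemma hcoef_contiguous a b c a1 c1 k a2 c2 n m : contiguous a c a1 c1 k a2 c2 ->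
  hcoef a b c n m = hcoef a1 b c1 n m +
    k * (Cnat n * hcoef a2 b c2 (n - 1) m + b * shift (hcoef a2 (b + 1) c2 n) m).
Proof.
  intros H. unfold hcoef. rewrite H.
  assert (E : Cnat (n + m) = Cnat n + Cnat m) by (unfold Cnat; now rewrite plus_INR, RtoC_plus).
  destruct m as [|m].
  - rewrite E, Cnat_0. simpl (shift _ 0). destruct n as [|n]; [rewrite Cnat_0; ring|].
    replace (S n + 0 - 1)%nat with (S n - 1 + 0)%nat by lia. ring.
  - simpl (shift _ (S m)). replace (n + S m - 1)%nat with (n + m)%nat by lia.
    transitivity (poch_ratio a1 c1 (n + S m) * bc b (S m) +
      k * (Cnat n * poch_ratio a2 c2 (n + m) * bc b (S m) + poch_ratio a2 c2 (n + m) * (Cnat (S m) * bc b (S m)))).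
    + rewrite E. ring.
    + rewrite bc_S. destruct n as [|n]; [rewrite Cnat_0; ring|].
      replace (S n - 1 + S m)%nat with (S n + m)%nat by lia. ring.
Qed.

Lemma hyp2f1_exists a c : admissible a c -> forall b, exists f, continues (hcoef a b c 0) f.
Proof.
  revert a c. apply (parameter_induction (fun a c => forall b, exists f, continues (hcoef a b c 0) f)).
  - intros a c Ha Hd b. eexists. now apply euler_hcoef.
  - intros a c O H1 H2 b. destruct (H1 b) as [f1 A1]. destruct (H2 (b + 1)) as [f2 A2].
    eexists. eapply continues_ext; [|apply continues_plus; [exact A1|]].
    2:{ apply (continues_scal (a / (c * (c + 1)))), (continues_scal b), continues_mulx, A2. }
    intros m. rewrite (hcoef_contiguous _ _ _ _ _ _ _ _ _ _ (contiguous_d a c (proj1 O))), Cnat_0. cring.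
  - intros a c O H1 H2 b. destruct (H1 b) as [f1 A1]. destruct (H2 (b + 1)) as [f2 A2].
    eexists. eapply continues_ext; [|apply continues_plus; [exact A1|]].
    2:{ apply (continues_scal (- ((c - a) / (c * (c + 1))))), (continues_scal b), continues_mulx, A2. }
    intros m. rewrite (hcoef_contiguous _ _ _ _ _ _ _ _ _ _ (contiguous_a a c (proj1 O))), Cnat_0. cring.
Qed.

Lemma hyp2f1_of_continues a b c f : continues (gauss_coef a b c) f -> continues (gauss_coef a b c) (hyp2f1 a b c).
Proof.
  intros H. apply (epsilon_spec (inhabits (fun _ : C => RtoC 0)) (is_hyp2f1 a b c)). now exists f.
Qed.

Lemma hyp2f1_continues a b c : admissible a c -> continues (gauss_coef a b c) (hyp2f1 a b c).
Proof.
  intros O. destruct (hyp2f1_exists a c O b) as [f H].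
  apply (hyp2f1_of_continues a b c f). eapply continues_ext; [|exact H].
  intros m. symmetry. apply gauss_coef_rat, O.
Qed.

Definition hypn (a b c : C) (n : nat) (x : C) : C :=
  poch a n / poch c n * hyp2f1 (a + Cnat n) b (c + Cnat n) x.

Lemma hypn_continues a b c n : admissible a c -> continues (hcoef a b c n) (hypn a b c n).
Proof.
  intros O. eapply continues_ext; [|apply continues_scal, hyp2f1_continues, admissible_n, O].
  intros m. cbv beta. rewrite gauss_coef_rat by (apply (admissible_n a c n O)). unfold hcoef, poch_ratio.
  rewrite !poch_add. destruct O as [O _].
  field. split; apply poch_neq0; [now apply not_nonpos_plus|easy].
Qed.

Lemma hypn_contiguous a b c a1 c1 k a2 c2 n x :
  contiguous a c a1 c1 k a2 c2 -> admissible a c -> admissible a1 c1 -> admissible a2 c2 -> cut_plane x ->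
  hypn a b c n x = hypn a1 b c1 n x +
    k * (Cnat n * hypn a2 b c2 (n - 1) x + b * (x * hypn a2 (b + 1) c2 n x)).
Proof.
  intros H O O1 O2 Hx.
  assert (A : continues (hcoef a b c n) (fun x => hypn a1 b c1 n x +
    k * (Cnat n * hypn a2 b c2 (n - 1) x + b * (x * hypn a2 (b + 1) c2 n x)))).
  { eapply continues_ext; [|apply (continues_plus (hcoef a1 b c1 n) (fun m => k * (Cnat n * hcoef a2 b c2 (n - 1) m + b * shift (hcoef a2 (b + 1) c2 n) m))); [now apply hypn_continues|]].
    - intros m. cbv beta. symmetry. now apply hcoef_contiguous.
    - apply (continues_scal k (fun m => Cnat n * hcoef a2 b c2 (n - 1) m + b * shift (hcoef a2 (b + 1) c2 n) m)
        (fun x => Cnat n * hypn a2 b c2 (n - 1) x + b * (x * hypn a2 (b + 1) c2 n x))).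
      apply (continues_plus (fun m => Cnat n * hcoef a2 b c2 (n - 1) m) (fun m => b * shift (hcoef a2 (b + 1) c2 n) m)
        (fun x => Cnat n * hypn a2 b c2 (n - 1) x) (fun x => b * (x * hypn a2 (b + 1) c2 n x))).
      + apply (continues_scal (Cnat n) (hcoef a2 b c2 (n - 1))). now apply hypn_continues.
      + apply (continues_scal b (shift (hcoef a2 (b + 1) c2 n))), continues_mulx. now apply hypn_continues. }
  exact (continues_unique _ _ _ (hypn_continues a b c n O) A x Hx).
Qed.

(** ** The Humbert series *)

Definition phi_term (a b c x y : C) (n : nat) : C := hypn a b c n x * (y ^ n / Cfact n).

(** [CSeries] has a value without convergence, so convergence is carried through
    the recursion on the parameters. *)
Definition phi_conv (a b c x y : C) : Prop := Clim (sum_n (phi_term a b c x y)) (Phi1 a b c x y).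

Lemma phi_conv_of a b c x y v : Clim (sum_n (phi_term a b c x y)) v -> Phi1 a b c x y = v /\ phi_conv a b c x y.
Proof.
  intros H. assert (E : Phi1 a b c x y = v) by now apply CSeries_eq.
  split; [exact E|]. unfold phi_conv. now rewrite E.
Qed.

Lemma sum_n_shift0 (u : nat -> C) n : sum_n (shift u) (S n) = sum_n u n.
Proof.
  induction n as [|n IH].
  - rewrite sum_n_C_S, !sum_O. simpl. cring.
  - rewrite sum_n_C_S, IH, sum_n_C_S. reflexivity.
Qed.

Lemma Phi1_contiguous_conv a b c a1 c1 k a2 c2 x y :
  contiguous a c a1 c1 k a2 c2 -> admissible a c -> admissible a1 c1 -> admissible a2 c2 -> cut_plane x ->
  phi_conv a1 b c1 x y -> phi_conv a2 b c2 x y -> phi_conv a2 (b + 1) c2 x y ->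
  Phi1 a b c x y = Phi1 a1 b c1 x y + k * (y * Phi1 a2 b c2 x y + b * x * Phi1 a2 (b + 1) c2 x y)
  /\ phi_conv a b c x y.
Proof.
  intros H O O1 O2 Hx L1 L2 L3. apply phi_conv_of.
  set (t2 := shift (fun n => y * phi_term a2 b c2 x y n)).
  set (t3 := fun n => b * x * phi_term a2 (b + 1) c2 x y n).
  assert (L2' : Clim (sum_n t2) (y * Phi1 a2 b c2 x y)).
  { apply Clim_decr. eapply Clim_ext; [|apply Clim_scal, L2].
    intros n. cbv beta. unfold t2. rewrite sum_n_shift0. symmetry. apply sum_n_Cscal. }
  assert (L3' : Clim (sum_n t3) (b * x * Phi1 a2 (b + 1) c2 x y)).
  { eapply Clim_ext; [|apply Clim_scal, L3]. intros n. symmetry. apply sum_n_Cscal. }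
  apply (Clim_ext (fun n => sum_n (phi_term a1 b c1 x y) n + k * (sum_n t2 n + sum_n t3 n))).
  2:{ apply Clim_plus; [exact L1|apply Clim_scal, Clim_plus; assumption]. }
  intros n. rewrite <- sum_n_Cplus, <- sum_n_Cscal, <- sum_n_Cplus.
  apply sum_n_ext. intros j. unfold phi_term at 2.
  rewrite (hypn_contiguous _ _ _ _ _ _ _ _ _ _ H O O1 O2 Hx).
  unfold t2, t3. destruct j as [|j].
  - simpl. rewrite Cnat_0. unfold phi_term. simpl. cring.
  - simpl (shift _ (S j)). rewrite Nat.sub_succ, Nat.sub_0_r. unfold phi_term.
    rewrite !Cfact_S. simpl (y ^ S j). cbv beta.
    match goal with |- ?l = ?r => change (@eq C l r) end.
    field. split; [apply Cfact_neq0|apply Cnat_S_neq0].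
Qed.

Definition phi_int (a d b x y : C) : C :=
  CInt (fun t => weight a d 0 t * kern b x t * Cexp (y * RtoC t)).

Lemma admissible_base a c : 1 < Re a -> 1 < Re (c - a) -> admissible a c.
Proof.
  intros Ha Hd. split; apply not_nonpos_Re; [|lra].
  replace c with (a + (c - a)) by ring. rewrite re_plus. lra.
Qed.

(** Euler's integral for each Gauss function, summed under the integral sign: the
    exponential series converges uniformly on the interval. *)
Lemma Phi1_base a b c x y : 1 < Re a -> 1 < Re (c - a) -> cut_plane x ->
  Phi1 a b c x y = / beta_int a (c - a) * phi_int a (c - a) b x y /\ phi_conv a b c x y.
Proof.
  intros Ha Hd Hx. apply phi_conv_of.
  assert (O := admissible_base a c Ha Hd).
  assert (Sx := proj1 (cut_plane_slit x) Hx).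
  destruct (kern_bound b x Sx) as [K [HK KB]].
  assert (Ck := C01_kern b x Sx).
  set (Y := Cmod y). assert (HY : 0 <= Y) by apply Cmod_ge_0.
  assert (Cw := C01_weight a _ 0 Ha Hd).
  set (wk := fun t => weight a (c - a) 0 t * kern b x t).
  assert (Cwk : C01 wk) by now apply C01_mult.
  set (e := fun n t => (y * RtoC t) ^ n / Cfact n).
  assert (Ce : forall n, C01 (e n)).
  { intros n. apply C01_mult; [apply C01_pow, C01_scal, C01_t|apply C01_const]. }
  assert (Cwe : forall n, C01 (fun t => wk t * e n t)) by (intros n; now apply C01_mult).
  assert (E : forall n, phi_term a b c x y n = / beta_int a (c - a) * CInt (fun t => wk t * e n t)).
  { intros n. unfold phi_term.
    rewrite (continues_unique _ _ _ (hypn_continues a b c n O) (euler_hcoef a b c n Ha Hd) x Hx).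
    unfold euler_int. rewrite <- Cmult_assoc. f_equal.
    rewrite (Cmult_comm (CInt _)), <- CInt_scal by (apply C01_mult; [now apply C01_weight|exact Ck]).
    apply CInt_ext. intros t Ht. unfold wk, e, weight. rewrite Cpow_mult_l. simpl. unfold Cdiv. ring. }
  apply (Clim_ext (fun M => / beta_int a (c - a) * sum_n (fun n => CInt (fun t => wk t * e n t)) M)).
  { intros M. rewrite <- sum_n_Cscal. apply sum_n_ext. intros j. now rewrite E. }
  apply Clim_scal.
  apply (Clim_bound _ _ (fun M => (2 * (K * (2 * exp Y))) * (Y ^ S M / INR (fact M)))%R).
  2: now apply lim_scal_0, exp_q_lim.
  intros M.
  rewrite <- (CInt_sum (fun n t => wk t * e n t)) by exact Cwe.
  rewrite Cmod_minus_sym. unfold phi_int.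
  change (fun t => weight a (c - a) 0 t * kern b x t * Cexp (y * RtoC t)) with (fun t => wk t * Cexp (y * RtoC t)).
  assert (C1 : C01 (fun t => wk t * Cexp (y * RtoC t))) by (apply C01_mult; [exact Cwk|apply C01_exp]).
  assert (C2 : C01 (fun t => sum_n (fun n => wk t * e n t) M)) by now apply (C01_sum (fun n t => wk t * e n t)).
  rewrite <- (CInt_minus _ _ C1 C2).
  rewrite Rmult_assoc. apply CInt_bound_const; [now apply C01_minus|].
  intros t Ht. rewrite sum_n_Cscal.
  assert (T := Cexp_taylor (y * RtoC t) M).
  change (sum_n (fun m => (y * RtoC t) ^ m / Cfact m) M) with (sum_n (fun n => e n t) M) in T.
  set (S := sum_n (fun n => e n t) M) in *.
  replace (wk t * Cexp (y * RtoC t) - wk t * S) with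
    (weight a (c - a) 0 t * (kern b x t * (Cexp (y * RtoC t) - S))) by (unfold wk; ring).
  rewrite !Cmod_mult.
  assert (W := weight_bound a (c - a) 0 t Ha Hd Ht).
  assert (Ey : Cmod (y * RtoC t) <= Y).
  { rewrite Cmod_mult, Cmod_R, Rabs_pos_eq by lra. fold Y. nra. }
  assert (T2 : Cmod (Cexp (y * RtoC t) - S) <= 2 * (Y ^ Datatypes.S M / INR (fact M) * exp Y)).
  { eapply Rle_trans; [exact T|]. apply Rmult_le_compat_l; [lra|].
    assert (0 < / INR (fact M)) by (apply Rinv_0_lt_compat, INR_fact_lt_0).
    apply Rmult_le_compat.
    - pos.
    - left; apply exp_pos.
    - apply Rmult_le_compat_r; [lra|]. apply pow_incr. split; [apply Cmod_ge_0|easy].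
    - now apply exp_le_compat. }
  specialize (KB t ltac:(lra)).
  apply Rle_trans with (1 * (K * (2 * (Y ^ Datatypes.S M / INR (fact M) * exp Y))))%R.
  - apply Rmult_le_compat; [apply Cmod_ge_0| |exact W|].
    + pos.
    + apply Rmult_le_compat; try apply Cmod_ge_0; assumption.
  - right. ring.
Qed.

Lemma phi_converges a c : admissible a c -> forall b x y, cut_plane x -> phi_conv a b c x y.
Proof.
  intros O.
  assert (G : admissible a c /\ forall b x y, cut_plane x -> phi_conv a b c x y); [|apply G].
  revert a c O. apply (parameter_induction (fun a c => admissible a c /\ forall b x y, cut_plane x -> phi_conv a b c x y)).
  - intros a c Ha Hd. split; [now apply admissible_base|].
    intros b x y Hx. now apply Phi1_base.
  - intros a c O [O1 H1] [O2 H2]. split; [easy|]. intros b x y Hx.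
    apply (Phi1_contiguous_conv a b c _ _ _ _ _ x y (contiguous_d a c (proj1 O))); auto.
  - intros a c O [O1 H1] [O2 H2]. split; [easy|]. intros b x y Hx.
    apply (Phi1_contiguous_conv a b c _ _ _ _ _ x y (contiguous_a a c (proj1 O))); auto.
Qed.

Lemma Phi1_contiguous a b c a1 c1 k a2 c2 x y :
  contiguous a c a1 c1 k a2 c2 -> admissible a c -> admissible a1 c1 -> admissible a2 c2 -> cut_plane x ->
  Phi1 a b c x y = Phi1 a1 b c1 x y + k * (y * Phi1 a2 b c2 x y + b * x * Phi1 a2 (b + 1) c2 x y).
Proof.
  intros H O O1 O2 Hx. apply (Phi1_contiguous_conv a b c a1 c1 k a2 c2); auto using phi_converges.
Qed.

(** * Cauchy products and the coefficients of the expansion *)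

Definition cauchy_prod (p q : nat -> C) (n : nat) : C := sum_n (fun k => p (n - k)%nat * q k) n.

Lemma sum_n_C_ext_le (u v : nat -> C) n : (forall k, (k <= n)%nat -> u k = v k) -> sum_n u n = sum_n v n.
Proof. apply sum_n_ext_loc. Qed.

Lemma sum_n_C_head (u : nat -> C) n : sum_n u (S n) = u 0%nat + sum_n (fun k => u (S k)) n.
Proof.
  induction n as [|n IH].
  - rewrite sum_n_C_S, !sum_O. reflexivity.
  - rewrite sum_n_C_S, IH, sum_n_C_S. cring.
Qed.

Lemma cauchy_prod_shift p q n : cauchy_prod (shift p) q n = shift (cauchy_prod p q) n.
Proof.
  destruct n as [|n].
  - unfold cauchy_prod. rewrite sum_O. simpl. cring.
  - change (shift (cauchy_prod p q) (S n)) with (cauchy_prod p q n). unfold cauchy_prod. rewrite sum_n_C_S, Nat.sub_diag.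
    rewrite (sum_n_C_ext_le _ (fun k => p (n - k)%nat * q k)).
    + simpl. cring.
    + intros k Hk. now rewrite Nat.sub_succ_l by easy.
Qed.

Lemma cauchy_prod_ext p p' q q' n : (forall k, p k = p' k) -> (forall k, q k = q' k) -> cauchy_prod p q n = cauchy_prod p' q' n.
Proof. intros P Q. apply sum_n_ext. intros k. now rewrite P, Q. Qed.

Lemma cauchy_prod_plus p p' q n : cauchy_prod (fun k => p k + p' k) q n = cauchy_prod p q n + cauchy_prod p' q n.
Proof. unfold cauchy_prod. rewrite <- sum_n_Cplus. apply sum_n_ext. intros k. cring. Qed.

Lemma cauchy_prod_scal_l c p q n : cauchy_prod (fun k => c * p k) q n = c * cauchy_prod p q n.
Proof. unfold cauchy_prod. rewrite <- sum_n_Cscal. apply sum_n_ext. intros k. cring. Qed.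

Lemma cauchy_prod_scal_r c p q n : cauchy_prod p (fun k => c * q k) n = c * cauchy_prod p q n.
Proof. unfold cauchy_prod. rewrite <- sum_n_Cscal. apply sum_n_ext. intros k. cring. Qed.

Definition deriv (p : nat -> C) (k : nat) : C := Cnat (S k) * p (S k).

Lemma cauchy_prod_deriv p q n : deriv (cauchy_prod p q) n = cauchy_prod (deriv p) q n + cauchy_prod p (deriv q) n.
Proof.
  unfold deriv at 1. unfold cauchy_prod at 1. rewrite <- sum_n_Cscal.
  rewrite (sum_n_C_ext_le _ (fun k => Cnat (S n - k) * p (S n - k)%nat * q k + p (S n - k)%nat * (Cnat k * q k))).
  - rewrite sum_n_Cplus. f_equal.
    + rewrite sum_n_C_S, Nat.sub_diag, Cnat_0.
      rewrite (sum_n_C_ext_le _ (fun k => deriv p (n - k)%nat * q k)).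
      * unfold cauchy_prod. cring.
      * intros k Hk. unfold deriv. now rewrite Nat.sub_succ_l.
    + rewrite sum_n_C_head, Cnat_0. rewrite Cmult_0_l, Cmult_0_r, Cplus_0_l. reflexivity.
  - intros k Hk. replace (Cnat (S n)) with (Cnat (S n - k) + Cnat k).
    + ring.
    + unfold Cnat. rewrite <- RtoC_plus, <- plus_INR. f_equal. f_equal. lia.
Qed.

(** The Taylor coefficients of [(1 - t)^(d-1) (1 - x t)^(-b)]. *)
Definition hsum (d b x : C) : nat -> C := cauchy_prod (bc (1 - d)) (fun k => bc b k * x ^ k).

Lemma bc_pascal e k : bc e k + - (1) * shift (bc e) k = bc (e - 1) k.
Proof.
  destruct k as [|k].
  - rewrite !bc_0. simpl. ring.
  - simpl. unfold bc. rewrite <- (poch_shift (e - 1)).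
    replace (e - 1 + 1) with e by ring. simpl poch. rewrite Cfact_S, Cnat_S.
    assert (N := Cnat_S_neq0 k). rewrite Cnat_S in N. field. split; [apply Cfact_neq0|exact N].
Qed.

(** Multiplication of the generating function by [1 - t]. *)
Lemma hsum_raise d b x n : hsum (d + 1) b x n = hsum d b x n + - (1) * shift (hsum d b x) n.
Proof.
  unfold hsum. rewrite <- cauchy_prod_shift, <- cauchy_prod_scal_l, <- cauchy_prod_plus.
  apply cauchy_prod_ext; [|reflexivity]. intros k. rewrite bc_pascal. f_equal. ring.
Qed.

Lemma hsum_0 d b x : hsum d b x 0 = 1.
Proof. unfold hsum, cauchy_prod. rewrite sum_O, !bc_0. simpl. cring. Qed.

(** Coefficient form of [(1-t) h' + (d-1) h = (1-t)^d f'] for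
    [h = (1-t)^(d-1) f], [f = (1 - x t)^(-b)]. *)
Lemma hsum_deriv d b x n :
  b * x * hsum (d + 1) (b + 1) x n =
  Cnat (S n) * hsum d b x (S n) - Cnat n * hsum d b x n + (d - 1) * hsum d b x n.
Proof.
  set (p := bc (1 - d)). set (q := fun k => bc b k * x ^ k).
  assert (Q : forall k, deriv q k = b * x * (bc (b + 1) k * x ^ k)).
  { intros k. unfold deriv, q. transitivity ((Cnat (S k) * bc b (S k)) * x ^ S k); [ring|].
    rewrite bc_S. simpl. ring. }
  assert (P : forall k, deriv p k = (1 - d) * bc (2 - d) k).
  { intros k. unfold deriv, p. rewrite bc_S. f_equal. f_equal. ring. }
  assert (E1 : b * x * hsum (d + 1) (b + 1) x n = cauchy_prod p (deriv q) n + - (1) * shift (cauchy_prod p (deriv q)) n).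
  { unfold hsum. rewrite <- cauchy_prod_scal_r, <- cauchy_prod_shift, <- cauchy_prod_scal_l, <- cauchy_prod_plus.
    apply cauchy_prod_ext; intros k; [|now rewrite Q].
    unfold p. rewrite bc_pascal. f_equal. ring. }
  assert (E2 : cauchy_prod (deriv p) q n + - (1) * shift (cauchy_prod (deriv p) q) n + (d - 1) * cauchy_prod p q n = 0).
  { rewrite <- cauchy_prod_shift, <- !cauchy_prod_scal_l, <- !cauchy_prod_plus.
    transitivity (cauchy_prod (fun k => 0 * p k) q n); [|rewrite cauchy_prod_scal_l; ring].
    apply cauchy_prod_ext; [|reflexivity]. intros k.
    assert (S : shift (deriv p) k = (1 - d) * shift (bc (2 - d)) k).
    { destruct k as [|k]; simpl; [ring|apply P]. }
    rewrite S, P. transitivity ((1 - d) * (bc (2 - d) k + - (1) * shift (bc (2 - d)) k) + (d - 1) * p k); [ring|].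
    rewrite bc_pascal. unfold p. replace (2 - d - 1) with (1 - d) by ring. ring. }
  assert (E3 : Cnat (S n) * hsum d b x (S n) = cauchy_prod (deriv p) q n + cauchy_prod p (deriv q) n) by apply cauchy_prod_deriv.
  assert (E4 : Cnat n * hsum d b x n = shift (cauchy_prod (deriv p) q) n + shift (cauchy_prod p (deriv q)) n).
  { destruct n as [|n]; [rewrite Cnat_0; simpl; ring|apply cauchy_prod_deriv]. }
  rewrite E1, E3, E4. change (hsum d b x n) with (cauchy_prod p q n).
  rewrite <- (Cplus_0_r (cauchy_prod p (deriv q) n + _)), <- E2. ring.
Qed.

(** The coefficient of [z^(-a-n)] in the form that Watson's lemma gives it. *)
Definition ucoef (a b c x : C) (n : nat) : C :=
  CGamma c / CGamma (c - a) * (poch a n * hsum (c - a) b x n).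

Lemma CGamma_2 c : ~ nonpos_int c -> CGamma (c + 2) = (c + 1) * (c * CGamma c).
Proof.
  intros Hc. replace (c + 2) with (c + 1 + 1) by ring.
  rewrite CGamma_S by now apply not_nonpos_S. now rewrite CGamma_S.
Qed.

(** The coefficients obey the relations that [contiguous_d] and [contiguous_a]
    impose on the functions, a factor [z] being a shift of the index. After the
    Gamma quotients are reduced, both identities are combinations of
    [hsum_raise] and [hsum_deriv] with [c = a + d]. *)
Lemma ucoef_d a b c x n : admissible a c ->
  ucoef a b c x n = ucoef a b (c + 1) x n +
    (- (a / (c * (c + 1))) * ucoef (a + 1) b (c + 2) x n +
     a / (c * (c + 1)) * (b * x) * shift (ucoef (a + 1) (b + 1) (c + 2) x) n).
Proof.
  intros [Hc Hd].
  assert (N1 := not_nonpos_0 c Hc). assert (N2 := not_nonpos_0 _ (not_nonpos_S c Hc)).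
  assert (N3 := not_nonpos_0 _ Hd). assert (N4 := CGamma_neq0 _ Hd).
  set (d := c - a) in *. unfold ucoef.
  replace (c + 1 - a) with (d + 1) by (unfold d; ring).
  replace (c + 2 - (a + 1)) with (d + 1) by (unfold d; ring). fold d.
  rewrite !CGamma_S, CGamma_2 by easy.
  assert (Ec : c = a + d) by (unfold d; ring).
  destruct n as [|n].
  - simpl. rewrite !hsum_0.
    transitivity (CGamma c / CGamma d * ((c - a) / d)).
    + replace (c - a) with d by reflexivity. field. auto.
    + field. auto.
  - simpl (shift _ (S n)).
    replace (CGamma c / CGamma d * (poch a (S n) * hsum d b x (S n))) with
      (CGamma c / (d * CGamma d) * poch a (S n) * (d * hsum d b x (S n))) by (field; auto).
    rewrite <- (poch_shift a n). simpl (poch (a + 1) (S n)).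
    transitivity (c * CGamma c / (d * CGamma d) * (a * poch (a + 1) n * hsum (d + 1) b x (S n)) +
      (- (CGamma c / (d * CGamma d)) * a * (poch (a + 1) n * (a + 1 + Cnat n) * hsum (d + 1) b x (S n)) +
       CGamma c / (d * CGamma d) * a * (poch (a + 1) n * (b * x * hsum (d + 1) (b + 1) x n)))).
    2:{ field. auto. }
    rewrite hsum_deriv, hsum_raise. simpl (shift _ (S n)). rewrite Cnat_S.
    set (h := hsum d b x n). set (h' := hsum d b x (S n)).
    set (G := CGamma c / (d * CGamma d)).
    replace (c * CGamma c / (d * CGamma d)) with (c * G) by (unfold G; field; auto).
    rewrite Ec. ring.
Qed.

Lemma ucoef_a a b c x n : admissible a c ->
  ucoef a b c x n = shift (ucoef (a + 1) b (c + 1) x) n +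
    ((c - a) / (c * (c + 1)) * ucoef (a + 1) b (c + 2) x n +
     - ((c - a) / (c * (c + 1))) * (b * x) * shift (ucoef (a + 1) (b + 1) (c + 2) x) n).
Proof.
  intros [Hc Hd].
  assert (N1 := not_nonpos_0 c Hc). assert (N2 := not_nonpos_0 _ (not_nonpos_S c Hc)).
  assert (N3 := not_nonpos_0 _ Hd). assert (N4 := CGamma_neq0 _ Hd).
  set (d := c - a) in *.
  assert (Ec : c = a + d) by (unfold d; ring).
  destruct n as [|n]; unfold ucoef; simpl (shift _ _);
  replace (c + 1 - (a + 1)) with d by (unfold d; ring);
  replace (c + 2 - (a + 1)) with (d + 1) by (unfold d; ring); fold d.
  - rewrite !CGamma_S, CGamma_2 by easy. simpl. rewrite !hsum_0. field. auto.
  - rewrite !CGamma_S, CGamma_2 by easy.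
    rewrite <- (poch_shift a n). simpl (poch (a + 1) (S n)).
    transitivity (c * CGamma c / CGamma d * (poch (a + 1) n * hsum d b x n) +
      (CGamma c / CGamma d * (poch (a + 1) n * (a + 1 + Cnat n) * hsum (d + 1) b x (S n)) +
       - (CGamma c / CGamma d) * (poch (a + 1) n * (b * x * hsum (d + 1) (b + 1) x n)))).
    2:{ field. auto. }
    rewrite hsum_deriv, hsum_raise. simpl (shift _ (S n)). rewrite Cnat_S.
    set (h := hsum d b x n). set (h' := hsum d b x (S n)).
    set (G := CGamma c / CGamma d).
    replace (c * CGamma c / CGamma d) with (c * G) by (unfold G; field; auto).
    rewrite Ec. ring.
Qed.

(** * Asymptotic expansions *)

Lemma Carg_spec (z : C) : z <> 0 -> cos (Carg z) = (Re z / Cmod z)%R /\ sin (Carg z) = (Im z / Cmod z)%R.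
Proof.
  intros Hz. assert (P := proj1 (Cmod_gt_0 z) Hz).
  assert (N := Cmod_sqr_sum z).
  assert (B := Re_div_Cmod_bound z Hz).
  assert (S : sin (acos (Re z / Cmod z)) = (Rabs (Im z) / Cmod z)%R).
  { rewrite sin_acos by easy.
    replace (1 - (Re z / Cmod z)²)%R with ((Rabs (Im z) / Cmod z)²).
    - apply sqrt_Rsqr. apply Rmult_le_pos; [apply Rabs_pos|left; now apply Rinv_0_lt_compat].
    - unfold Rdiv. rewrite !Rsqr_mult, <- Rsqr_abs. unfold Rsqr.
      replace (Im z * Im z)%R with (Cmod z * Cmod z - Re z * Re z)%R by lra. field. lra. }
  unfold Carg. destruct (Rle_dec 0 (Im z)) as [I|I].
  - rewrite cos_acos by easy. rewrite S, Rabs_pos_eq by easy. easy.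
  - rewrite cos_neg, sin_neg, cos_acos by easy. rewrite S, Rabs_left by lra. split; [easy|]. field. lra.
Qed.

Lemma Cexp_Clog (z : C) : z <> 0 -> Cexp (Clog z) = z.
Proof.
  intros Hz. assert (P := proj1 (Cmod_gt_0 z) Hz). destruct (Carg_spec z Hz) as [E1 E2].
  apply C_eq.
  - rewrite Re_Cexp. unfold Clog; simpl. rewrite exp_ln, E1 by easy. field. lra.
  - rewrite Im_Cexp. unfold Clog; simpl. rewrite exp_ln, E2 by easy. field. lra.
Qed.

Lemma Carg_bound z : Rabs (Carg z) <= PI.
Proof.
  unfold Carg. generalize (acos_bound (Re z / Cmod z)). intros B.
  destruct (Rle_dec 0 (Im z)); apply Rabs_le; lra.
Qed.

Lemma Cpower_plus z w w' : Cpower z (w + w') = Cpower z w * Cpower z w'.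
Proof. unfold Cpower. rewrite <- Cexp_plus. f_equal. ring. Qed.

Lemma Cpower_1 (z : C) : z <> 0 -> Cpower z 1 = z.
Proof. intros H. unfold Cpower. rewrite Cmult_1_l. now apply Cexp_Clog. Qed.

Lemma Cmod_Cpower z w : Cmod (Cpower z w) <= exp (Rabs (Im w) * PI) * Rpower (Cmod z) (Re w) /\
  exp (- (Rabs (Im w) * PI)) * Rpower (Cmod z) (Re w) <= Cmod (Cpower z w).
Proof.
  unfold Cpower. rewrite Cmod_Cexp, re_mult. unfold Clog; simpl. unfold Rpower.
  rewrite <- !exp_plus.
  assert (B : Rabs (Im w * Carg z) <= Rabs (Im w) * PI).
  { rewrite Rabs_mult. apply Rmult_le_compat_l; [apply Rabs_pos|apply Carg_bound]. }
  apply Rabs_le_between in B. split; apply exp_le_compat; lra.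
Qed.

Definition zpow (a : C) (n : nat) (z : C) : C := Cpower z (- a - Cnat n).

Lemma zpow_shift a n z : zpow (a + 1) n z = zpow a (S n) z.
Proof. unfold zpow. f_equal. rewrite Cnat_S. ring. Qed.

Lemma zpow_mulz a n (z : C) : z <> 0 -> z * zpow (a + 1) n z = zpow a n z.
Proof.
  intros Hz. unfold zpow. rewrite <- (Cpower_1 z Hz) at 1. rewrite <- Cpower_plus. f_equal. ring.
Qed.

(** The threshold is at least 1 so that powers of [|z|] increase with the
    exponent. *)
Definition bigO (D : C -> Prop) (f : C -> C) (s : R) : Prop :=
  exists K M : R, 0 < K /\ 1 <= M /\
    forall z, D z -> M <= Cmod z -> Cmod (f z) <= K * Rpower (Cmod z) s.

Lemma bigO_plus D f g s : bigO D f s -> bigO D g s -> bigO D (fun z => f z + g z) s.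
Proof.
  intros [K1 [M1 [P1 [Q1 H1]]]] [K2 [M2 [P2 [Q2 H2]]]].
  exists (K1 + K2)%R, (Rmax M1 M2). split; [lra|]. split; [eapply Rle_trans; [exact Q1|apply Rmax_l]|].
  intros z Dz Hz. eapply Rle_trans; [apply Cmod_triangle|]. rewrite Rmult_plus_distr_r.
  apply Rplus_le_compat; [apply H1|apply H2]; auto; eapply Rle_trans; [apply Rmax_l|exact Hz|apply Rmax_r|exact Hz].
Qed.

Lemma bigO_scal D c f s : bigO D f s -> bigO D (fun z => c * f z) s.
Proof.
  intros [K1 [M1 [P1 [Q1 H1]]]].
  exists ((Cmod c + 1) * K1)%R, M1. assert (A := Cmod_ge_0 c).
  split; [apply Rmult_lt_0_compat; lra|]. split; [easy|].
  intros z Dz Hz. rewrite Cmod_mult, Rmult_assoc. specialize (H1 z Dz Hz).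
  apply Rmult_le_compat; [easy|apply Cmod_ge_0|lra|exact H1].
Qed.

Lemma bigO_ext D f g s : (forall z, D z -> 1 <= Cmod z -> f z = g z) -> bigO D f s -> bigO D g s.
Proof.
  intros E [K [M [P [Q H]]]]. exists K, M. split; [easy|]. split; [easy|].
  intros z Dz Hz. rewrite <- E by (auto; lra). auto.
Qed.

Lemma Rpower_le_exp r s s' : 1 <= r -> s <= s' -> Rpower r s <= Rpower r s'.
Proof.
  intros Hr Hs. unfold Rpower. apply exp_le_compat. apply Rmult_le_compat_r; [|easy].
  rewrite <- ln_1. apply ln_le; lra.
Qed.

Lemma bigO_le D f s s' : s <= s' -> bigO D f s -> bigO D f s'.
Proof.
  intros Hs [K [M [P [Q H]]]]. exists K, M. split; [easy|]. split; [easy|].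
  intros z Dz Hz. eapply Rle_trans; [now apply H|]. apply Rmult_le_compat_l; [lra|].
  apply Rpower_le_exp; lra.
Qed.

Lemma bigO_mulz D f s s' : s + 1 <= s' -> bigO D f s -> bigO D (fun z => z * f z) s'.
Proof.
  intros Hs [K [M [P [Q H]]]]. exists K, M. split; [easy|]. split; [easy|].
  intros z Dz Hz. rewrite Cmod_mult. specialize (H z Dz Hz).
  apply Rle_trans with (Cmod z * (K * Rpower (Cmod z) s))%R.
  - apply Rmult_le_compat_l; lra.
  - replace (Cmod z * (K * Rpower (Cmod z) s))%R with (K * Rpower (Cmod z) (s + 1))%R.
    + apply Rmult_le_compat_l; [lra|]. apply Rpower_le_exp; lra.
    + rewrite Rpower_plus, Rpower_1 by lra. ring.
Qed.

Lemma bigO_zpow D a n : bigO D (zpow a n) (- Re a - INR n).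
Proof.
  exists (exp (Rabs (Im (- a - Cnat n)) * PI)), 1%R. split; [apply exp_pos|]. split; [lra|].
  intros z _ _. exact (proj1 (Cmod_Cpower z (- a - Cnat n))).
Qed.

(** The remainder is compared with the modulus of the next power, which is
    stable under multiplication by [z] and under a shift of the index; for every
    [N] this is stronger than a remainder of smaller order than the last term. *)
Definition expands (D : C -> Prop) (f : C -> C) (a : C) (u : nat -> C) : Prop :=
  forall N, bigO D (fun z => f z - sum_n (fun n => u n * zpow a n z) N) (- Re a - INR N - 1).

Lemma expands_ext D f g a u v : (forall z, D z -> 1 <= Cmod z -> f z = g z) -> (forall n, u n = v n) ->
  expands D f a u -> expands D g a v.
Proof.
  intros E F H N. eapply bigO_ext; [|apply (H N)]. intros z Dz Hz. cbv beta. rewrite E by easy.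
  f_equal. apply sum_n_ext. intros n. now rewrite F.
Qed.

Lemma expands_plus D f g a u v : expands D f a u -> expands D g a v ->
  expands D (fun z => f z + g z) a (fun n => u n + v n).
Proof.
  intros F G N. eapply bigO_ext; [|apply bigO_plus; [apply (F N)|apply (G N)]].
  intros z _ _. cbv beta.
  replace (sum_n (fun n => (u n + v n) * zpow a n z) N) with
    (sum_n (fun n => u n * zpow a n z) N + sum_n (fun n => v n * zpow a n z) N).
  - ring.
  - rewrite <- sum_n_Cplus. apply sum_n_ext. intros n. cring.
Qed.

Lemma expands_scal D c f a u : expands D f a u -> expands D (fun z => c * f z) a (fun n => c * u n).
Proof.
  intros F N. eapply bigO_ext; [|apply (bigO_scal D c), (F N)].
  intros z _ _. cbv beta.
  replace (sum_n (fun n => c * u n * zpow a n z) N) with (c * sum_n (fun n => u n * zpow a n z) N).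
  - ring.
  - rewrite <- sum_n_Cscal. apply sum_n_ext. intros n. cring.
Qed.

Lemma expands_mulz D f a u : expands D f (a + 1) u -> expands D (fun z => z * f z) a u.
Proof.
  intros F N. eapply bigO_ext; [|eapply bigO_mulz; [|apply (F N)]].
  - intros z _ Hz. assert (Nz : z <> 0) by (apply Cmod_neq0; lra). cbv beta.
    replace (sum_n (fun n => u n * zpow a n z) N) with (z * sum_n (fun n => u n * zpow (a + 1) n z) N).
    + ring.
    + rewrite <- sum_n_Cscal. apply sum_n_ext. intros n. rewrite <- (zpow_mulz a n z Nz). cring.
  - rewrite re_plus. simpl (Re 1). lra.
Qed.

(** Over the scale of [a], the expansion with leading power [z^(-a-1)] starts with
    a zero coefficient; for [N = 0] its first term is part of the remainder. *)
Lemma expands_shift D f a u : expands D f (a + 1) u -> expands D f a (shift u).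
Proof.
  intros F. intros [|N].
  - apply (bigO_ext D (fun z => (f z - sum_n (fun n => u n * zpow (a + 1) n z) 0) + u 0%nat * zpow (a + 1) 0 z)).
    + intros z _ _. rewrite !sum_O. simpl. ring.
    + apply bigO_plus.
      * eapply bigO_le; [|apply (F 0%nat)]. rewrite re_plus. simpl. lra.
      * apply bigO_scal. eapply bigO_le; [|apply bigO_zpow]. rewrite re_plus. simpl. lra.
  - eapply bigO_ext; [|eapply bigO_le; [|apply (F N)]].
    + intros z _ _. cbv beta. f_equal.
      rewrite sum_n_C_head. simpl. rewrite Cmult_0_l, Cplus_0_l.
      apply sum_n_ext. intros n. now rewrite zpow_shift.
    + rewrite S_INR, re_plus. simpl (Re 1). lra.
Qed.

Lemma poincare_of_expands D f a u :
  expands D f a u -> poincare_expansion (fun y => D (- y)) (fun y => f (- y)) u (fun n y => Cpower (- y) (- a - Cnat n)).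
Proof.
  intros H N eps He. destruct (H N) as [K [M [HK [HM B]]]].
  set (k := exp (- (Rabs (Im (- a - Cnat N)) * PI))). assert (Hk : 0 < k) by apply exp_pos.
  exists (Rmax M (K / (eps * k))). intros y Dy Hy.
  rewrite <- Cmod_opp in Hy. set (z := - y) in *.
  assert (Hz1 : M <= Cmod z) by (eapply Rle_trans; [apply Rmax_l|exact Hy]).
  assert (Hz2 : K / (eps * k) <= Cmod z) by (eapply Rle_trans; [apply Rmax_r|exact Hy]).
  eapply Rle_trans; [apply (B z Dy Hz1)|].
  assert (L := proj2 (Cmod_Cpower z (- a - Cnat N))). fold k in L.
  apply Rle_trans with (eps * (k * Rpower (Cmod z) (Re (- a - Cnat N))))%R; [|apply Rmult_le_compat_l; lra].
  replace (Re (- a - Cnat N)) with (- Re a - INR N)%R by reflexivity.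
  replace (- Re a - INR N - 1)%R with ((- Re a - INR N) + - (1))%R by ring.
  rewrite Rpower_plus, Rpower_Ropp, Rpower_1 by lra.
  set (P := Rpower (Cmod z) (- Re a - INR N)). assert (HP : 0 < P) by apply exp_pos.
  assert (E : K * / Cmod z <= eps * k).
  { apply (Rmult_le_reg_r (Cmod z)); [lra|]. rewrite Rmult_assoc, Rinv_l by lra.
    assert (0 < eps * k) by now apply Rmult_lt_0_compat.
    apply (Rmult_le_compat_l (eps * k)) in Hz2; [|lra].
    replace (eps * k * (K / (eps * k)))%R with K in Hz2 by (field; lra). lra. }
  replace (K * (P * / Cmod z))%R with (P * (K * / Cmod z))%R by ring.
  replace (eps * (k * P))%R with (P * (eps * k))%R by ring.
  apply Rmult_le_compat_l; lra.
Qed.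

(** ** Watson's lemma for the Euler integral *)

Definition sector (delta : R) (z : C) : Prop := (Rabs (Carg z) <= PI / 2 - delta).

Lemma sector_Re delta (z : C) : 0 < delta <= PI / 2 -> sector delta z -> 1 <= Cmod z ->
  Cmod z * sin delta <= Re z.
Proof.
  intros Hd Sz Hz. assert (Nz : z <> 0) by (apply Cmod_neq0; lra).
  destruct (Carg_spec z Nz) as [E _].
  replace (Re z) with (Cmod z * cos (Carg z))%R by (rewrite E; field; lra).
  apply Rmult_le_compat_l; [lra|].
  now apply cos_sector.
Qed.

(** An exponentially small error is smaller than every power. *)
Lemma laplace_int_expand delta a d s : 0 < delta <= PI / 2 -> 1 < Re a -> 1 < Re d ->
  bigO (sector delta) (fun z => laplace_int a z - beta_const a d * Cpower z (- a)) s.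
Proof.
  intros Hdel Ha Hd.
  destruct (laplace_int_asym a _ delta Ha Hdel (laplace_int_lim_const a d Ha Hd)) as [K [HK H]].
  fold (beta_const a d) in H.
  assert (Pd : 0 < sin delta) by (apply sin_gt_0; [lra|generalize PI_RGT_0; lra]).
  (* The power of [|z|] that the exponential has to absorb. *)
  set (sg := Rmax 1 (- Re a - s)).
  assert (Sg : 0 < sg) by (eapply Rlt_le_trans; [apply Rlt_0_1|apply Rmax_l]).
  destruct (pow_exp_bound sg (sin delta / 2) Sg ltac:(lra)) as [K2 [HK2 H2]].
  set (k := exp (Rabs (Im (- a)) * PI)). assert (Hk : 0 < k) by apply exp_pos.
  exists (K * k * K2)%R, 1%R. split; [apply Rmult_lt_0_compat; [now apply Rmult_lt_0_compat|easy]|]. split; [lra|].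
  intros z Sz Hz. assert (Nz : z <> 0) by (apply Cmod_neq0; lra).
  specialize (H (Cmod z) (Carg z) Hz Sz). fold (Clog z) in H.
  unfold laplace_log in H. rewrite (Cexp_Clog z Nz) in H. fold (Cpower z a) in H.
  set (E := Cpower z a * laplace_int a z - beta_const a d) in *.
  replace (laplace_int a z - beta_const a d * Cpower z (- a)) with (E * Cpower z (- a)).
  2:{ unfold E. assert (X : Cpower z a * Cpower z (- a) = 1).
      { rewrite <- Cpower_plus. replace (a + - a) with (RtoC 0) by ring. unfold Cpower. rewrite Cmult_0_l. apply Cexp_0. }
      transitivity ((Cpower z a * Cpower z (- a)) * laplace_int a z - beta_const a d * Cpower z (- a)); [ring|]. rewrite X. ring. }
  rewrite Cmod_mult.
  assert (U := proj1 (Cmod_Cpower z (- a))). fold k in U. replace (Re (- a)) with (- Re a)%R in U by reflexivity.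
  set (r := Cmod z) in *.
  specialize (H2 r ltac:(lra)).
  assert (B : Rpower r (- Re a) <= Rpower r sg * Rpower r s).
  { rewrite <- Rpower_plus. apply Rpower_le_exp; [easy|]. unfold sg. generalize (Rmax_r 1 (- Re a - s)). lra. }
  set (e := exp (- (sin delta / 2 * r))) in *. assert (He : 0 < e) by apply exp_pos.
  apply Rle_trans with ((K * e) * (k * (Rpower r sg * Rpower r s)))%R.
  - apply Rmult_le_compat; [apply Cmod_ge_0|apply Cmod_ge_0|exact H|].
    eapply Rle_trans; [exact U|]. apply Rmult_le_compat_l; lra.
  - replace (K * e * (k * (Rpower r sg * Rpower r s)))%R with (K * k * (Rpower r sg * e) * Rpower r s)%R by ring.
    apply Rmult_le_compat_r; [left; apply exp_pos|].
    apply Rmult_le_compat_l; [left; now apply Rmult_lt_0_compat|exact H2].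
Qed.

Lemma cauchy_rows (p q : nat -> C) t N :
  sum_n (fun n => cauchy_prod p q n * t ^ n) N =
  sum_n (fun k => q k * t ^ k * sum_n (fun j => p j * t ^ j) (N - k)) N.
Proof.
  induction N as [|N IH].
  - unfold cauchy_prod. repeat (rewrite sum_O; cbv beta). simpl Nat.sub. cring.
  - rewrite sum_n_C_S, IH, (sum_n_C_S (fun k => q k * t ^ k * _)), Nat.sub_diag, sum_O.
    rewrite (sum_n_C_ext_le (fun k => q k * t ^ k * sum_n (fun j => p j * t ^ j) (S N - k))
      (fun k => q k * t ^ k * sum_n (fun j => p j * t ^ j) (N - k) + t ^ S N * (p (S N - k)%nat * q k))).
    + rewrite sum_n_Cplus, sum_n_Cscal. unfold cauchy_prod. rewrite sum_n_C_S, Nat.sub_diag.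
      rewrite Cpow_S. simpl (t ^ 0). cring.
    + intros k Hk. rewrite Nat.sub_succ_l, sum_n_C_S by easy.
      replace (t ^ S N) with (t ^ k * t ^ S (N - k)) by (rewrite <- Cpow_add_r; f_equal; lia). cring.
Qed.

(** The truncated Cauchy product stops its rows at different orders, which have
    to be estimated with one constant. *)
Lemma onemt_taylor_unif d N : 1 < Re d -> exists K, 0 < K /\ forall j t, (j <= N)%nat -> 0 <= t <= 1 ->
  Rle (Cmod (rpow (d - 1) (1 - t) - sum_n (fun m => (bc (1 - d) m * RtoC t ^ m)%C) j)) (K * t ^ S j).
Proof.
  intros Hd. induction N as [|N [K [HK H]]].
  - destruct (onemt_taylor d 0 Hd) as [K [HK H]]. exists K. split; [easy|].
    intros j t Hj Ht. replace j with 0%nat by lia. now apply H.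
  - destruct (onemt_taylor d (S N) Hd) as [K' [HK' H']]. exists (K + K')%R. split; [lra|].
    intros j t Hj Ht. assert (Pt : 0 <= t ^ S j) by (apply pow_le; lra).
    destruct (Nat.eq_dec j (S N)) as [->|Ne].
    + eapply Rle_trans; [now apply H'|]. apply Rmult_le_compat_r; lra.
    + eapply Rle_trans; [apply H; [lia|easy]|]. apply Rmult_le_compat_r; lra.
Qed.

Lemma integrand_taylor d b x N : 1 < Re d -> slit (1 - x) ->
  exists K, 0 < K /\ forall t, 0 <= t <= 1 ->
  Rle (Cmod (rpow (d - 1) (1 - t) * kern b x t - sum_n (fun n => (hsum d b x n * RtoC t ^ n)%C) N)) (K * t ^ S N).
Proof.
  intros Hd Sx.
  destruct (onemt_taylor_unif d N Hd) as [K1 [HK1 H1]].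
  destruct (kern_taylor b x N Sx) as [K2 [HK2 H2]].
  set (A := sum_n (fun k => Cmod (bc b k * x ^ k)) N).
  assert (HA : 0 <= A).
  { unfold A. clear. induction N as [|N IH]; [rewrite sum_O; apply Cmod_ge_0|].
    rewrite sum_Sn. apply Rplus_le_le_0_compat; [exact IH|apply Cmod_ge_0]. }
  exists (K2 + K1 * A)%R. split. { assert (0 <= K1 * A) by (apply Rmult_le_pos; lra). lra. }
  intros t Ht. specialize (H2 t Ht).
  set (F := rpow (d - 1) (1 - t)) in *. set (G := kern b x t) in *.
  assert (HF : Cmod F <= 1).
  { apply Cmod_rpow_le_1; [lra|]. left. now apply Re_m1. }
  set (Q := sum_n (fun m => bc b m * x ^ m * RtoC t ^ m) N) in *.
  replace (F * G - sum_n (fun n => hsum d b x n * RtoC t ^ n) N) with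
    (F * (G - Q) + sum_n (fun k => bc b k * x ^ k * RtoC t ^ k * (F - sum_n (fun j => bc (1 - d) j * RtoC t ^ j) (N - k))) N).
  - eapply Rle_trans; [apply Cmod_triangle|]. rewrite Rmult_plus_distr_r. apply Rplus_le_compat.
    + rewrite Cmod_mult. assert (P := Cmod_ge_0 (G - Q)). assert (P2 := Cmod_ge_0 F).
      apply Rle_trans with (1 * Cmod (G - Q))%R; [now apply Rmult_le_compat_r|]. now rewrite Rmult_1_l.
    + eapply Rle_trans; [apply Cmod_sum|]. unfold A.
      replace (K1 * sum_n (fun k => Cmod (bc b k * x ^ k)) N * t ^ S N)%R with
        (sum_n (fun k => (K1 * t ^ S N) * Cmod (bc b k * x ^ k))%R N).
      * assert (X : forall u v : nat -> R, (forall k, (k <= N)%nat -> u k <= v k) -> sum_n u N <= sum_n v N).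
        { clear. intros u v H. induction N as [|N IH]; [rewrite !sum_O; now apply H|].
          rewrite !sum_Sn. unfold plus; simpl. apply Rplus_le_compat; [apply IH; intros; apply H; lia|now apply H]. }
        apply X. intros k Hk.
        rewrite !Cmod_mult, (Cmod_pow (RtoC t)), Cmod_R, Rabs_pos_eq by lra.
        specialize (H1 (N - k)%nat t ltac:(lia) Ht).
        set (B := (Cmod (bc b k) * Cmod (x ^ k))%R).
        assert (HB : 0 <= B) by (apply Rmult_le_pos; apply Cmod_ge_0).
        apply Rle_trans with (B * t ^ k * (K1 * t ^ S (N - k)))%R.
        -- apply Rmult_le_compat_l; [apply Rmult_le_pos; [easy|apply pow_le; lra]|exact H1].
        -- right. replace (S N) with (k + S (N - k))%nat by lia. rewrite pow_add. ring.
      * transitivity (K1 * t ^ S N * sum_n (fun k => Cmod (bc b k * x ^ k)) N)%R; [|rring].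
        apply (sum_n_mult_l (K := R_Ring)).
  - unfold hsum. rewrite cauchy_rows.
    rewrite (sum_n_ext _ (fun k => F * (bc b k * x ^ k * RtoC t ^ k) + (- (1)) * (bc b k * x ^ k * RtoC t ^ k * sum_n (fun j => bc (1 - d) j * RtoC t ^ j) (N - k)))).
    + rewrite sum_n_Cplus, !sum_n_Cscal. fold Q. ring.
    + intros k. cring.
Qed.

Lemma CGamma_n c n : ~ nonpos_int c -> CGamma (c + Cnat n) = poch c n * CGamma c.
Proof.
  intros Hc. induction n as [|n IH].
  - replace (c + Cnat 0) with c by (rewrite Cnat_0; ring). simpl. ring.
  - rewrite Cnat_S, Cplus_assoc, CGamma_S by now apply not_nonpos_plus. rewrite IH. simpl. ring.
Qed.

Lemma beta_const_n a c n : 1 < Re a -> 1 < Re (c - a) ->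
  beta_const (a + Cnat n) (c - a) = poch a n * (beta_int a (c - a) * (CGamma c / CGamma (c - a))).
Proof.
  intros Ha Hd. destruct (admissible_base a c Ha Hd) as [Hc Hda].
  unfold beta_const. replace (a + Cnat n + (c - a)) with (c + Cnat n) by ring.
  rewrite CGamma_n by easy.
  transitivity (beta_int (a + Cnat n) (c - a) * poch c n * (CGamma c / CGamma (c - a))); [unfold Cdiv; ring|].
  assert (I := beta_int_n_l a (c - a) n Ha Hd). replace (a + (c - a)) with c in I by ring. rewrite I. ring.
Qed.

(** Watson's lemma. The Taylor polynomial of [(1-t)^(d-1) (1-x t)^(-b)] is
    integrated against [t^(a-1) e^(-z t)] term by term; its remainder
    [O(t^(N+1))] contributes [O((Re z)^(-a-N-1))], and [Re z >= |z| sin delta]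
    in the sector. *)
Lemma watson_base delta a b c x : 0 < delta <= PI / 2 -> 1 < Re a -> 1 < Re (c - a) -> cut_plane x ->
  expands (sector delta) (fun z => Phi1 a b c x (- z)) a (ucoef a b c x).
Proof.
  intros Hdel Ha Hd Hx N.
  assert (Sx := proj1 (cut_plane_slit x) Hx).
  set (d := c - a) in *.
  assert (HB := beta_int_neq0 a d Ha Hd).
  destruct (integrand_taylor d b x N Hd Sx) as [K [HK H]].
  assert (HaN : 0 < Re a + INR N) by (generalize (pos_INR N); lra).
  destruct (real_laplace_bound (Re a + INR N) HaN) as [K1 [HK1 W]].
  assert (Pd : 0 < sin delta) by (apply sin_gt_0; [lra|generalize PI_RGT_0; lra]).
  set (rem := fun z t => rpow (a - 1) t * (rpow (d - 1) (1 - t) * kern b x t - sum_n (fun n => hsum d b x n * RtoC t ^ n) N) * Cexp (- z * RtoC t)).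
  assert (Cs : C01 (fun t => sum_n (fun n => hsum d b x n * RtoC t ^ n) N)).
  { apply (C01_sum (fun n t => hsum d b x n * RtoC t ^ n)). intros n. apply C01_scal, C01_pow, C01_t. }
  assert (Cf : C01 (fun t => rpow (d - 1) (1 - t) * kern b x t)).
  { apply C01_mult; [now apply C01_rpow1, Re_m1|now apply C01_kern]. }
  assert (Cr : forall z, C01 (rem z)).
  { intros z. apply C01_mult; [|apply C01_exp]. apply C01_mult; [now apply C01_rpow, Re_m1|now apply C01_minus]. }
  assert (dec : forall z, Phi1 a b c x (- z) - sum_n (fun n => ucoef a b c x n * zpow a n z) N =
     / beta_int a d * CInt (rem z) + sum_n (fun n => / beta_int a d * hsum d b x n * (laplace_int (a + Cnat n) z - beta_const (a + Cnat n) d * Cpower z (- (a + Cnat n)))) N).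
  { intros z. rewrite (proj1 (Phi1_base a b c x (- z) Ha Hd Hx)). fold d. unfold phi_int.
    assert (E : CInt (fun t => weight a d 0 t * kern b x t * Cexp (- z * RtoC t)) =
       CInt (rem z) + sum_n (fun n => hsum d b x n * laplace_int (a + Cnat n) z) N).
    { rewrite (sum_n_ext _ (fun n => CInt (fun t => hsum d b x n * (rpow (a + Cnat n - 1) t * Cexp (- z * RtoC t))))).
      2:{ intros n. unfold laplace_int. rewrite CInt_scal; [reflexivity|]. apply C01_laplace. now apply Re_pn. }
      assert (Cg : forall n, C01 (fun t => hsum d b x n * (rpow (a + Cnat n - 1) t * Cexp (- z * RtoC t)))).
      { intros n. apply C01_scal, C01_laplace. now apply Re_pn. }
      rewrite <- (CInt_sum (fun n t => hsum d b x n * (rpow (a + Cnat n - 1) t * Cexp (- z * RtoC t)))) by exact Cg.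
      rewrite <- CInt_plus; [|apply Cr|now apply (C01_sum (fun n t => hsum d b x n * (rpow (a + Cnat n - 1) t * Cexp (- z * RtoC t))))].
      apply CInt_ext. intros t Ht.
      rewrite (sum_n_ext _ (fun n => rpow (a - 1) t * Cexp (- z * RtoC t) * (hsum d b x n * RtoC t ^ n))).
      - rewrite sum_n_Cscal. unfold rem, weight. simpl. ring.
      - intros n. replace (a + Cnat n - 1) with (a - 1 + Cnat n) by ring. rewrite rpow_nat. cring. }
    rewrite E.
    rewrite (sum_n_ext (fun n => ucoef a b c x n * zpow a n z) (fun n => / beta_int a d * (hsum d b x n * beta_const (a + Cnat n) d * Cpower z (- (a + Cnat n))))).
    2:{ intros n. unfold d. rewrite beta_const_n by easy. unfold ucoef, zpow. fold d.
        replace (- a - Cnat n) with (- (a + Cnat n)) by ring.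
        match goal with |- ?l = ?r => change (@eq C l r) end. field. split; [|exact HB]. apply CGamma_neq0, (admissible_base a c Ha Hd). }
    rewrite (sum_n_ext (fun n => / beta_int a d * hsum d b x n * (laplace_int (a + Cnat n) z - beta_const (a + Cnat n) d * Cpower z (- (a + Cnat n))))
      (fun n => / beta_int a d * (hsum d b x n * laplace_int (a + Cnat n) z) + (- (1)) * (/ beta_int a d * (hsum d b x n * beta_const (a + Cnat n) d * Cpower z (- (a + Cnat n)))))).
    2:{ intros n. cring. }
    rewrite sum_n_Cplus, !sum_n_Cscal. ring. }
  apply (bigO_ext _ _ _ _ (fun z _ _ => eq_sym (dec z))).
  apply bigO_plus.
  - apply bigO_scal.
    exists (2 * (K * (K1 * Rpower (sin delta) (- Re a - INR N - 1))))%R, 1%R.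
    split. { assert (0 < K * (K1 * Rpower (sin delta) (- Re a - INR N - 1))); [|lra].
      apply Rmult_lt_0_compat; [easy|]. apply Rmult_lt_0_compat; [easy|apply exp_pos]. }
    split; [lra|]. intros z Sz Hz.
    assert (Rz := sector_Re delta z Hdel Sz Hz).
    assert (Pz : 0 < Cmod z * sin delta) by (apply Rmult_lt_0_compat; lra).
    set (g := fun t => (K * (Cmod (rpow (RtoC (Re a + INR N)) t) * exp (- (Re z * t))))%R).
    assert (I : is_RInt g 0 1 (K * real_laplace (Re a + INR N) (Re z))%R).
    { apply (is_RInt_scal (V := R_NormedModule)). apply (RInt_correct (V := R_CompleteNormedModule)), ex_real_laplace. easy. }
    assert (B : Cmod (CInt (rem z)) <= 2 * RInt g 0 1).
    { apply CInt_bound; [apply Cr|eexists; exact I|].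
      intros t Ht. unfold rem, g. rewrite !Cmod_mult, Cmod_Cexp, Cmod_rpow, Cmod_rpow_real by lra.
      replace (Re (- z * RtoC t)) with (- (Re z * t))%R by (rewrite re_scal_r, re_opp; ring).
      rewrite <- Rmult_assoc. apply Rmult_le_compat_r; [left; apply exp_pos|].
      specialize (H t ltac:(lra)).
      apply Rle_trans with (Rpower t (Re (a - 1)) * (K * t ^ S N))%R.
      - apply Rmult_le_compat_l; [left; apply exp_pos|exact H].
      - right. rewrite <- Rpower_pow by lra. replace (Re (a - 1)) with (Re a - 1)%R by reflexivity.
        rewrite S_INR. replace (Re a + INR N)%R with ((Re a - 1) + (INR N + 1))%R by ring.
        rewrite (Rpower_plus (Re a - 1)). ring. }
    eapply Rle_trans; [exact B|]. rewrite (is_RInt_unique _ _ _ _ I).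
    specialize (W (Re z) ltac:(lra)).
    replace (2 * (K * (K1 * Rpower (sin delta) (- Re a - INR N - 1))) * Rpower (Cmod z) (- Re a - INR N - 1))%R with
      (2 * (K * (K1 * (Rpower (Cmod z) (- Re a - INR N - 1) * Rpower (sin delta) (- Re a - INR N - 1)))))%R by ring.
    rewrite Rpower_mult_distr by lra.
    apply Rmult_le_compat_l; [lra|]. apply Rmult_le_compat_l; [lra|].
    eapply Rle_trans; [exact W|]. apply Rmult_le_compat_l; [lra|].
    replace (- (Re a + INR N) - 1)%R with (- (Re a + INR N + 1))%R by ring.
    replace (- Re a - INR N - 1)%R with (- (Re a + INR N + 1))%R by ring.
    rewrite !Rpower_Ropp. apply Rinv_le_contravar; [apply exp_pos|].
    apply Rle_Rpower_l; lra.
  - assert (S : forall M, bigO (sector delta) (fun z => sum_n (fun n => / beta_int a d * hsum d b x n *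
       (laplace_int (a + Cnat n) z - beta_const (a + Cnat n) d * Cpower z (- (a + Cnat n)))) M) (- Re a - INR N - 1)).
    { assert (T : forall n, bigO (sector delta) (fun z => / beta_int a d * hsum d b x n *
       (laplace_int (a + Cnat n) z - beta_const (a + Cnat n) d * Cpower z (- (a + Cnat n)))) (- Re a - INR N - 1)).
      { intros n. apply bigO_scal, laplace_int_expand; auto using Re_pn. }
      induction M as [|M IH].
      - eapply bigO_ext; [|apply (T 0%nat)]. intros z _ _. now rewrite sum_O.
      - eapply bigO_ext; [|apply bigO_plus; [apply IH|apply (T (S M))]]. intros z _ _. now rewrite sum_n_C_S. }
    apply S.
Qed.

(** The contiguous relations hold for the functions and for the coefficients, so
    the expansion passes from the shifted parameters to [a] and [c]. *)
Lemma Phi1_expands delta a c : 0 < delta <= PI / 2 -> admissible a c -> forall b x, cut_plane x ->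
  expands (sector delta) (fun z => Phi1 a b c x (- z)) a (ucoef a b c x).
Proof.
  intros Hdel. revert a c.
  apply (parameter_induction (fun a c => forall b x, cut_plane x ->
    expands (sector delta) (fun z => Phi1 a b c x (- z)) a (ucoef a b c x))).
  - intros a c Ha Hd b x Hx. now apply watson_base.
  - intros a c O H1 H2 b x Hx.
    set (k := a / (c * (c + 1))).
    apply (expands_ext _ (fun z => Phi1 a b (c + 1) x (- z) + (- k * (z * Phi1 (a + 1) b (c + 2) x (- z)) + k * (b * x) * Phi1 (a + 1) (b + 1) (c + 2) x (- z))) _ _
       (fun n => ucoef a b (c + 1) x n + (- k * ucoef (a + 1) b (c + 2) x n + k * (b * x) * shift (ucoef (a + 1) (b + 1) (c + 2) x) n))).
    + intros z _ _. rewrite (Phi1_contiguous a b c _ _ _ _ _ x (- z) (contiguous_d a c (proj1 O)) O (admissible_d _ _ O) (admissible_ad _ _ O) Hx).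
      fold k. ring.
    + intros n. symmetry. now apply ucoef_d.
    + apply expands_plus; [now apply H1|]. apply expands_plus; apply expands_scal.
      * apply expands_mulz. now apply H2.
      * apply expands_shift. now apply H2.
  - intros a c O H1 H2 b x Hx.
    set (k := (c - a) / (c * (c + 1))).
    apply (expands_ext _ (fun z => Phi1 (a + 1) b (c + 1) x (- z) + (k * (z * Phi1 (a + 1) b (c + 2) x (- z)) + - k * (b * x) * Phi1 (a + 1) (b + 1) (c + 2) x (- z))) _ _
       (fun n => shift (ucoef (a + 1) b (c + 1) x) n + (k * ucoef (a + 1) b (c + 2) x n + - k * (b * x) * shift (ucoef (a + 1) (b + 1) (c + 2) x) n))).
    + intros z _ _. rewrite (Phi1_contiguous a b c _ _ _ _ _ x (- z) (contiguous_a a c (proj1 O)) O (admissible_a _ _ O) (admissible_ad _ _ O) Hx).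
      fold k. ring.
    + intros n. symmetry. now apply ucoef_a.
    + apply expands_plus; [apply expands_shift; now apply H1|]. apply expands_plus; apply expands_scal.
      * apply expands_mulz. now apply H2.
      * apply expands_shift. now apply H2.
Qed.

(** * The polynomials in the coefficients *)

Lemma poch_neg_nat n k : (k <= n)%nat -> (- (1)) ^ k * poch (- Cnat n) k * Cfact (n - k) = Cfact n.
Proof.
  induction k as [|k IH]; intros Hk.
  - rewrite Nat.sub_0_r. simpl. ring.
  - rewrite <- IH by lia. replace (n - k)%nat with (S (n - S k)) by lia.
    rewrite Cfact_S. replace (S (n - S k)) with (n - k)%nat by lia.
    replace (Cnat (n - k)) with (Cnat n - Cnat k).
    + simpl. ring.
    + unfold Cnat. rewrite minus_INR, RtoC_minus by lia. reflexivity.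
Qed.

Lemma poch_neg_nat_0 n k : (n < k)%nat -> poch (- Cnat n) k = 0.
Proof.
  induction k as [|k IH]; intros Hk; [lia|]. simpl.
  destruct (Nat.eq_dec k n) as [->|Ne]; [ring|]. rewrite IH by lia. ring.
Qed.

Lemma poch_reflect d n k : (k <= n)%nat ->
  poch (1 - d) n = (- (1)) ^ k * poch (d - Cnat n) k * poch (1 - d) (n - k).
Proof.
  induction k as [|k IH]; intros Hk.
  - rewrite Nat.sub_0_r. simpl. ring.
  - rewrite IH by lia. replace (n - k)%nat with (S (n - S k)) by lia. simpl.
    replace (Cnat (n - S k)) with (Cnat n - Cnat k - 1).
    + ring.
    + unfold Cnat. rewrite minus_INR, RtoC_minus, S_INR, RtoC_plus by lia. ring.
Qed.

Definition delta_at (k : nat) : nat -> C := Nat.iter k shift (fun n => match n with O => 1 | S _ => 0 end).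

Lemma delta_at_spec k n : delta_at k n = if Nat.eq_dec n k then 1 else 0.
Proof.
  revert n. induction k as [|k IH]; intros [|n]; simpl; try reflexivity.
  unfold delta_at in *. simpl. rewrite IH. destruct (Nat.eq_dec n k), (Nat.eq_dec (S n) (S k)); try reflexivity; lia.
Qed.

Lemma continues_fext u f g : (forall x, f x = g x) -> continues u f -> continues u g.
Proof.
  intros E [A B]. split.
  - intros z Hz. destruct (A z Hz) as [r [v [Hr V]]]. exists r, v. split; [easy|].
    intros y Hy. rewrite <- E. now apply V.
  - intros x Hx. rewrite <- E. now apply B.
Qed.

Lemma ps_const (c w : C) : Cis_pseries (fun n => match n with O => c | S _ => RtoC 0 end) w c.
Proof.
  apply Cis_pseries_Clim. apply (Clim_ext (fun _ => c)); [|apply Clim_const].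
  intros n. induction n as [|n IH]; [rewrite sum_O; simpl; cring|]. rewrite sum_n_C_S, <- IH. cring.
Qed.

Lemma continues_pow k : continues (delta_at k) (fun x => x ^ k).
Proof.
  induction k as [|k IH].
  - split.
    + intros z Hz. exists 1%R, (delta_at 0). split; [lra|]. intros y _. apply ps_const.
    + intros x _. apply ps_const.
  - exact (continues_mulx _ _ IH).
Qed.

Lemma continues_poly (u : nat -> C) n :
  continues (fun m => if le_dec m n then u m else 0) (fun x => sum_n (fun k => u k * x ^ k) n).
Proof.
  induction n as [|n IH].
  - apply (continues_fext _ (fun x => u 0%nat * x ^ 0)); [intros x; now rewrite sum_O|].
    eapply continues_ext; [|apply continues_scal, continues_pow]. intros m. cbv beta. rewrite delta_at_spec.
    destruct (Nat.eq_dec m 0) as [E|E], (le_dec m 0); try lia; [subst m|]; ring.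
  - apply (continues_fext _ (fun x => sum_n (fun k => u k * x ^ k) n + u (S n) * x ^ S n)).
    { intros x. now rewrite sum_n_C_S. }
    eapply continues_ext; [|apply continues_plus; [exact IH|apply continues_scal, continues_pow]].
    intros m. cbv beta. rewrite delta_at_spec.
    destruct (Nat.eq_dec m (S n)) as [->|Ne].
    + destruct (le_dec (S n) n), (le_dec (S n) (S n)); try lia. ring.
    + destruct (le_dec m n), (le_dec m (S n)); try lia; ring.
Qed.

(** Reversing the Pochhammer symbols, [(1-d)_n = (-1)^k (d-n)_k (1-d)_(n-k)],
    turns the terms of [(1-d)_n 2F1[-n, b; d-n; x]] into those of the Cauchy
    product. For [d] not a positive integer the Gauss function is this
    polynomial because its series terminates; otherwise the sum is the
    definition. *)
Lemma poch_hyp2f1_hsum a b c x n : ~ nonpos_int (c - a) -> cut_plane x ->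
  poch_hyp2f1 a b c x n = Cfact n * hsum (c - a) b x n.
Proof.
  intros Hd Hx. unfold poch_hyp2f1, hsum, cauchy_prod. rewrite <- sum_n_Cscal.
  set (d := c - a) in *. replace (a - c + 1) with (1 - d) by (unfold d; ring).
  destruct (excluded_middle_informative (pos_int d)) as [P|P].
  - apply sum_n_C_ext_le. intros k Hk. rewrite <- (poch_neg_nat n k Hk). unfold bc.
    field. split; apply Cfact_neq0.
  - assert (Nd : ~ nonpos_int (d - Cnat n)).
    { intros [m E]. assert (Ed : d = Cnat n - Cnat m).
      { replace d with (d - Cnat n + Cnat n) by ring. rewrite E. ring. }
      destruct (le_lt_dec n m) as [L|L].
      - apply Hd. exists (m - n)%nat. rewrite Ed. unfold Cnat. rewrite minus_INR, RtoC_minus by lia. ring.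
      - apply P. exists (n - m - 1)%nat. rewrite Ed. replace (S (n - m - 1)) with (n - m)%nat by lia.
        unfold Cnat. rewrite minus_INR, RtoC_minus by lia. reflexivity. }
    assert (A : continues (gauss_coef (- Cnat n) b (d - Cnat n)) (fun x => sum_n (fun k => gauss_coef (- Cnat n) b (d - Cnat n) k * x ^ k) n)).
    { eapply continues_ext; [|apply continues_poly]. intros m. cbv beta. destruct (le_dec m n); [reflexivity|].
      unfold gauss_coef. rewrite poch_neg_nat_0 by lia. unfold Cdiv. ring. }
    rewrite (continues_unique _ _ _ (hyp2f1_of_continues _ _ _ _ A) A x Hx), <- sum_n_Cscal.
    apply sum_n_C_ext_le. intros k Hk. rewrite (poch_reflect d n k Hk), <- (poch_neg_nat n k Hk).
    unfold gauss_coef, bc. field.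
    repeat split; try apply Cfact_neq0. now apply poch_neq0.
Qed.

Theorem theorem3p2 (a b c : C) (delta : R) (x : C)
    (hc : ~ nonpos_int c) (hca : ~ nonpos_int (c - a))
    (hdelta : 0 < delta <= PI / 2)
    (hx1 : x <> 1) (hx : Rabs (Carg (1 - x)) < PI) :
  poincare_expansion
    (fun y => (Rabs (Carg (- y)) <= PI / 2 - delta))
    (fun y => Phi1 a b c x y)
    (fun n => CGamma c / CGamma (c - a)
                * (poch_hyp2f1 a b c x n * poch a n / Cfact n))
    (fun n y => Cpower (- y) (- a - Cnat n)).
Proof.
  assert (Hx : cut_plane x) by (split; assumption).
  assert (O : admissible a c) by (split; assumption).
  assert (E : expands (sector delta) (fun z => Phi1 a b c x (- z)) a
    (fun n => CGamma c / CGamma (c - a) * (poch_hyp2f1 a b c x n * poch a n / Cfact n))).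
  { eapply expands_ext; [reflexivity| |now apply (Phi1_expands delta a c hdelta O b x)].
    intros n. rewrite poch_hyp2f1_hsum by assumption. unfold ucoef. field.
    split; [apply Cfact_neq0|now apply CGamma_neq0]. }
  intros N eps He. destruct (poincare_of_expands _ _ _ _ E N eps He) as [M HM].
  exists M. intros y Dy Hy. specialize (HM y Dy Hy). cbv beta in HM.
  replace (- - y) with y in HM by ring. exact HM.
Qed.
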